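(* There exist absolute constants $c_0,c_1>0$ such that the following holds in the Gaussian linear model. If $N\ge c_0$ and $\Sigma$ is such that $k_b^*<N/4$ for some $b\ge\max(4/\kappa_{DM},24)$, then $$\mathbb E\|\Sigma^{1/2}(\hat\beta-\beta^* )\|_2^2\ge\frac{c_1}{b^2}\max\Big\{\frac{\sigma_\xi^2k_b^*}{N},\ \frac{\sigma_\xi^2N\,\mathrm{Tr}(\Sigma_{k_b^*+1:p}^2)}{\mathrm{Tr}^2(\Sigma_{k_b^*+1:p})},\ \|\Sigma_{k_b^*+1:p}^{1/2}\beta^*_{k_b^*+1:p}\|_2^2,\ \|\Sigma_{1:k_b^*}^{-1/2}\beta^*_{1:k_b^*}\|_2^2\Big(\frac{\mathrm{Tr}(\Sigma_{k_b^*+1:p})}{N}\Big)^2\Big\}.$$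
   Context: Gaussian linear model: $N\in\mathbb N$, $p\in\mathbb N\cup\{\infty\}$ (for $p=\infty$ read $\mathbb R^p$ as $\ell_2$ and $\Sigma$ as trace class); $\Sigma$ is a $p\times p$ covariance matrix with eigenvalues $\sigma_1\ge\cdots\ge\sigma_p>0$ and orthonormal eigenvectors $u_1,\dots,u_p$. $y=\mathbb X\beta^*+\xi$, where the rows of the $N\times p$ matrix $\mathbb X$ are i.i.d. $\mathcal N(0,\Sigma)$, $\xi\sim\mathcal N(0,\sigma_\xi^2I_N)$ is independent of $\mathbb X$, and $\beta^*\in\mathbb R^p$ is arbitrary. $\hat\beta\in\mathrm{argmin}\{\|\beta\|_2:\mathbb X\beta=y\}$. For $k\ge0$, $\Sigma_{1:k}=\sum_{j\le k}\sigma_ju_ju_j^\top$, $\Sigma_{k+1:p}=\sum_{j>k}\sigma_ju_ju_j^\top$, $\Sigma_{1:k}^{-1/2}=\sum_{j\le k}\sigma_j^{-1/2}u_ju_j^\top$; $v_{1:k},v_{k+1:p}$ are the orthogonal projections of $v$ onto $\mathrm{span}(u_j:j\le k)$ and $\mathrm{span}(u_j:j>k)$. $r_k(\Sigma)=\mathrm{Tr}(\Sigma_{k+1:p})/\|\Sigma_{k+1:p}\|_{op}$ and $k_b^*=\min\{k\ge0:r_k(\Sigma)\ge bN\}$ ($+\infty$ if the set is empty). $\kappa_{DM}\in(0,1]$ is an absolute constant for which the Gaussian Dvoretzky–Milman theorem holds: there is an absolute $c>0$ such that, for every norm $|||\cdot|||$ with unit ball $B$ and dual unit ball $B^*$, with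 $\ell^*(B^* )=\mathbb E\sup_{x\in B^*}\langle x,g\rangle$ ($g$ standard Gaussian) and $d_*(B)=(\ell^*(B^* )/\sup_{x\in B^*}\|x\|_2)^2$, if $N\le\kappa_{DM}d_*(B)$ then with probability at least $1-\exp(-c\,d_*(B))$, for all $\lambda\in\mathbb R^N$, $\frac1{\sqrt2}\|\lambda\|_2\ell^*(B^* )\le|||G^\top\lambda|||\le\sqrt{3/2}\|\lambda\|_2\ell^*(B^* )$, $G$ being an $N\times p$ matrix with i.i.d. $\mathcal N(0,1)$ entries. *)

(* Defs.v *)
From HB Require Import structures.
From mathcomp Require Import all_boot all_order all_algebra.
From mathcomp Require Import all_classical all_reals all_analysis.

Set Implicit Arguments.
Unset Strict Implicit.
Unset Printing Implicit Defensive.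

Import Order.TTheory GRing.Theory Num.Theory.
Import numFieldNormedType.Exports.

Local Open Scope classical_set_scope.
Local Open Scope ring_scope.

(** * Vectors and operators in dimension p, where p is finite or infinite *)

(* [Some n] is the dimension n, [None] is p = oo.  Coordinates are numbered
   from 0, so that "j <= k" for the usual numbering from 1 reads [val j < k]. *)
Definition in_dim (p : option nat) (j : nat) : bool :=
  if p is Some n then (j < n)%N else true.

Definition idx (p : option nat) : Type := {j : nat | in_dim p j}.

Section Vectors.
Variables (R : realType) (p : option nat).

Definition vec := idx p -> R.

Definition zext (a : vec) (j : nat) : R := oapp a 0 (insub j).

(* For p finite the sequence of partial sums is eventually constant.  For
   p = oo the value is meaningful when the series converges, which is the case
   at all uses below. *)
Definition psum (a : vec) : R := limn (series (zext a)).

Definition dot (x y : vec) : R := psum (fun i => x i * y i).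

Definition norm2 (x : vec) : R := Num.sqrt (dot x x).

(* R^p if p is finite, and l_2 if p = oo. *)
Definition Rp : set vec :=
  [set x | cvgn (series (zext (fun i => x i ^+ 2)))].

Definition vsub (x y : vec) : vec := fun i => x i - y i.

Definition basis_vec (i : idx p) : vec := fun j => (i == j)%:R.

Definition mulmv (S : idx p -> vec) (v : vec) : vec := fun i => dot (S i) v.

Definition trace (A : vec -> vec) : R :=
  psum (fun i => dot (basis_vec i) (A (basis_vec i))).

Definition opnorm (A : vec -> vec) : R :=
  sup [set norm2 (A v) | v in [set v | Rp v /\ norm2 v <= 1]].

(* [S] is a p x p covariance matrix (trace class if p = oo) with eigenvalues
   [sigma] in nonincreasing order, with multiplicity, all positive, and [u] is
   an orthonormal basis of eigenvectors.  These conditions determine S: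
   S i l = \sum_j sigma_j u_j(i) u_j(l). *)
Record is_covariance (S : idx p -> vec) (sigma : vec) (u : idx p -> vec) :
    Prop := IsCovariance {
  cov_rows : forall i, Rp (S i) ;
  cov_basis_Rp : forall j, Rp (u j) ;
  cov_orthonormal : forall j l, dot (u j) (u l) = (j == l)%:R ;
  cov_complete : forall v, Rp v -> (forall j, dot (u j) v = 0) ->
    forall i, v i = 0 ;
  cov_eigen : forall j i, mulmv S (u j) i = sigma j * u j i ;
  cov_pos : forall j, 0 < sigma j ;
  cov_noninc : forall j l, (val j <= val l)%N -> sigma l <= sigma j ;
  cov_trace : cvgn (series (zext sigma))
}.

Section Spectral.
Variables (sigma : vec) (u : idx p -> vec).

(* \sum_j f_j u_j u_j^T *)
Definition spec (f : vec) (v : vec) : vec :=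
  fun i => psum (fun j => f j * dot (u j) v * u j i).

Definition head (k : nat) (f : vec) : vec :=
  fun j => if (val j < k)%N then f j else 0.

Definition tail (k : nat) (f : vec) : vec :=
  fun j => if (val j < k)%N then 0 else f j.

Definition Sigma_sqrt : vec -> vec := spec (fun j => Num.sqrt (sigma j)).

Definition Sigma_tail (k : nat) : vec -> vec := spec (tail k sigma).

Definition Sigma_tail_sqrt (k : nat) : vec -> vec :=
  spec (tail k (fun j => Num.sqrt (sigma j))).

Definition Sigma_head_invsqrt (k : nat) : vec -> vec :=
  spec (head k (fun j => (Num.sqrt (sigma j))^-1)).

Definition proj_head (k : nat) : vec -> vec := spec (head k (fun=> 1)).

Definition proj_tail (k : nat) : vec -> vec := spec (tail k (fun=> 1)).

(* r_k(Sigma); for k >= p this is 0 / 0 = 0. *)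
Definition eff_rank (k : nat) : R :=
  trace (Sigma_tail k) / opnorm (Sigma_tail k).

(* k_b^* = k; no k satisfies this when k_b^* = +oo. *)
Definition is_kstar (b : R) (N k : nat) : Prop :=
  b * N%:R <= eff_rank k /\
  forall l : nat, b * N%:R <= eff_rank l -> (k <= l)%N.

End Spectral.

End Vectors.

(** * Gaussian laws and independence *)

(* N(0, v).  The library's [normal_prob m s], parametrized by the standard
   deviation s, is not the Dirac mass for s = 0. *)
Definition centered_normal (R : realType) (v : R)
    (B : set (measurableTypeR R)) : \bar R :=
  if v == 0 then \d_(0 : measurableTypeR R) B else normal_prob 0 (Num.sqrt v) B.

Section Probability.
Context (R : realType) (d : measure_display) (T : measurableType d)
  (P : probability T R).

Definition has_centered_normal_law (Z : T -> R) (v : R) : Prop :=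
  measurable_fun [set: T] Z /\
  forall B : set (measurableTypeR R), measurable B ->
    P (Z @^-1` B) = centered_normal v B.

Definition sigma_gen (I : Type) (Z : I -> T -> R) : set (set T) :=
  <<s \bigcup_(i in [set: I])
        preimage_set_system [set: T] (Z i)
          (@measurable _ (measurableTypeR R)) >>.

(* The events [A i] may be taken equal to [setT], so that the product rule for
   the whole family implies the product rule for its subfamilies. *)
Definition mutually_independent (I : finType) (F : I -> set (set T)) : Prop :=
  forall A : I -> set T, (forall i, F i (A i)) ->
    P (\bigcap_(i in [set: I]) A i) = (\prod_(i : I) P (A i))%E.

Definition independent2 (F G : set (set T)) : Prop :=
  forall A B, F A -> G B -> P (A `&` B) = (P A * P B)%E.

Definition iid_standard_normal (I : finType) (Z : I -> T -> R) : Prop :=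
  (forall i, has_centered_normal_law (Z i) 1) /\
  mutually_independent (fun i => sigma_gen (fun _ : unit => Z i)).

(** * The Gaussian linear model and its minimum-norm interpolator *)

Definition is_argmin_norm (p : option nat) (C : set (vec R p)) (x : vec R p) :
    Prop :=
  C x /\ forall z, C z -> norm2 x <= norm2 z.

(* Solutions b in R^p of X b = y. *)
Definition interpolators (p : option nat) (N : nat) (X : 'I_N -> vec R p)
    (y : 'I_N -> R) : set (vec R p) :=
  [set b | Rp b /\ forall i, dot (X i) b = y i].

(* A random vector is Gaussian with covariance S when each linear functional v
   of it has law N(0, <v, S v>). *)
Record gaussian_linear_model (p : option nat) (N : nat) (S : idx p -> vec R p)
    (beta : vec R p) (sxi : R) (X : 'I_N -> T -> vec R p) (xi : 'I_N -> T -> R)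
    (bhat : T -> vec R p) : Prop := GaussianLinearModel {
  glm_beta : Rp beta ;
  glm_sxi : 0 <= sxi ;
  glm_X_Rp : forall i w, Rp (X i w) ;
  glm_X_meas : forall i j, measurable_fun [set: T] (fun w => X i w j) ;
  glm_X_gauss : forall i v, Rp v ->
    has_centered_normal_law (fun w => dot (X i w) v) (dot v (mulmv S v)) ;
  glm_X_indep :
    mutually_independent (fun i => sigma_gen (fun j w => X i w j)) ;
  glm_xi_gauss : forall a : 'I_N -> R,
    has_centered_normal_law (fun w => \sum_i a i * xi i w)
      (sxi ^+ 2 * \sum_i a i ^+ 2) ;
  glm_X_xi_indep : independent2
    (sigma_gen (fun (ij : 'I_N * idx p) w => X ij.1 w ij.2)) (sigma_gen xi) ;
  glm_bhat_meas : forall j, measurable_fun [set: T] (fun w => bhat w j) ;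
  (* the argmin is empty when X b = y has no solution *)
  glm_bhat : {ae P, forall w,
    let C := interpolators (fun i => X i w)
               (fun i => dot (X i w) beta + xi i w) in
    C !=set0 -> is_argmin_norm C (bhat w)}
}.

End Probability.

(** * The Gaussian Dvoretzky-Milman theorem *)

Section DvoretzkyMilman.
Variable R : realType.

Definition cdot (p : nat) (x y : 'cV[R]_p) : R := \sum_i x i 0 * y i 0.

Definition cnorm2 (p : nat) (x : 'cV[R]_p) : R := Num.sqrt (cdot x x).

Record is_norm (p : nat) (nrm : 'cV[R]_p -> R) : Prop := IsNorm {
  nrm_definite : forall x, nrm x = 0 -> x = 0 ;
  nrm_scale : forall (a : R) x, nrm (a *: x) = `|a| * nrm x ;
  nrm_triangle : forall x y, nrm (x + y) <= nrm x + nrm y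
}.

Definition dual_ball (p : nat) (nrm : 'cV[R]_p -> R) : set 'cV[R]_p :=
  [set x | forall y, nrm y <= 1 -> cdot x y <= 1].

(* l^*(B^* ), where g is a standard Gaussian vector; only the law of g
   matters. *)
Definition ell_star (p : nat) (nrm : 'cV[R]_p -> R) (d : measure_display)
    (T : measurableType d) (P : probability T R) (g : T -> 'cV[R]_p) : R :=
  fine ('E_P[fun w => sup [set cdot x (g w) | x in dual_ball nrm]])%E.

Definition dvoretzky_dim (p : nat) (nrm : 'cV[R]_p -> R) (ell : R) : R :=
  (ell / sup [set cnorm2 x | x in dual_ball nrm]) ^+ 2.

Definition is_kappa_DM (kappa : R) : Prop :=
  [/\ 0 < kappa, kappa <= 1 &
  exists2 c : R, 0 < c &
  forall (p N : nat) (nrm : 'cV[R]_p -> R), is_norm nrm ->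
  forall (d : measure_display) (T : measurableType d) (P : probability T R)
    (g : T -> 'cV[R]_p) (G : T -> 'M[R]_(N, p)),
  iid_standard_normal P (fun (i : 'I_p) w => g w i 0) ->
  iid_standard_normal P (fun (ij : 'I_N * 'I_p) w => G w ij.1 ij.2) ->
  let ell := ell_star nrm P g in
  let dstar := dvoretzky_dim nrm ell in
  let event := [set w | forall lam : 'cV[R]_N,
    (Num.sqrt 2)^-1 * cnorm2 lam * ell <= nrm ((G w)^T *m lam) /\
    nrm ((G w)^T *m lam) <= Num.sqrt (3 / 2) * cnorm2 lam * ell] in
  N%:R <= kappa * dstar ->
  ((1 - expR (- (c * dstar)))%:E <= P event)%E].

End DvoretzkyMilman.

(* Main.v *)
(* Fix an eigenvector u_j and write X X^T = a a^T + B, where a = X u_j and B is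
   the Gram matrix of the rows of X deprived of their component along u_j.
   With y = beta_j a + e, the normal equations of the interpolator give
     <u_j, bhat - beta> = (a^T B^-1 e - beta_j) / (1 + a^T B^-1 a),
   where a is independent of (B, e).
   - Bias: by symmetry of the law of a, conditionally on (B, e) the number
     a^T B^-1 e has the sign opposite to beta_j with probability at least 1/2,
     and then the square is at least beta_j^2 / (1 + a^T B^-1 a)^2.
   - Variance: integrating over the noise alone leaves at least
     sxi^2 |B^-1 a|^2 / (1 + a^T B^-1 a)^2, and |B^-1 a| >= a^T B^-1 a / |a|.
   Conditionally on B, a^T B^-1 a is of order sigma_j Tr(B^-1) (Markov above,
   Paley-Zygmund below), so it remains to see that Tr(B^-1) is of order N / t
   with t = Tr(Sigma_{k+1:p}).
   - Upper bound: (B^-1)_ii is bounded by the inverse of a regularized squared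
     distance of the tail of row i to the span of the tails of the other rows.
     Conditionally on these rows this is a quadratic form in a Gaussian vector,
     of mean of order t since r_k(Sigma) >= b N, and Chebyshev's inequality is
     sharp enough for a union bound over the N rows.
   - Lower bound: on the orthogonal complement of the first k columns, which has
     dimension at least 3 N / 4, B coincides with the Gram matrix of the tails,
     whose trace is at most 4 N t with probability at least 3/4.
   Multiplying by sigma_j and summing over j gives the four terms. *)
Require Import Defs.
From HB Require Import structures.
From mathcomp Require Import all_boot all_order all_algebra.
From mathcomp Require Import all_classical all_reals all_analysis.
From mathcomp Require Import measurable_realfun.
From mathcomp Require Import ring lra.
Set Implicit Arguments.
Unset Strict Implicit.
Unset Printing Implicit Defensive.
Import Order.TTheory GRing.Theory Num.Theory.
Import numFieldNormedType.Exports.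
Local Open Scope classical_set_scope.
Local Open Scope ring_scope.

(** * Normal distributions *)

Section integration.
Context {R : realType}.
Local Notation mu := (@lebesgue_measure R).
Local Open Scope ereal_scope.

Import HBNNSimple.

(** The model prescribes the laws of linear functionals and product rules for sigma-algebras, in a
    dimension that may be infinite, so no joint density is at hand. Independence of X u_j from (B,
    e) is therefore derived from characteristic functions: linear functionals of the two parts are
    uncorrelated and their sums are normal, and the cosines and sines of such functionals generate
    all events concerned. [B] may be singular and there may be no interpolator. The error functional
    is set to 0 where [B] is singular, and the upper bound on Tr(B^-1) brings invertibility with it.
    Infinite sums are truncated: finitely many coordinates already carry 23/24 of t. A ridge keeps
    every inverse meaningful for the truncated matrix and is removed afterwards at the cost of a
    factor 2. The factor 1 / b^2 comes from the ratio sigma_j N / t: by minimality of k it is at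
    least 1 / b for j <= k, and since r_k(Sigma) >= b N it is at most 1 / b for j > k. *)

Lemma ge0_integral_normal_prob (m s : R) (f : measurableTypeR R -> \bar R) :
  measurable_fun [set: measurableTypeR R] f -> (forall x, 0 <= f x) ->
  \int[normal_prob m s]_x f x = \int[mu]_x (f x * (normal_pdf m s x)%:E).
Proof.
move=> mf f0.
pose f_ := nnsfun_approx measurableT mf.
have mpdf : measurable_fun setT (EFin \o normal_pdf m s).
  by apply/measurable_EFinP; exact: measurable_normal_pdf.
have pdf0 x : 0 <= (normal_pdf m s x)%:E by rewrite lee_fin normal_pdf_ge0.
transitivity (limn (fun n => \int[normal_prob m s]_x (f_ n x)%:E)).
  rewrite -monotone_convergence//=.
  - by apply: eq_integral => ? _; apply/esym/cvg_lim => //=; exact: cvg_nnsfun_approx.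
  - by move=> n; exact: measurableT_comp.
  - by move=> n ? _; rewrite lee_fin.
  - by move=> ? _ ? ? mn; rewrite lee_fin; exact/lefP/nd_nnsfun_approx.
transitivity (limn (fun n => \int[mu]_x ((f_ n x)%:E * (normal_pdf m s x)%:E))); last first.
  rewrite -monotone_convergence//=.
  - apply: eq_integral => x _; apply: cvg_lim => //.
    apply: cvgeZr => //; exact: cvg_nnsfun_approx.
  - by move=> n; apply: emeasurable_funM => //; exact: measurableT_comp.
  - by move=> n x _; rewrite mule_ge0// lee_fin.
  - move=> x _ a b ab; rewrite lee_wpmul2r// lee_fin.
    exact/lefP/nd_nnsfun_approx.
apply: congr_lim; apply/funext => n /=.
have fE x : (f_ n x)%:E =
    \sum_(r \in range (f_ n)) (r * \1_(f_ n @^-1` [set r]) x)%:E.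
  by rewrite fsumEFin// -fimfunE.
transitivity (\int[mu]_x (\sum_(r \in range (f_ n))
    ((r * \1_(f_ n @^-1` [set r]) x)%:E * (normal_pdf m s x)%:E))); last first.
  apply: eq_integral => x _; rewrite fE ge0_mule_fsuml// => r.
  exact: nnfun_muleindic_ge0.
under eq_integral => x _ do rewrite fE.
rewrite !ge0_integral_fsum//; last 4 first.
  - move=> r; apply: emeasurable_funM => //; exact/measurable_EFinP/measurable_funM.
  - by move=> r x _; rewrite mule_ge0// nnfun_muleindic_ge0.
  - by move=> r; exact/measurable_EFinP/measurable_funM.
  - by move=> r x _; rewrite nnfun_muleindic_ge0.
apply: eq_fsbigr => r _.
(* The approximations are nonnegative, so a negative [r] has an empty preimage; constants are pulled
   out of the integral only for [r >= 0]. *)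
have [r0|r0] := ltP r 0%R.
  rewrite integral0_eq; last by move=> x _; rewrite preimage_nnfun0// indic0 mulr0.
  by rewrite integral0_eq// => x _; rewrite preimage_nnfun0// indic0 mulr0 mul0e.
under eq_integral => x _ do rewrite EFinM.
under [RHS]eq_integral => x _ do rewrite EFinM -muleA.
rewrite !ge0_integralZl//.
  congr (_ * _); rewrite integral_indic// setIT.
  transitivity (\int[mu]_(x in f_ n @^-1` [set r]) (normal_pdf m s x)%:E) => //.
  rewrite [LHS]integral_mkcond; apply: eq_integral => x _; rewrite patchE indicE.
  by case: ifPn => xr; rewrite ?mul1e ?mul0e.
all: try by rewrite lee_fin.
- by apply: emeasurable_funM => //; exact: measurableT_comp.
- by move=> x _; rewrite mule_ge0// lee_fin.
- exact: measurableT_comp.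
Qed.

(** By uniqueness of Lebesgue measure it suffices to compare the two measures on half-open
    intervals. *)
Lemma lebesgue_measure_addr (c : R) (A : set R) : measurable A ->
  pushforward mu ((fun x => x + c)%R : _ -> measurableTypeR R) A = mu A.
Proof.
move=> mA.
have mphi : measurable_fun setT ((fun x => x + c)%R : measurableTypeR R -> measurableTypeR R).
  exact: measurable_funD.
pose mp := isMeasurableFun.Build _ _ _ _ _ mphi.
pose mpack : {mfun _ >-> _} := HB.pack ((fun x => x + c)%R : measurableTypeR R -> measurableTypeR R) mp.
apply/esym; apply: (@lebesgue_measure_unique R (pushforward mu mpack)) => //= _ [[a b]] _ <-.
rewrite /pushforward/= [X in _ = mu X](_ : _ = `](a - c)%R, (b - c)%R]%classic); last first.
  by apply/seteqP; split => x /=; rewrite !in_itv/= lerBrDr ltrBlDr.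
rewrite !lebesgue_measure_itv/= !lte_fin ltrD2r.
by case: ifPn => // _; rewrite -!EFinD; congr (_%:E); ring.
Qed.

Lemma ge0_integral_addr (c : R) (f : measurableTypeR R -> \bar R) :
  measurable_fun [set: measurableTypeR R] f -> (forall x, 0 <= f x) ->
  \int[mu]_x f (x + c)%R = \int[mu]_x f x.
Proof.
move=> mf f0.
have mphi : measurable_fun setT ((fun x => x + c)%R : measurableTypeR R -> measurableTypeR R).
  exact: measurable_funD.
rewrite -[LHS](ge0_integral_pushforward mphi mu measurableT mf)//.
by apply: eq_measure_integral => A mA _; exact: lebesgue_measure_addr.
Qed.

End integration.

(** * Normal densities: exponential tilting and convolution *)

Section normal.
Context {R : realType}.
Local Notation mu := (@lebesgue_measure R).

Lemma normal_pdf_gt0E (s : R) (m x : R) : s != 0 ->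
  normal_pdf m s x = (Num.sqrt (s ^+ 2 * pi *+ 2))^-1 *
    expR (- (x - m) ^+ 2 / (s ^+ 2 *+ 2)).
Proof. by move=> s0; rewrite normal_pdfE. Qed.

(* Completing the square. *)
Lemma normal_pdf_mul (s t x z : R) : 0 < s -> 0 < t ->
  normal_pdf 0 (Num.sqrt s) x * normal_pdf 0 (Num.sqrt t) (z - x) =
  normal_pdf 0 (Num.sqrt (s + t)) z *
  normal_pdf (s * z / (s + t)) (Num.sqrt (s * t / (s + t))) x.
Proof.
move=> s0 t0; have st0 : 0 < s + t by rewrite addr_gt0.
have r0 : 0 < s * t / (s + t) by rewrite divr_gt0// mulr_gt0.
rewrite !normal_pdf_gt0E ?gt_eqF ?sqrtr_gt0//.
rewrite !sqr_sqrtr ?ltW//.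
rewrite mulrACA [RHS]mulrACA -!invfM -!expRD; congr (_ * _).
  rewrite -!sqrtrM; try by rewrite mulrn_wge0// mulr_ge0 ?ltW// pi_gt0.
  congr (_^-1); congr Num.sqrt.
  by move: pi => q; field; rewrite gt_eqF.
congr expR; rewrite !subr0; field.
by rewrite !gt_eqF.
Qed.

(** Exponential tilting: a factor e^{tx} moves the mean from 0 to s^2 t. The second and fourth
    moments are later derived from this identity. *)
Lemma normal_pdf_shift (s t x : R) : s != 0 ->
  normal_pdf 0 s x * expR (t * x) =
  expR (s ^+ 2 * t ^+ 2 / 2) * normal_pdf 0 s (x - s ^+ 2 * t).
Proof.
move=> s0; rewrite !normal_pdf_gt0E// -[LHS]mulrA [RHS]mulrCA -!expRD.
by congr (_ * expR _); rewrite !subr0; field.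
Qed.

Local Open Scope ereal_scope.

Lemma ge0_integral_normal_exp (s t : R) (f : measurableTypeR R -> \bar R) :
  s != 0%R -> measurable_fun [set: measurableTypeR R] f -> (forall x, 0 <= f x) ->
  \int[normal_prob 0 s]_x (f x * (expR (t * x))%:E) =
  (expR (s ^+ 2 * t ^+ 2 / 2))%:E *
  \int[normal_prob 0 s]_x f (x + s ^+ 2 * t)%R.
Proof.
move=> s0 mf f0.
have mfc : measurable_fun [set: measurableTypeR R] (fun x => f (x + s ^+ 2 * t)%R).
  by apply: measurableT_comp => //; exact: measurable_funD.
have mex : measurable_fun [set: measurableTypeR R] (fun x : R => (expR (t * x))%:E).
  apply: measurableT_comp => //.
  exact: (measurableT_comp (@measurable_expR R) (@mulrl_measurable R setT t)).
rewrite !ge0_integral_normal_prob//; last 2 first.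
- exact: emeasurable_funM.
- by move=> x; rewrite mule_ge0// lee_fin expR_ge0.
have mpdf c : measurable_fun [set: measurableTypeR R] (fun x : R => (normal_pdf 0 s (x - c))%:E).
  apply: measurableT_comp => //; apply: measurableT_comp => //.
    exact: measurable_normal_pdf.
  exact: measurable_funB.
transitivity (\int[mu]_x ((expR (s ^+ 2 * t ^+ 2 / 2))%:E *
   (f x * (normal_pdf 0 s (x - s ^+ 2 * t))%:E))).
  apply: eq_integral => x _; rewrite -muleA -EFinM [(expR _ * _)%R]mulrC.
  by rewrite normal_pdf_shift// EFinM muleCA.
have mg : measurable_fun [set: measurableTypeR R]
    (fun x : measurableTypeR R => f x * (normal_pdf 0 s (x - s ^+ 2 * t))%:E).
  exact: (emeasurable_funM mf (mpdf _)).
have g0 (x : measurableTypeR R) : 0 <= f x * (normal_pdf 0 s (x - s ^+ 2 * t))%:E.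
  by rewrite mule_ge0// lee_fin normal_pdf_ge0.
apply: etrans (ge0_integralZl_EFin mu measurableT (fun x _ => g0 x) mg (expR_ge0 _)) _.
apply: (congr1 (mule _)); apply: etrans (esym (ge0_integral_addr (s ^+ 2 * t)%R mg g0)) _.
by apply: eq_integral => x _; rewrite addrK.
Qed.

(** In the variables x and z = x + y, [normal_pdf_mul] factors the joint density into the density of
    z times a normal density in x, which integrates to 1 after Tonelli. *)
Lemma integral_normal_conv (s t : R) (f : measurableTypeR R -> \bar R) :
  (0 < s)%R -> (0 < t)%R ->
  measurable_fun [set: measurableTypeR R] f -> (forall x, 0 <= f x) ->
  \int[normal_prob 0 (Num.sqrt s)]_x \int[normal_prob 0 (Num.sqrt t)]_y
     f (x + y)%R = \int[normal_prob 0 (Num.sqrt (s + t))]_x f x.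
Proof.
move=> s0 t0 mf f0.
have mpdf m c : measurable_fun [set: measurableTypeR R] (fun x : R => (normal_pdf m c x)%:E).
  apply: measurableT_comp => //; exact: measurable_normal_pdf.
have pdf0 m c (x : R) : 0 <= (normal_pdf m c x)%:E by rewrite lee_fin normal_pdf_ge0.
have mfc x : measurable_fun [set: measurableTypeR R] (fun y => f (x + y)%R).
  by apply: measurableT_comp => //; exact: measurable_funD.
have mfD : measurable_fun [set: measurableTypeR R * measurableTypeR R]
    (fun u : measurableTypeR R * measurableTypeR R => f (u.1 + u.2)%R).
  by apply: measurableT_comp => //; exact: measurable_funD.
have mpB : measurable_fun [set: measurableTypeR R * measurableTypeR R]
    (fun u : measurableTypeR R * measurableTypeR R => (normal_pdf 0 (Num.sqrt t) (u.2 - u.1))%:E).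
  apply: measurableT_comp => //; apply: measurableT_comp => //.
    exact: measurable_normal_pdf.
  exact: measurable_funB.
have mint : measurable_fun [set: measurableTypeR R]
    (fun x => \int[normal_prob 0 (Num.sqrt t)]_y f (x + y)%R).
  apply: (@measurable_fun_fubini_tonelli_F _ _ (measurableTypeR R)
    (measurableTypeR R) R (normal_prob 0 (Num.sqrt t))
    (fun u => f (u.1 + u.2)%R)) => //.
apply: etrans (ge0_integral_normal_prob _ _ mint _) _.
  by move=> x; apply: integral_ge0.
rewrite [RHS](ge0_integral_normal_prob _ _ mf f0).
pose F (u : measurableTypeR R * measurableTypeR R) :=
  f u.2 * ((normal_pdf 0 (Num.sqrt s) u.1)%:E *
           (normal_pdf 0 (Num.sqrt t) (u.2 - u.1))%:E).
have mF : measurable_fun setT F.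
  apply: emeasurable_funM; first exact: measurableT_comp.
  apply: emeasurable_funM => //.
  exact: (measurableT_comp (mpdf _ _)).
have F0 u : 0 <= F u by rewrite /F !mule_ge0.
transitivity (\int[mu]_x \int[mu]_z F (x, z)).
  apply: eq_integral => x _.
  have mg : measurable_fun [set: measurableTypeR R] (fun y : measurableTypeR R =>
      f (x + y)%R * (normal_pdf 0 (Num.sqrt t) y)%:E).
    exact: (emeasurable_funM (mfc x) (mpdf _ _)).
  have g0 (y : measurableTypeR R) : 0 <= f (x + y)%R * (normal_pdf 0 (Num.sqrt t) y)%:E.
    by rewrite mule_ge0.
  have mFx : measurable_fun [set: measurableTypeR R] (fun z => F (x, z)).
    by apply: (measurableT_comp mF); exact: measurable_pair1.
  rewrite (ge0_integral_normal_prob _ _ (mfc x))// muleC.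
  apply: etrans (esym (ge0_integralZl_EFin mu measurableT (fun y _ => g0 y) mg (normal_pdf_ge0 _ _ _))) _.
  apply: etrans (ge0_integral_addr x mFx (fun z => F0 (x, z))).
  by apply: eq_integral => y _; rewrite /F/= addrK muleCA addrC.
rewrite (fubini_tonelli F)//.
apply: eq_integral => z _.
transitivity (\int[mu]_x ((f z * (normal_pdf 0 (Num.sqrt (s + t)) z)%:E) *
  (normal_pdf (s * z / (s + t)) (Num.sqrt (s * t / (s + t))) x)%:E)).
  by apply: eq_integral => x _; rewrite /F/= -muleA -!EFinM normal_pdf_mul.
rewrite ge0_integralZl//; last by rewrite mule_ge0.
by rewrite integral_normal_pdf mule1.
Qed.

End normal.

(** * Moments of the centered normal distribution *)

Section moments.
Context {R : realType}.
Variables (s : R) (s0 : s != 0%R).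
Local Notation nP := (normal_prob 0 s).
Local Open Scope ereal_scope.

Lemma integral_normal_exp (t : R) (f : measurableTypeR R -> R) :
  measurable_fun [set: measurableTypeR R] f ->
  \int[nP]_x (f x * expR (t * x))%:E =
  (expR (s ^+ 2 * t ^+ 2 / 2))%:E * \int[nP]_x (f (x + s ^+ 2 * t)%R)%:E.
Proof.
move=> mf; rewrite integralE [X in _ = _ * X]integralE.
have mfp : measurable_fun [set: measurableTypeR R] (EFin \o f)^\+.
  by apply: measurable_funepos; exact: measurableT_comp.
have mfn : measurable_fun [set: measurableTypeR R] (EFin \o f)^\-.
  by apply: measurable_funeneg; exact: measurableT_comp.
have -> : \int[nP]_x (fun x => (f x * expR (t * x))%:E)^\+ x =
   (expR (s ^+ 2 * t ^+ 2 / 2))%:E * \int[nP]_x (fun x => (f (x + s ^+ 2 * t)%R)%:E)^\+ x.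
  apply: etrans (etrans _ (ge0_integral_normal_exp t s0 mfp _)) _ => //; last first.
    by congr (_ * _); apply: eq_integral => x _; rewrite !funeposE.
  apply: eq_integral => x _; rewrite !funeposE/= -!EFin_max -EFinM.
  by rewrite maxr_pMl ?expR_ge0// mul0r.
have -> : \int[nP]_x (fun x => (f x * expR (t * x))%:E)^\- x =
   (expR (s ^+ 2 * t ^+ 2 / 2))%:E * \int[nP]_x (fun x => (f (x + s ^+ 2 * t)%R)%:E)^\- x.
  apply: etrans (etrans _ (ge0_integral_normal_exp t s0 mfn _)) _ => //; last first.
    by congr (_ * _); apply: eq_integral => x _; rewrite !funenegE.
  apply: eq_integral => x _; rewrite !funenegE/= -!EFin_max -EFinM.
  by rewrite maxr_pMl ?expR_ge0// mul0r mulNr.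
(* Either part may be infinite; multiplication by the positive constant still distributes over the
   extended difference, case by case. *)
have c0 := expR_gt0 (s ^+ 2 * t ^+ 2 / 2).
move: (\int[_]_x _) (\int[_]_x _) => [a||] [b||] //=;
  rewrite ?(gt0_muley, gt0_muleNy) ?lte_fin// -?EFinB -?EFinM -?EFinB ?mulrBr//=.
all: by rewrite ?(addye, addNye, gt0_muley, gt0_muleNy).
Qed.

Lemma integral_normal_expR (t : R) :
  \int[nP]_x (expR (t * x))%:E = (expR (s ^+ 2 * t ^+ 2 / 2))%:E.
Proof.
rewrite -[LHS](_ : \int[nP]_x (1 * expR (t * x))%:E = _); last first.
  by apply: eq_integral => x _; rewrite mul1r.
rewrite (@integral_normal_exp t (cst 1%R))//=.
by rewrite integral_cst// [X in _ * (_ * X)](@probability_setT _ _ _ nP) !mule1.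
Qed.

Lemma exprn_le_fact_expR (n : nat) (x : R) : (0 <= x -> x ^+ n <= n`!%:R * expR x)%R.
Proof.
case: n => [|n] x0; first by rewrite expr0 fact0 mul1r -expR0 ler_expR.
rewrite mulrC -ler_pdivrMr ?ltr0n ?fact_gt0//.
by apply: le_trans (expR_ge1Dxn n x0); rewrite lerDr.
Qed.

(** Bounding |x|^n by n! e^|x|, and e^|y| by e^y + e^-y, leaves exponentials only, whose normal
    integrals are explicit. *)
Lemma exprn_le_cosh (n : nat) (x c : R) : (0 <= c)%R ->
  (`|x| ^+ n * expR (c * `|x|) <= n`!%:R * (expR ((c + 1) * x) + expR (- (c + 1) * x)))%R.
Proof.
move=> c0; apply: (@le_trans _ _ (n`!%:R * expR `|x| * expR (c * `|x|))%R).
  by rewrite ler_pM2r ?expR_gt0// exprn_le_fact_expR.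
rewrite -mulrA -expRD ler_pM2l ?ltr0n ?fact_gt0//.
have [x0|x0] := leP 0%R x.
  by rewrite ger0_norm// (_ : (x + c * x = (c + 1) * x)%R) ?lerDl ?expR_ge0//; ring.
by rewrite ltr0_norm// (_ : (- x + c * - x = - (c + 1) * x)%R) ?lerDr ?expR_ge0//; ring.
Qed.

Lemma integrable_normal_cosh (k c : R) : nP.-integrable setT
  (fun x : measurableTypeR R => (k * (expR (c * x) + expR (- c * x)))%:E).
Proof.
have i a : nP.-integrable setT (fun x : measurableTypeR R => (expR (a * x))%:E).
  apply/integrableP; split.
    apply: measurableT_comp => //.
    exact: (measurableT_comp (@measurable_expR R) (@mulrl_measurable R setT a)).
  under eq_integral => x _ do rewrite gee0_abs ?lee_fin ?expR_ge0//.
  by rewrite integral_normal_expR ltry.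
by under eq_fun => x do rewrite EFinM EFinD; apply: integrableZl => //; exact: integrableD.
Qed.

(** The factor e^{c|x|} is kept because the difference quotients of e^{tx} at t = 0 are dominated by
    |x| e^|x|. *)
Lemma integrable_normal_powM (n : nat) (c : R) : (0 <= c)%R -> nP.-integrable setT
  (fun x : measurableTypeR R => (`|x| ^+ n * expR (c * `|x|))%:E).
Proof.
move=> c0; apply: le_integrable (integrable_normal_cosh n`!%:R (c + 1)) => //.
  apply: measurableT_comp => //; apply: measurable_funM.
    by apply: measurable_funX; exact: normr_measurable.
  apply: (measurableT_comp (@measurable_expR R)).
  exact: (measurableT_comp (@mulrl_measurable R setT c) (@normr_measurable R setT)).
move=> x _; rewrite !gee0_abs ?lee_fin ?mulr_ge0 ?addr_ge0 ?expR_ge0 ?exprn_ge0//.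
exact: exprn_le_cosh.
Qed.

Lemma integrable_normal_pow (n : nat) : nP.-integrable setT
  (fun x : measurableTypeR R => (x ^+ n)%:E).
Proof.
apply: (le_integrable measurableT _ _ (integrable_normal_powM n (lexx 0%R))).
  by apply: measurableT_comp => //; exact: exprn_measurable.
move=> x _; rewrite mul0r expR0 mulr1 abse_EFin lee_fin normrX.
exact: ler_norm.
Qed.

Lemma integral_normalN (f : measurableTypeR R -> R) :
  measurable_fun [set: measurableTypeR R] f ->
  \int[nP]_x (f (- x)%R)%:E = \int[nP]_x (f x)%:E.
Proof.
have H (g : measurableTypeR R -> \bar R) : measurable_fun [set: measurableTypeR R] g ->
  (forall x, 0 <= g x) -> \int[nP]_x g (- x)%R = \int[nP]_x g x.
  move=> mg g0.
  have mN : measurable_fun [set: measurableTypeR R] (-%R : measurableTypeR R -> measurableTypeR R).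
    exact: oppr_measurable.
  have mpdf : measurable_fun [set: measurableTypeR R] (fun x : measurableTypeR R => (normal_pdf 0 s x)%:E).
    by apply: measurableT_comp => //; exact: measurable_normal_pdf.
  have mh : measurable_fun [set: measurableTypeR R]
    (fun x : measurableTypeR R => g x * (normal_pdf 0 s x)%:E).
    exact: (emeasurable_funM mg mpdf).
  rewrite (ge0_integral_normal_prob _ _ (measurableT_comp mg mN)); last first.
    by move=> x; exact: g0.
  rewrite (ge0_integral_normal_prob _ _ mg)//.
  transitivity (\int[pushforward (@lebesgue_measure R) (-%R : measurableTypeR R -> measurableTypeR R)]_x
    (g x * (normal_pdf 0 s x)%:E)).
    rewrite (ge0_integral_pushforward mN _ measurableT mh); last first.
      by move=> x _; rewrite mule_ge0// lee_fin normal_pdf_ge0.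
    apply: eq_integral => x _ /=.
    by rewrite !normal_pdf_gt0E// !subr0 sqrrN.
  by apply: eq_measure_integral => A mA _; exact: lebesgue_measureN.
move=> mf; rewrite integralE [RHS]integralE; congr (_ - _).
  apply: etrans (etrans _ (H (fun x => (EFin \o f)^\+ x) _ _)) _ => //.
    by apply: eq_integral => x _; rewrite !funeposE.
  by apply: measurable_funepos; exact: measurableT_comp.
apply: etrans (etrans _ (H (fun x => (EFin \o f)^\- x) _ _)) _ => //.
  by apply: eq_integral => x _; rewrite !funenegE.
by apply: measurable_funeneg; exact: measurableT_comp.
Qed.

Lemma norm_expRB1 (u : R) : (`|expR u - 1| <= `|u| * expR `|u|)%R.
Proof.
have H (v : R) : (expR v - 1 <= v * expR v)%R.
  have := expR_ge1Dx (- v); rewrite -(ler_pM2r (expR_gt0 v)) -expRD addNr expR0.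
  by rewrite mulrDl mul1r mulNr => ?; lra.
have [u0|u0] := leP 0%R u.
  by rewrite !ger0_norm ?H// subr_ge0 -expR0 ler_expR.
rewrite ltr0_norm ?ltr0_norm//; last by rewrite subr_lt0 -expR0 ltr_expR.
have := expR_ge1Dx u => h; apply: (@le_trans _ _ (- u)%R); first by lra.
by rewrite ler_peMr ?oppr_ge0 1?ltW// -expR0 ltr_expR oppr_gt0.
Qed.

Lemma cvg_natmul_expRB1 (x : R) :
  (fun n : nat => n.+1%:R * (expR (n.+1%:R^-1 * x) - 1))%R @ \oo --> x.
Proof.
have ni : (fun n : nat => n.+1%:R^-1 * x)%R @ \oo --> (0%R : R).
  by rewrite -[X in _ --> X](mul0r x); apply: cvgMl; exact: cvg_harmonic.
have hi : (fun n : nat => x * expR (n.+1%:R^-1 * x))%R @ \oo --> x.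
  have e0 : (fun n : nat => expR (n.+1%:R^-1 * x))%R @ \oo --> (expR 0 : R).
    by apply: (cvg_comp _ _ ni); exact: continuous_expR.
  by rewrite -[X in _ --> X]mulr1; apply: cvgMr; rewrite expR0 in e0.
apply: (squeeze_cvgr _ (cvg_cst x) hi); near=> n.
have n0 : (0 < n.+1%:R :> R)%R by rewrite ltr0n.
set u := (n.+1%:R^-1 * x)%R; have xu : (x = n.+1%:R * u)%R.
  by rewrite /u mulrA mulfV ?mul1r// gt_eqF.
have -> : (x * expR u = n.+1%:R * (u * expR u))%R by rewrite mulrA -xu.
rewrite {1}xu !ler_pM2l//; apply/andP; split.
  by have := expR_ge1Dx u => ?; lra.
have := expR_ge1Dx (- u); rewrite -(ler_pM2r (expR_gt0 u)) -expRD addNr expR0.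
by rewrite mulrDl mul1r mulNr => ?; lra.
Unshelve. all: end_near. Qed.

(** Differentiation under the integral sign: the moment of order k + 1 is the derivative at t = 0 of
    the integral of x^k e^{tx}, taken along t = 1 / (n + 1). *)
Lemma cvg_integral_normal_step (k : nat) :
  (fun n : nat => \int[nP]_x (x ^+ k * (n.+1%:R * (expR (n.+1%:R^-1 * x) - 1)))%:E) @ \oo -->
  \int[nP]_x (x ^+ k.+1)%:E.
Proof.
have mk j : measurable_fun [set: measurableTypeR R] (fun x : measurableTypeR R => (x ^+ j)%R).
  exact: exprn_measurable.
have me a : measurable_fun [set: measurableTypeR R] (fun x : measurableTypeR R => expR (a * x)).
  exact: (measurableT_comp (@measurable_expR R) (@mulrl_measurable R setT a)).
have [] // := @dominated_convergence _ _ _ nP setT measurableT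
  (fun (n : nat) (x : measurableTypeR R) => (x ^+ k * (n.+1%:R * (expR (n.+1%:R^-1 * x) - 1)))%:E)
  (fun x => (x ^+ k.+1)%:E)
  (fun x => (`|x| ^+ k.+1 * expR (1 * `|x|))%:E).
- move=> n; apply: measurableT_comp => //; apply: measurable_funM => //.
  by apply: measurable_funM => //; exact: measurable_funB.
- exact: measurableT_comp.
- apply: aeW => x _; apply: cvg_EFin; first by near=> n.
  rewrite /comp/= exprSr; apply: cvgMr; exact: cvg_natmul_expRB1.
- exact: integrable_normal_powM.
- apply: aeW => x n _; rewrite abse_EFin lee_fin !normrM normrX exprSr -mulrA.
  rewrite ler_wpM2l ?exprn_ge0// (ger0_norm (ler0n _ _)) mul1r.
  have n0 : (0 < n.+1%:R :> R)%R by rewrite ltr0n.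
  rewrite -ler_pdivlMl//; apply: (le_trans (norm_expRB1 _)).
  rewrite normrM gtr0_norm ?invr_gt0// -mulrA ler_pM2l ?invr_gt0//.
  by rewrite ler_wpM2l// ler_expR ler_piMl// invf_le1// ler1n.
Unshelve. all: end_near. Qed.

Let M k := \int[nP]_x (x ^+ k)%:E.

Let Mfin k : M k \is a fin_num.
Proof. by apply: integrable_fin_num => //; exact: integrable_normal_pow. Qed.

Lemma integral_normal_odd (k : nat) : odd k -> \int[nP]_x (x ^+ k)%:E = 0.
Proof.
move=> ok; have := @integral_normalN (fun x => x ^+ k)%R (@exprn_measurable R setT k).
under eq_integral => x _ do rewrite exprNn -signr_odd ok expr1 EFinM.
rewrite integralZl//; last exact: integrable_normal_pow.
rewrite -/(M k); case: (M k) (Mfin k) => // r _ [] h.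
by congr (_%:E); lra.
Qed.

Lemma integral_normal_sin (c : R) : \int[nP]_x (sin (c * x))%:E = 0.
Proof.
have ms : measurable_fun [set: measurableTypeR R] (fun x : measurableTypeR R => sin (c * x)).
  apply: (@measurableT_comp _ _ _ _ _ _ (@sin R) _ (fun x => c * x)%R); last first.
    exact: mulrl_measurable.
  by apply: continuous_measurable_fun => x; exact: continuous_sin.
have is_ : nP.-integrable setT (fun x : measurableTypeR R => (sin (c * x))%:E).
  apply: (le_integrable measurableT _ _ (integrable_normal_pow 0%N)).
    exact: measurableT_comp.
  by move=> x _; rewrite expr0 !abse_EFin lee_fin normr1 ler_norml sin_geN1 sin_le1.
have := integral_normalN ms.
under eq_integral => x _ do rewrite mulrN sinN -mulN1r EFinM.
rewrite integralZl//.
case: (\int[nP]_x _) (integrable_fin_num measurableT is_) => // r _ [] h.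
by congr (_%:E); lra.
Qed.

Let m k := fine (M k).

(** Tilting expresses the same difference quotient through the k-th moment of a shifted variable, so
    that moments of order at most [k] determine its limit. *)
Let stepE (k n : nat) :
  \int[nP]_x (x ^+ k * (n.+1%:R * (expR (n.+1%:R^-1 * x) - 1)))%:E =
  (n.+1%:R * (expR (s ^+ 2 * n.+1%:R^-1 ^+ 2 / 2) *
    fine (\int[nP]_x ((x + s ^+ 2 * n.+1%:R^-1) ^+ k)%:E) - m k))%:E.
Proof.
have mk j : measurable_fun [set: measurableTypeR R] (fun x : measurableTypeR R => (x ^+ j)%R).
  exact: exprn_measurable.
have me a : measurable_fun [set: measurableTypeR R] (fun x : measurableTypeR R => expR (a * x)).
  exact: (measurableT_comp (@measurable_expR R) (@mulrl_measurable R setT a)).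
set a := (n.+1%:R^-1)%R.
have ie : nP.-integrable setT (fun x : measurableTypeR R => (x ^+ k * expR (a * x))%:E).
  have a0 : (0 <= a)%R by rewrite invr_ge0.
  apply: (le_integrable measurableT _ _ (integrable_normal_powM k a0)).
    by apply: measurableT_comp => //; exact: measurable_funM.
  move=> x _; rewrite !abse_EFin lee_fin !normrM !normrX normr_id ler_wpM2l ?exprn_ge0//.
  rewrite (ger0_norm (expR_ge0 _)) (ger0_norm (expR_ge0 _)) ler_expR -[leRHS]ger0_norm ?mulr_ge0//.
  by rewrite (le_trans (ler_norm _))// !normrM normr_id.
under eq_integral => x _ do
  rewrite mulrCA mulrBr mulr1 EFinM EFinB.
rewrite integralZl//; last by apply: integrableB => //; exact: integrable_normal_pow.
rewrite integralB_EFin//; last exact: integrable_normal_pow.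
have fi : \int[nP]_x ((x + s ^+ 2 * a) ^+ k)%:E \is a fin_num.
  have := integrable_fin_num measurableT ie.
  rewrite integral_normal_exp//.
  move: (expR_gt0 (s ^+ 2 * a ^+ 2 / 2)) (\int[nP]_x _) => c0 [r||]//.
    by rewrite gt0_muley ?lte_fin.
  by rewrite gt0_muleNy ?lte_fin.
rewrite integral_normal_exp// -/(M k) -(fineK (Mfin k)) -{1}(fineK fi).
by [].
Qed.

Let cvg_sqr_harmonic : (fun n : nat => n.+1%:R^-1 ^+ 2)%R @ \oo --> (0 : R)%R.
Proof.
have harm : (fun n : nat => n.+1%:R^-1)%R @ \oo --> (0 : R)%R by exact: cvg_harmonic.
by rewrite -[X in _ --> X](mulr0 (0 : R)%R); exact: (cvgM harm harm).
Qed.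

Let cvg_exp1 : (fun n : nat => expR (s ^+ 2 * n.+1%:R^-1 ^+ 2 / 2))%R @ \oo --> (1 : R)%R.
Proof.
have h : (fun n : nat => s ^+ 2 * n.+1%:R^-1 ^+ 2 / 2)%R @ \oo --> (s ^+ 2 * 0 / 2 : R)%R.
  exact: (cvgM (cvgM (cvg_cst _) cvg_sqr_harmonic) (cvg_cst _)).
have := cvg_comp _ _ h (@continuous_expR R _).
by rewrite mulr0 mul0r expR0; exact: cvg_trans.
Qed.

(** For k = 1 the shifted moment is s^2 / (n + 1), and the quotient reduces to s^2 times an
    exponential tending to 1. *)
Lemma integral_normal_sqr : \int[nP]_x (x ^+ 2)%:E = (s ^+ 2)%:E.
Proof.
have c1 := @cvg_integral_normal_step 1%N.
move: c1; rewrite (funext (@stepE _)) => c1.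
apply: (cvg_unique _ c1) => //=.
have harm : (fun n : nat => n.+1%:R^-1)%R @ \oo --> (0 : R)%R by exact: cvg_harmonic.
have h (n : nat) : \int[nP]_x ((x + s ^+ 2 * n.+1%:R^-1) ^+ 1)%:E =
    (s ^+ 2 * n.+1%:R^-1)%:E.
  under eq_integral => x _ do rewrite expr1 EFinD.
  rewrite integralD//; last 2 first.
  - by have := integrable_normal_pow 1%N; under eq_fun => x do rewrite expr1.
  - exact: finite_measure_integrable_cst.
  rewrite integral_cst// [X in _ + (_ * X)](@probability_setT _ _ _ nP) mule1.
  exact: etrans (congr1 (fun z => z + _) (@integral_normal_odd 1%N isT)) (add0e _).
have m1 : m 1%N = 0%R by rewrite /m /M integral_normal_odd.
apply: cvg_EFin; first by near=> n.
rewrite /comp/=.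
have -> : (fun n : nat => n.+1%:R * (expR (s ^+ 2 * n.+1%:R^-1 ^+ 2 / 2) *
    fine (\int[nP]_x ((x + s ^+ 2 * n.+1%:R^-1) ^+ 1)%:E) - m 1%N))%R =
  (fun n : nat => s ^+ 2 * expR (s ^+ 2 * n.+1%:R^-1 ^+ 2 / 2))%R.
  apply/funext => n; rewrite h m1 subr0/=; set e := expR _.
  by field.
by rewrite -[X in _ --> X]mulr1; apply: cvgMr.
Unshelve. all: end_near. Qed.

(** For k = 3 the shifted moment is 3 s^2 a + a^3 with a = s^2 / (n + 1); after multiplication by n
    + 1 only 3 s^4 survives in the limit. *)
Lemma integral_normal_pow4 : \int[nP]_x (x ^+ 4)%:E = (3 * s ^+ 4)%:E.
Proof.
have c1 := @cvg_integral_normal_step 3%N.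
move: c1; rewrite (funext (@stepE _)) => c1.
apply: (cvg_unique _ c1) => //=.
have harm : (fun n : nat => n.+1%:R^-1)%R @ \oo --> (0 : R)%R by exact: cvg_harmonic.
have h (a : R) : \int[nP]_x ((x + a) ^+ 3)%:E = (3 * s ^+ 2 * a + a ^+ 3)%:E.
  transitivity (\int[nP]_x ((x ^+ 3)%:E + ((3 * a)%:E * (x ^+ 2)%:E +
     ((3 * a ^+ 2)%:E * (x ^+ 1)%:E + (a ^+ 3)%:E)))).
    by apply: eq_integral => x _; rewrite -!EFinM -!EFinD; congr (_%:E); ring.
  have i j := integrable_normal_pow j.
  rewrite !integralD//; try by [exact: finite_measure_integrable_cst
    | exact: integrableZl | exact: integrable_normal_pow
    | repeat (apply: integrableD => //); (exact: integrableZl || exact: finite_measure_integrable_cst)].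
  rewrite !integralZl// integral_cst//.
  rewrite [X in _ + (_ + (_ + _ * X))](@probability_setT _ _ _ nP) mule1.
  rewrite (@integral_normal_odd 3%N isT) (@integral_normal_odd 1%N isT) integral_normal_sqr mule0 !add0e.
  by rewrite -EFinM -EFinD; congr (_%:E); ring.
have m3 : m 3%N = 0%R by rewrite /m /M integral_normal_odd.
apply: cvg_EFin; first by near=> n.
rewrite /comp/=.
have -> : (fun n : nat => n.+1%:R * (expR (s ^+ 2 * n.+1%:R^-1 ^+ 2 / 2) *
    fine (\int[nP]_x ((x + s ^+ 2 * n.+1%:R^-1) ^+ 3)%:E) - m 3%N))%R =
  (fun n : nat => (3 * s ^+ 4 + s ^+ 6 * n.+1%:R^-1 ^+ 2) * expR (s ^+ 2 * n.+1%:R^-1 ^+ 2 / 2))%R.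
  apply/funext => n; rewrite h m3 subr0/=; set e := expR _.
  by field.
rewrite -[X in _ --> X]mulr1; apply: cvgM => //.
rewrite -[X in _ --> X]addr0; apply: cvgD; first exact: cvg_cst.
by rewrite -(mulr0 (s ^+ 6)%R); apply: cvgMr.
Unshelve. all: end_near. Qed.

End moments.

(** * Decoupling and sums of independent normal variables *)

Section decoupling.
Context (R : realType) (d : measure_display) (T : measurableType d)
  (P : probability T R).
Local Open Scope ereal_scope.

Lemma measurable_id_g_sigma (F : set (set T)) : F `<=` measurable ->
  measurable_fun setT (id : T -> g_sigma_algebraType F).
Proof.
move=> mF _ Y mY; rewrite setTI preimage_id.
by apply: (@smallest_sub _ (@sigma_algebra T setT) F measurable) => //; exact: sigma_algebra_measurable.
Qed.

(* Independence of [F] and [G] decouples the two occurrences of [w]. *)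
Lemma ge0_integral_indep (F G : set (set T))
    (phi : g_sigma_algebraType F * g_sigma_algebraType G -> \bar R) :
  F `<=` measurable -> G `<=` measurable ->
  independent2 P <<s F>> <<s G>> ->
  measurable_fun setT phi -> (forall z, 0 <= phi z) ->
  \int[P]_w phi (w, w) = \int[P]_w \int[P]_v phi (w, v).
Proof.
move=> mF mG FG mphi phi0.
have mf := measurable_id_g_sigma mF; have mg := measurable_id_g_sigma mG.
pose hf := isMeasurableFun.Build _ _ _ _ _ mf.
pose hg := isMeasurableFun.Build _ _ _ _ _ mg.
pose f : {mfun T >-> g_sigma_algebraType F} := HB.pack (id : T -> g_sigma_algebraType F) hf.
pose g : {mfun T >-> g_sigma_algebraType G} := HB.pack (id : T -> g_sigma_algebraType G) hg.
have mfg : measurable_fun setT (fun w : T => (f w, g w)) by exact: measurable_fun_pair.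
pose hfg := isMeasurableFun.Build _ _ _ _ _ mfg.
pose fg : {mfun T >-> (g_sigma_algebraType F * g_sigma_algebraType G)%type} :=
  HB.pack (fun w : T => (f w, g w)) hfg.
(* Independence says that the law of the diagonal map w -> (w, w), seen in the two generated
   sigma-algebras, is the product of its marginals; Tonelli then separates the two occurrences. *)
have prodE := @product_measure_unique _ _ _ _ R (distribution P f) (distribution P g)
  (distribution P fg) (fun A B mA mB => FG A B mA mB).
transitivity (\int[distribution P fg]_z phi z).
  by rewrite ge0_integral_distribution.
transitivity (\int[(distribution P f \x distribution P g)]_z phi z).
  by apply: eq_measure_integral => A mA _; exact/esym/prodE.
rewrite fubini_tonelli1//.
rewrite ge0_integral_distribution//; last 2 first.
- exact: measurable_fun_fubini_tonelli_F.
- by move=> x; exact: integral_ge0.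
apply: eq_integral => w _.
by rewrite /= /fubini_F ge0_integral_distribution//; exact: measurable_fun_pair2.
Qed.

End decoupling.

(** * Random variables with a centered normal law *)

Section normal_law.
Context (R : realType) (d : measure_display) (T : measurableType d)
  (P : probability T R).
Local Open Scope ereal_scope.

Lemma ge0_integral_law (Z : T -> R) (v : R) (f : measurableTypeR R -> \bar R) :
  has_centered_normal_law P Z v ->
  measurable_fun [set: measurableTypeR R] f -> (forall x, 0 <= f x) ->
  \int[P]_w f (Z w) =
    if v == 0%R then f 0%R else \int[normal_prob 0 (Num.sqrt v)]_x f x.
Proof.
move=> [mZ lawZ] mf f0.
have mZ' : measurable_fun [set: T] (Z : T -> measurableTypeR R) by [].
rewrite -(ge0_integral_pushforward mZ' P measurableT mf)//.
case: ifPn => v0.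
- rewrite (eq_measure_integral (\d_(0%R : measurableTypeR R))); last first.
    by move=> A mA _; have := lawZ _ mA; rewrite /centered_normal v0.
  by rewrite integral_dirac// diracT mul1e.
- apply: eq_measure_integral => A mA _.
  by have := lawZ _ mA; rewrite /centered_normal (negbTE v0).
Qed.

Lemma integral_law (Z : T -> R) (v : R) (f : measurableTypeR R -> R) :
  has_centered_normal_law P Z v -> measurable_fun [set: measurableTypeR R] f ->
  \int[P]_w (f (Z w))%:E =
    if v == 0%R then (f 0%R)%:E else \int[normal_prob 0 (Num.sqrt v)]_x (f x)%:E.
Proof.
move=> lZ mf; rewrite integralE.
have mfE : measurable_fun [set: measurableTypeR R] (EFin \o f) by exact: measurableT_comp.
have -> : \int[P]_w (fun w => (f (Z w))%:E)^\+ w = \int[P]_w ((EFin \o f)^\+ (Z w)).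
  by apply: eq_integral => w _; rewrite !funeposE.
have -> : \int[P]_w (fun w => (f (Z w))%:E)^\- w = \int[P]_w ((EFin \o f)^\- (Z w)).
  by apply: eq_integral => w _; rewrite !funenegE.
rewrite (ge0_integral_law lZ)//; last exact: measurable_funepos.
rewrite (ge0_integral_law lZ)//; last exact: measurable_funeneg.
case: ifPn => v0; last by rewrite [RHS]integralE.
by have /= <- := congr1 (fun g => g 0%R) (funeposneg (EFin \o f)).
Qed.

Lemma integrable_law (Z : T -> R) (v : R) (f : measurableTypeR R -> R) :
  has_centered_normal_law P Z v -> measurable_fun [set: measurableTypeR R] f ->
  (v != 0%R -> (normal_prob 0 (Num.sqrt v)).-integrable setT (EFin \o f)) ->
  P.-integrable setT (fun w => (f (Z w))%:E).
Proof.
move=> lZ mf fi.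
have mZ : measurable_fun [set: T] (Z : T -> measurableTypeR R) by case: lZ.
have mfE : measurable_fun [set: measurableTypeR R] (EFin \o f) by exact: measurableT_comp.
apply/integrableP; split; first exact: (measurableT_comp mfE mZ).
rewrite (@ge0_integral_law Z v (fun x => `|(f x)%:E|) lZ)//; last exact: measurableT_comp.
by case: ifPn => [_|/fi/integrableP[]//]; rewrite ltry.
Qed.

Variables (Z : T -> R) (v : R) (v0 : (0 <= v)%R) (lZ : has_centered_normal_law P Z v).

Let sv0 : v != 0%R -> Num.sqrt v != 0%R.
Proof. by move=> vn; rewrite gt_eqF// sqrtr_gt0 lt0r vn. Qed.

Lemma law_integrable_pow (n : nat) : P.-integrable setT (fun w => (Z w ^+ n)%:E).
Proof.
apply: (@integrable_law Z v (fun x => x ^+ n)%R lZ); first exact: exprn_measurable.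
by move=> /sv0 s0; exact: integrable_normal_pow.
Qed.

Lemma law_integral_pow1 : \int[P]_w (Z w)%:E = 0.
Proof.
have := @integral_law Z v (fun x => x ^+ 1)%R lZ (@exprn_measurable R setT 1).
rewrite /= => ->; case: ifPn => // /sv0 s0.
by rewrite (integral_normal_odd s0).
Qed.

Lemma law_integral_pow2 : \int[P]_w (Z w ^+ 2)%:E = v%:E.
Proof.
rewrite (@integral_law Z v (fun x => x ^+ 2)%R lZ (@exprn_measurable R setT 2)).
case: ifPn => [/eqP ->|/sv0 s0]; first by rewrite expr0n.
by rewrite (integral_normal_sqr s0) sqr_sqrtr.
Qed.

Lemma law_integral_pow4 : \int[P]_w (Z w ^+ 4)%:E = (3 * v ^+ 2)%:E.
Proof.
rewrite (@integral_law Z v (fun x => x ^+ 4)%R lZ (@exprn_measurable R setT 4)).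
case: ifPn => [/eqP ->|/sv0 s0]; first by rewrite !expr0n mulr0.
by rewrite (integral_normal_pow4 s0) (exprM _ 2 2) sqr_sqrtr.
Qed.

Lemma law_integral_sin : \int[P]_w (sin (Z w))%:E = 0.
Proof.
rewrite (@integral_law Z v (@sin R) lZ); last first.
  by apply: continuous_measurable_fun; exact: continuous_sin.
case: ifPn => [_|/sv0 s0]; first by rewrite sin0.
have := integral_normal_sin s0 1.
by under eq_integral => x _ do rewrite mul1r.
Qed.

Lemma law_oppr : has_centered_normal_law P (fun w => - Z w)%R v.
Proof.
have [mZ lawZ] := lZ; split; first exact: measurable_funN.
move=> B mB.
have mN : measurable_fun [set: measurableTypeR R] (-%R : measurableTypeR R -> measurableTypeR R).
  exact: oppr_measurable.
have mNB : measurable ((-%R : measurableTypeR R -> measurableTypeR R) @^-1` B).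
  by rewrite -[X in measurable X]setTI; exact: mN.
transitivity (P (Z @^-1` (-%R @^-1` B))) => //.
rewrite (lawZ _ mNB) /centered_normal; case: ifPn => vn.
  by rewrite !diracE; congr ((_ : bool)%:R%:E); apply/idP/idP; rewrite !inE/= oppr0.
have mI : measurable_fun [set: measurableTypeR R] (\1_B : measurableTypeR R -> R) by exact: measurable_indic.
have := integral_normalN (sv0 vn) mI.
rewrite (integral_indic (normal_prob 0 (Num.sqrt v)) measurableT mB) setIT => <-.
rewrite -(setIT (_ @^-1` B)) -(integral_indic (normal_prob 0 (Num.sqrt v)) measurableT mNB).
by apply: eq_integral => x _; rewrite !indicE; congr ((_ : bool)%:R%:E); apply/idP/idP; rewrite !inE.
Qed.

(** [Z] and [- Z] have the same law, and the events [Z <= 0] and [0 <= Z] cover the space. *)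
Lemma law_le0_half : (2^-1)%:E <= P [set w | Z w <= 0]%R.
Proof.
have [mZ lawZ] := lZ; have [_ lawN] := law_oppr.
have m0 : measurable (`]-oo, 0%R]%classic : set (measurableTypeR R)) by exact: measurable_itv.
have mle : measurable [set w | Z w <= 0]%R.
  rewrite [X in measurable X](_ : _ = setT `&` Z @^-1` `]-oo, 0%R]%classic); first exact: mZ.
  by rewrite setTI; apply/seteqP; split => w /=; rewrite in_itv.
have mge : measurable [set w | 0 <= Z w]%R.
  rewrite [X in measurable X](_ : _ = setT `&` Z @^-1` `[0%R, +oo[%classic).
    by apply: mZ => //; exact: measurable_itv.
  by rewrite setTI; apply/seteqP; split => w /=; rewrite in_itv/= andbT.
have E : P [set w | 0 <= Z w]%R = P [set w | Z w <= 0]%R.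
  transitivity (P ((fun w => - Z w)%R @^-1` `]-oo, 0%R]%classic)).
    by congr (P _); apply/seteqP; split => w /=; rewrite in_itv/= oppr_le0.
  rewrite (lawN _ m0) -(lawZ _ m0).
  by congr (P _); apply/seteqP; split => w /=; rewrite in_itv.
have : 1 <= P [set w | Z w <= 0]%R + P [set w | 0 <= Z w]%R.
  rewrite -(@probability_setT _ _ _ P) (_ : setT = [set w | Z w <= 0]%R `|` [set w | 0 <= Z w]%R).
    exact: measureU2.
  by apply/seteqP; split => w //= _; exact/orP/le_total.
have fP : P [set w | Z w <= 0]%R \is a fin_num by exact: fin_num_measure.
rewrite E; case: (P _) fP => // r _.
by rewrite -EFinD !lee_fin => ?; lra.
Qed.

End normal_law.

Section sum_law.
Context (R : realType) (d : measure_display) (T : measurableType d)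
  (P : probability T R).
Local Open Scope ereal_scope.

(** Decoupling turns the law of the sum into an iterated integral, to which [integral_normal_conv]
    applies. *)
Lemma law_add (F G : set (set T)) (U V : T -> R) (s t : R) :
  F `<=` measurable -> G `<=` measurable ->
  independent2 P <<s F>> <<s G>> ->
  measurable_fun setT (U : g_sigma_algebraType F -> R) ->
  measurable_fun setT (V : g_sigma_algebraType G -> R) ->
  (0 <= s)%R -> (0 <= t)%R ->
  has_centered_normal_law P U s -> has_centered_normal_law P V t ->
  has_centered_normal_law P (fun w => U w + V w)%R (s + t).
Proof.
move=> mF mG FG mU mV s0 t0 lU lV.
split; first by apply: measurable_funD; [case: lU|case: lV].
move=> B mB.
have mI : measurable_fun [set: measurableTypeR R] (EFin \o (\1_B : measurableTypeR R -> R)).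
  by apply: measurableT_comp => //; exact: measurable_indic.
have I0 (x : measurableTypeR R) : 0 <= (EFin \o (\1_B : measurableTypeR R -> R)) x by rewrite lee_fin.
pose f := EFin \o (\1_B : measurableTypeR R -> R).
have mUV : measurable ((fun w => U w + V w)%R @^-1` B).
  rewrite -[X in measurable X]setTI; apply: (measurable_funD _ _) => //; [by case: lU|by case: lV].
transitivity (\int[P]_w f (U w + V w)%R).
  have := integral_indic P measurableT mUV; rewrite setIT => <-.
  exact: eq_integral.
have mD (x : R) : measurable_fun [set: measurableTypeR R] (fun y : measurableTypeR R => f (x + y)%R).
  by apply: measurableT_comp => //; exact: measurable_funD.
have mD' (x : R) : measurable_fun [set: measurableTypeR R] (fun y : measurableTypeR R => f (y + x)%R).
  by apply: measurableT_comp => //; exact: measurable_funD.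
transitivity (\int[P]_w \int[P]_v f (U w + V v)%R).
  apply: (@ge0_integral_indep R d T P F G (fun z => f (U z.1 + V z.2)%R)) => //.
  apply: (measurableT_comp mI); apply: measurable_funD.
    exact: (measurableT_comp mU).
  exact: (measurableT_comp mV).
under eq_integral => w _ do rewrite (ge0_integral_law lV (mD (U w)))//.
rewrite /centered_normal paddr_eq0//.
(* A law of variance 0 is a Dirac mass without density, so the convolution formula is reserved for
   two nonzero variances. *)
have [t00|tn] := eqVneq t 0%R; have [s00|sn] := eqVneq s 0%R => //=.
- under eq_integral => w _ do rewrite addr0.
  by rewrite (ge0_integral_law lU mI)// s00 eqxx /f/= indicE diracE.
- under eq_integral => w _ do rewrite addr0.
  rewrite (ge0_integral_law lU mI)// (negbTE sn) t00 addr0.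
  by apply: etrans (integral_indic _ measurableT mB) _; rewrite setIT.
- have mint : measurable_fun [set: measurableTypeR R] (fun x =>
      \int[normal_prob 0 (Num.sqrt t)]_y f (x + y)%R).
    apply: (@measurable_fun_fubini_tonelli_F _ _ (measurableTypeR R)
    (measurableTypeR R) R (normal_prob 0 (Num.sqrt t)) (fun u => f (u.1 + u.2)%R)) => //.
    by apply: (measurableT_comp mI); exact: measurable_funD.
  rewrite (ge0_integral_law lU mint); last by move=> x; exact: integral_ge0.
  rewrite s00 eqxx add0r.
  under eq_integral => w _ do rewrite add0r.
  by apply: etrans (integral_indic _ measurableT mB) _; rewrite setIT.
- have mint : measurable_fun [set: measurableTypeR R] (fun x =>
      \int[normal_prob 0 (Num.sqrt t)]_y f (x + y)%R).
    apply: (@measurable_fun_fubini_tonelli_F _ _ (measurableTypeR R)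
    (measurableTypeR R) R (normal_prob 0 (Num.sqrt t)) (fun u => f (u.1 + u.2)%R)) => //.
    by apply: (measurableT_comp mI); exact: measurable_funD.
  rewrite (ge0_integral_law lU mint); last by move=> x; exact: integral_ge0.
  rewrite (negbTE sn) integral_normal_conv// ?lt0r ?sn ?tn//.
  by apply: etrans (integral_indic _ measurableT mB) _; rewrite setIT.
Qed.

End sum_law.

(** * Independence of uncorrelated jointly normal variables *)

Section bounded_closure.
Context (R : realType) (T : Type).
Implicit Types (B : set (T -> R)) (f g : T -> R).

(* The closure of [B] under linear combinations and bounded pointwise limits. *)
Inductive bcl B : (T -> R) -> Prop :=
| bcl_base f : B f -> bcl B f
| bcl_lin (a : R) f g : bcl B f -> bcl B g -> bcl B (fun w => a * f w + g w)
| bcl_lim (M : R) (f_ : nat -> T -> R) f : (forall n, bcl B (f_ n)) ->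
    (forall n w, `|f_ n w| <= M) -> (forall w, f_ n w @[n --> \oo] --> f w) ->
    bcl B f.

Definition bounded_base B := forall f, B f -> exists M, forall w, `|f w| <= M.
Definition mul_base B := forall f g, B f -> B g -> bcl B (fun w => f w * g w).

Lemma bcl_bounded B f : bounded_base B -> bcl B f ->
  exists M, forall w, `|f w| <= M.
Proof.
move=> bB; elim=> {f} [f /bB//|a f g _ [M Mf] _ [N Ng]|M f_ f _ _ fM ff].
  exists (`|a| * M + N) => w.
  by rewrite (le_trans (ler_normD _ _))// lerD// normrM ler_wpM2l.
exists M => w; have nb : `|f_ n w| @[n --> \oo] --> `|f w| by apply: cvg_norm; exact: ff.
rewrite -(cvg_lim (@Rhausdorff R) nb); apply: limr_le; first by apply/cvg_ex; exists `|f w|.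
by near=> n; exact: fM.
Unshelve. all: end_near. Qed.

Section mul.
Variables (B : set (T -> R)) (bB : bounded_base B) (mB : mul_base B).

(** Induction on each factor in turn: first with the left factor in the base, then for a left factor
    in the closure. Boundedness of the fixed factor keeps the limits bounded. *)
Lemma bcl_mul f g : bcl B f -> bcl B g -> bcl B (fun w => f w * g w).
Proof.
have H h k : B h -> bcl B k -> bcl B (fun w => h w * k w).
  move=> Bh; elim=> {k} [k Bk|a k l _ ih1 _ ih2|M k_ k _ ih kM kk].
  - exact: mB.
  - rewrite (_ : (fun w => _) = (fun w => a * (h w * k w) + h w * l w)).
      exact: bcl_lin.
    by apply/funext => w; ring.
  - have [N Nh] := bB Bh.
    apply: (bcl_lim (M := N * M) ih) => [n w|w]; first by rewrite normrM ler_pM.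
    by apply: cvgMr; exact: kk.
move=> Bf; move: g; elim: Bf => {f} [f Bf|a f h _ ih1 _ ih2|M f_ f _ ih fM ff] g Bg.
- exact: H.
- rewrite (_ : (fun w => _) = (fun w => a * (f w * g w) + h w * g w)).
    by apply: bcl_lin; [exact: ih1|exact: ih2].
  by apply/funext => w; ring.
- have [N Ng] := bcl_bounded bB Bg.
  apply: (bcl_lim (M := M * N) (fun n => ih n g Bg)) => [n w|w].
    by rewrite normrM ler_pM.
  by apply: cvgMl; exact: ff.
Qed.

Hypothesis B1 : bcl B (cst 1).

Lemma bcl0 : bcl B (cst 0).
Proof.
rewrite (_ : cst 0 = (fun w => -1 * (cst 1 w : R) + (cst 1 w : R))); first exact: bcl_lin.
by apply/funext => w /=; ring.
Qed.

Lemma bclZ a f : bcl B f -> bcl B (fun w => a * f w).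
Proof.
move=> Bf; rewrite (_ : (fun w => _) = (fun w => a * f w + cst 0 w)).
  by apply: bcl_lin => //; exact: bcl0.
by apply/funext => w /=; rewrite addr0.
Qed.

Lemma bclD f g : bcl B f -> bcl B g -> bcl B (fun w => f w + g w).
Proof.
move=> Bf Bg; rewrite (_ : (fun w => _) = (fun w => 1 * f w + g w)); first exact: bcl_lin.
by apply/funext => w /=; rewrite mul1r.
Qed.

(** This is a functional monotone class argument. Complements are affine in the indicator, and a
    countable union is the bounded limit of one minus the finite products of the complementary
    indicators, which closure under products provides. *)
Lemma bcl_sigma : sigma_algebra setT [set A | bcl B \1_A].
Proof.
split=> /= [|A BA|A_ BA].
- by rewrite indic0; exact: bcl0.
- rewrite (_ : \1_(setT `\` A) = (fun w => -1 * \1_A w + cst 1 w)); first exact: bcl_lin.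
  by apply/funext => w /=; rewrite setTD !indicE in_setC; case: (w \in A) => /=; ring.
- pose g n w : R := \prod_(k < n) (1 - \1_(A_ k) w).
  have Bg n : bcl B (g n).
    elim: n => [|n ih].
      by rewrite (_ : g 0 = cst 1)//; apply/funext => w; rewrite /g big_ord0.
    rewrite (_ : g n.+1 = (fun w => g n w * (-1 * \1_(A_ n) w + cst 1 w))).
      by apply: bcl_mul => //; exact: bcl_lin.
    by apply/funext => w; rewrite /g big_ord_recr/=; ring.
  have gE n w : g n w = \1_(~` \bigcup_(k < n) A_ k) w.
    elim: n => [|n ih].
      by rewrite /g big_ord0 indicE mem_set//= bigcup_mkord big_ord0.
    rewrite /g big_ord_recr/= -/(g n w) ih !indicE !bigcup_mkord big_ord_recr/= -!bigcup_mkord.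
    rewrite setCU in_setI; set p := (_ \in ~` _) .
    rewrite in_setC; case: p; case: (_ \in _) => //=; ring.
  apply: (@bcl_lim _ 1 (fun n w => -1 * g n w + cst 1 w)) => [n|n w|w].
  - exact: bcl_lin.
  - by rewrite gE indicE /=; case: (_ \in _) => /=; rewrite ?mulr1 ?mulr0 ?addNr ?normr0 ?add0r ?normr1.
  - have [[k _ Ak]|nA] := pselect ((\bigcup_k A_ k) w).
      rewrite indicE mem_set/=; last by exists k.
      apply: cvg_near_cst; near=> n; rewrite gE indicE memNset ?mulr0 ?add0r//=.
      by apply; exists k => //=; near: n; exact: nbhs_infty_gt.
    rewrite indicE memNset//.
    apply: cvg_near_cst; near=> n; rewrite gE indicE mem_set/= ?mulr1 ?addNr//.
    by move=> [j _ Aj]; apply: nA; exists j.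
Unshelve. all: end_near. Qed.

Lemma bcl_g_sigma (F : set (set T)) : (forall A, F A -> bcl B \1_A) ->
  forall A, <<s F >> A -> bcl B \1_A.
Proof. by move=> FB; apply: smallest_sub => //; exact: bcl_sigma. Qed.

End mul.

End bounded_closure.

(** * Polynomial approximation of the sign function *)

Section sign.
Context (R : realType).

(* Its iterates tend to the sign on [-1, 1]; they turn the algebra spanned by the
   [cos U] and [sin U] into indicators of the events [c < U]. *)
Definition smooth_sign (s : R) : R := (3 * s - s ^+ 3) / 2.

Lemma smooth_signN s : smooth_sign (- s) = - smooth_sign s.
Proof. by rewrite /smooth_sign; field. Qed.

Lemma iter_smooth_signN n s : iter n smooth_sign (- s) = - iter n smooth_sign s.
Proof. by elim: n => //= n ->; rewrite smooth_signN. Qed.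

Lemma iter_smooth_sign0 n : iter n smooth_sign 0 = 0.
Proof. by elim: n => //= n ->; rewrite /smooth_sign; field. Qed.

Lemma iter_smooth_sign_bounds n s : 0 < s -> s <= 1 ->
  s <= iter n smooth_sign s <= 1.
Proof.
move=> s0 s1; elim: n => [|n /=/andP[ih1 ih2]]; first by rewrite lexx.
set x := iter n smooth_sign s in ih1 ih2 *; rewrite /smooth_sign.
have x0 : 0 < x by exact: lt_le_trans ih1.
have x21 : x ^+ 2 <= 1 by rewrite expr_le1// ltW.
have : 0 <= x * (1 - x ^+ 2) by rewrite mulr_ge0 ?subr_ge0// ltW.
have : 0 <= (1 - x) ^+ 2 * (2 + x) by rewrite mulr_ge0 ?sqr_ge0// addr_ge0// ltW.
by move=> h1 h2; apply/andP; split; nra.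
Qed.

(** Since 1 - f(y) = (1 - y)^2 (2 + y) / 2 for f = [smooth_sign], and the iterates of x > 0 never
    fall below x, the distance to 1 shrinks at each step by a factor at most 1 - x / 2. *)
Lemma cvg_iter_smooth_sign s : `|s| <= 1 ->
  iter n smooth_sign s @[n --> \oo] --> Num.sg s.
Proof.
have pos (x : R) : 0 < x -> x <= 1 -> iter n smooth_sign x @[n --> \oo] --> (1 : R).
  move=> x0 x1.
  have b n : 1 - iter n smooth_sign x <= (1 - x / 2) ^+ n.
    elim: n => [|n ih]; first by rewrite expr0 /=; lra.
    have /andP[h1 h2] := iter_smooth_sign_bounds n x0 x1.
    rewrite exprS iterS; set y := iter n smooth_sign x in ih h1 h2 *.
    have h3 : 0 <= 1 - x / 2 by lra.
    apply: (@le_trans _ _ ((1 - x / 2) * (1 - y))); last by rewrite ler_wpM2l.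
    rewrite /smooth_sign.
    have -> : 1 - (3 * y - y ^+ 3) / 2 = (1 - y) * ((1 - y) * (2 + y) / 2) by field.
    rewrite mulrC ler_wpM2r ?subr_ge0//; nra.
  have g0 : (1 - x / 2) ^+ n @[n --> \oo] --> (0 : R).
    by apply: cvg_expr; rewrite ger0_norm; lra.
  have hl : (fun n => 1 - (1 - x / 2) ^+ n) @ \oo --> (1 : R).
    by rewrite -[X in _ --> X]subr0; apply: cvgB => //; exact: cvg_cst.
  apply: (squeeze_cvgr _ hl (cvg_cst (1 : R))); near=> n.
  have /andP[_ h2] := iter_smooth_sign_bounds n x0 x1.
  by rewrite h2 andbT lerBlDr -lerBlDl b.
move=> s1; have [s0|s0|->] := ltgtP s 0.
- rewrite ltr0_sg//; have := pos (- s); rewrite oppr_gt0 => /(_ s0).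
  rewrite ltr0_norm// in s1 => /(_ s1) /cvgN.
  apply: cvg_trans; apply: near_eq_cvg; near=> n.
  by rewrite -[s in RHS]opprK [RHS]iter_smooth_signN.
- by rewrite gtr0_sg//; apply: pos => //; rewrite gtr0_norm in s1.
- rewrite sgr0; apply: cvg_near_cst; near=> n; exact: iter_smooth_sign0.
Unshelve. all: end_near. Qed.

Lemma norm_iter_smooth_sign n s : `|s| <= 1 -> `|iter n smooth_sign s| <= 1.
Proof.
have pos (x : R) : 0 < x -> x <= 1 -> `|iter n smooth_sign x| <= 1.
  move=> x0 x1; have /andP[h1 h2] := iter_smooth_sign_bounds n x0 x1.
  by rewrite ger0_norm// (le_trans _ h1)// ltW.
move=> s1; have [s0|s0|->] := ltgtP s 0.
- rewrite -[s]opprK iter_smooth_signN normrN; apply: pos; first by rewrite oppr_gt0.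
  by rewrite ltr0_norm in s1.
- by apply: pos => //; rewrite gtr0_norm in s1.
- by rewrite iter_smooth_sign0 normr0.
Qed.

End sign.

(** * The algebra spanned by cosines and sines of a linear space of variables *)

Section trigonometric.
Context (R : realType) (T : Type).
Variable L : set (T -> R).
Hypothesis L0 : L (cst 0).
Hypothesis Llin : forall (a : R) U V, L U -> L V -> L (fun w => a * U w + V w).

Definition trig_base : set (T -> R) :=
  [set f | exists2 U, L U & f = (fun w => cos (U w)) \/ f = (fun w => sin (U w))].

Lemma trig_bounded : bounded_base trig_base.
Proof.
by move=> f [U _ [->|->]]; exists 1 => w; rewrite ler_norml ?cos_geN1 ?cos_le1 ?sin_geN1 ?sin_le1.
Qed.

Let LZ (a : R) U : L U -> L (fun w => a * U w).
Proof.
move=> LU; rewrite (_ : (fun w => _) = (fun w => a * U w + cst 0 w)); first exact: Llin.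
by apply/funext => w; rewrite addr0.
Qed.

Let LD U V : L U -> L V -> L (fun w => U w + V w).
Proof.
move=> LU LV; rewrite (_ : (fun w => _) = (fun w => 1 * U w + V w)); first exact: Llin.
by apply/funext => w; rewrite mul1r.
Qed.

Let LB U V : L U -> L V -> L (fun w => U w - V w).
Proof.
move=> LU LV; rewrite (_ : (fun w => _) = (fun w => -1 * V w + U w)); first exact: Llin.
by apply/funext => w; rewrite mulN1r addrC.
Qed.

Let bcos U : L U -> bcl trig_base (fun w => cos (U w)).
Proof. by move=> LU; apply: bcl_base; exists U => //; left. Qed.

Let bsin U : L U -> bcl trig_base (fun w => sin (U w)).
Proof. by move=> LU; apply: bcl_base; exists U => //; right. Qed.

Lemma trig1 : bcl trig_base (cst 1).
Proof.
by have := bcos L0; rewrite (_ : (fun w => _) = cst 1)//; apply/funext => w; rewrite cos0.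
Qed.

Lemma trig_mul : mul_base trig_base.
Proof.
have D f g : bcl trig_base f -> bcl trig_base g -> bcl trig_base (fun w => f w + g w) by exact: bclD.
have Z a f : bcl trig_base f -> bcl trig_base (fun w => a * f w) by apply: bclZ; exact: trig1.
move=> f g [U LU [->|->]] [V LV [->|->]].
- rewrite (_ : (fun w => _) = (fun w => 2^-1 * cos (U w + V w) + 2^-1 * cos (U w - V w))).
    by apply: D; apply: Z; apply: bcos; [exact: LD|exact: LB].
  by apply/funext => w; rewrite cosB cosD; field.
- rewrite (_ : (fun w => _) = (fun w => 2^-1 * sin (U w + V w) + (- 2^-1) * sin (U w - V w))).
    by apply: D; apply: Z; apply: bsin; [exact: LD|exact: LB].
  by apply/funext => w; rewrite sinD sinB; field.
- rewrite (_ : (fun w => _) = (fun w => 2^-1 * sin (U w + V w) + 2^-1 * sin (U w - V w))).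
    by apply: D; apply: Z; apply: bsin; [exact: LD|exact: LB].
  by apply/funext => w; rewrite sinD sinB; field.
- rewrite (_ : (fun w => _) = (fun w => 2^-1 * cos (U w - V w) + (- 2^-1) * cos (U w + V w))).
    by apply: D; apply: Z; apply: bcos; [exact: LB|exact: LD].
  by apply/funext => w; rewrite cosB cosD; field.
Qed.

Let bmul := bcl_mul trig_bounded trig_mul.

Lemma trig_sg f : bcl trig_base f -> (forall w, `|f w| <= 1) ->
  bcl trig_base (fun w => Num.sg (f w)).
Proof.
move=> Bf f1; apply: (@bcl_lim _ _ _ 1 (fun n w => iter n (@smooth_sign R) (f w))).
- elim=> [//|n ih] /=.
  rewrite (_ : (fun w => _) = (fun w => 3 / 2 * iter n (@smooth_sign R) (f w) +
      (- 2^-1) * (iter n (@smooth_sign R) (f w) *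
        (iter n (@smooth_sign R) (f w) * iter n (@smooth_sign R) (f w))))).
    apply: bclD; apply: (bclZ trig1) => //.
    by apply: bmul => //; exact: bmul.
  by apply/funext => w; rewrite {1}/smooth_sign; field.
- by move=> n w; exact: norm_iter_smooth_sign.
- by move=> w; exact: cvg_iter_smooth_sign.
Qed.

(** For small [a n] the number a_n (U - c) lies within (-pi, pi), where the sine has the sign of its
    argument. With s this sign, (s + s^2) / 2 is 1 for s = 1 and 0 for s = 0 or -1. *)
Lemma trig_gt U c : L U -> bcl trig_base (\1_[set w | c < U w] : T -> R).
Proof.
move=> LU; pose a n : R := n.+1%:R^-1.
pose s n w := sin (a n * U w - a n * c).
have s1 n w : `|s n w| <= 1 by rewrite ler_norml sin_geN1 sin_le1.
have Bs n : bcl trig_base (s n).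
  rewrite (_ : s n = (fun w => cos (a n * c) * sin (a n * U w) +
     (- sin (a n * c)) * cos (a n * U w))); last first.
    by apply/funext => w; rewrite /s sinB; ring.
  by apply: bclD; apply: (bclZ trig1); [apply: bsin|apply: bcos]; exact: LZ.
have Bg n := trig_sg (Bs n) (s1 n).
apply: (@bcl_lim _ _ _ 1 (fun n w => 2^-1 * (Num.sg (s n w) + Num.sg (s n w) * Num.sg (s n w)))).
- by move=> n; apply: (bclZ trig1); apply: bclD => //; exact: bmul.
- move=> n w; rewrite ler_norml; case: sgrP => _; apply/andP; split; lra.
- move=> w.
  have a0 : a n @[n --> \oo] --> (0 : R) by exact: cvg_harmonic.
  have ac : (a n * (U w - c))%R @[n --> \oo] --> (0 : R).
    by rewrite -[X in _ --> X](mul0r (U w - c)); apply: cvgMl.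
  have small : \forall n \near \oo, `|a n * (U w - c)| < pi.
    have /cvgrPdist_lt/(_ _ (pi_gt0 R)) := ac; apply: filterS => n.
    by rewrite sub0r normrN.
  rewrite indicE; have [cU|Uc] := boolP (w \in [set w | c < U w]).
    apply: cvg_near_cst; near=> n.
    have h : `|a n * (U w - c)| < pi by near: n.
    move: cU; rewrite inE/= => cU.
    have p : 0 < a n * (U w - c) by rewrite mulr_gt0 ?subr_gt0// invr_gt0.
    rewrite gtr0_sg ?/s -?mulrBr; first by rewrite /=; field.
    by apply: sin_gt0_pi; rewrite p/=; rewrite gtr0_norm in h.
  apply: cvg_near_cst; near=> n.
  have h : `|a n * (U w - c)| < pi by near: n.
  move: Uc; rewrite notin_setE/= => /negP; rewrite -leNgt le_eqVlt => /orP[/eqP e|Uc].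
    by rewrite /s e subrr sin0 sgr0 /=; ring.
  have p : a n * (U w - c) < 0 by rewrite pmulr_rlt0 ?subr_lt0// invr_gt0.
  rewrite ltr0_sg ?/s -?mulrBr; first by rewrite /=; field.
  rewrite -[X in sin X]opprK sinN oppr_lt0; apply: sin_gt0_pi.
  by rewrite oppr_gt0 p/=; rewrite ltr0_norm in h.
Unshelve. all: end_near. Qed.

Lemma trig_preimage U (Y : set (measurableTypeR R)) : L U -> measurable Y ->
  bcl trig_base (\1_(U @^-1` Y) : T -> R).
Proof.
move=> LU mY.
have sig : sigma_algebra [set: measurableTypeR R]
    [set Y | bcl trig_base (\1_(U @^-1` Y) : T -> R)].
  have [h0 hC hU] := bcl_sigma trig_bounded trig_mul trig1.
  split=> /=.
  - by rewrite preimage_set0.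
  - by move=> A /hC/=; rewrite !setTD preimage_setC.
  - by move=> A hA; rewrite preimage_bigcup; apply: hU.
have : <<s (@RGenOInfty.G R) >> Y.
  by move: mY; rewrite [X in X Y -> _](RGenOInfty.measurableE R).
move: Y {mY}; apply: smallest_sub => // _ [c ->] /=.
rewrite (_ : U @^-1` _ = [set w | c < U w]); first exact: trig_gt.
by apply/seteqP; split => w /=; rewrite in_itv/= andbT.
Qed.

End trigonometric.

(** * The product rule for expectations on bounded closures *)

Section uncorrelated.
Context (R : realType) (d : measure_display) (T : measurableType d)
  (P : probability T R).

Lemma bounded_integrable (f : T -> R) (M : R) : measurable_fun setT f ->
  (forall w, `|f w| <= M) -> P.-integrable setT (EFin \o f).
Proof.
move=> mf fM; have ic : P.-integrable setT (EFin \o cst M).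
  exact: finite_measure_integrable_cst.
apply: (le_integrable measurableT _ _ ic); first exact: measurableT_comp.
by move=> w _; rewrite /= lee_fin (le_trans (fM w))// ler_norm.
Qed.

Lemma bounded_cvg_Rintegral (M : R) (f_ : nat -> T -> R) (f : T -> R) :
  (forall n, measurable_fun setT (f_ n)) -> (forall n w, `|f_ n w| <= M) ->
  (forall w, f_ n w @[n --> \oo] --> f w) ->
  (\int[P]_w f_ n w)%R @[n --> \oo] --> (\int[P]_w f w)%R.
Proof.
move=> mf fM ff.
have mff : measurable_fun setT f.
  by apply: (measurable_fun_cvg mf) => w _; exact: ff.
have ic : P.-integrable setT (EFin \o cst M).
  exact: finite_measure_integrable_cst.
have [] := @dominated_convergence _ _ _ P setT measurableT (fun n => EFin \o f_ n)
  (EFin \o f) (EFin \o cst M).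
- by move=> n; exact: measurableT_comp.
- exact: measurableT_comp.
- apply: aeW => w _; apply: cvg_EFin; first by near=> n.
  exact: ff.
- by [].
- by apply: aeW => w n _; rewrite /= lee_fin.
move=> iF _ h; apply: fine_cvg; rewrite fineK//.
exact: integrable_fin_num.
Unshelve. all: end_near. Qed.

Lemma bcl_measurable (B : set (T -> R)) f : (forall g, B g -> measurable_fun setT g) ->
  bcl B f -> measurable_fun setT f.
Proof.
move=> mB; elim=> {f} [f /mB//|a f g _ mf _ mg|M f_ f _ ih fM ff].
- by apply: measurable_funD => //; apply: measurable_funM.
- by apply: (measurable_fun_cvg ih) => w _; exact: ff.
Qed.

Variables B C : set (T -> R).
Hypotheses (mB : forall g, B g -> measurable_fun setT g)
  (mC : forall g, C g -> measurable_fun setT g)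
  (bB : bounded_base B) (bC : bounded_base C).
Hypothesis BC : forall f g, B f -> C g ->
  (\int[P]_w (f w * g w) = (\int[P]_w f w) * (\int[P]_w g w))%R.

Let ib (f : T -> R) : measurable_fun setT f -> (exists M, forall w, `|f w| <= M) ->
  P.-integrable setT (EFin \o f).
Proof. by move=> mf [M fM]; exact: bounded_integrable fM. Qed.

(** The product rule is linear in each factor and stable under bounded limits by dominated
    convergence, so it passes from the bases to their closures by the double induction of
    [bcl_mul]. *)
Lemma bcl_uncorrelated f g : bcl B f -> bcl C g ->
  (\int[P]_w (f w * g w) = (\int[P]_w f w) * (\int[P]_w g w))%R.
Proof.
have im (h k : T -> R) M N : measurable_fun setT h -> measurable_fun setT k ->
    (forall w, `|h w| <= M) -> (forall w, `|k w| <= N) ->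
    P.-integrable setT (EFin \o (fun w => h w * k w)).
  move=> mh mk hM kN; apply: (@bounded_integrable _ (M * N)); first exact: measurable_funM.
  by move=> w; rewrite normrM ler_pM.
have H h k : B h -> bcl C k ->
   (\int[P]_w (h w * k w) = (\int[P]_w h w) * (\int[P]_w k w))%R.
  move=> Bh; have [M hM] := bB Bh; have mh := mB Bh.
  elim=> {k} [k Ck|a k l Ck ihk Cl ihl|N k_ k Ck ih kN kk].
  - exact: BC.
  - have mk := bcl_measurable mC Ck; have ml := bcl_measurable mC Cl.
    have [K kK] := bcl_bounded bC Ck; have [K' lK] := bcl_bounded bC Cl.
    have -> : (\int[P]_w (h w * (a * k w + l w)) =
        \int[P]_w (a * (h w * k w) + h w * l w))%R.
      by apply: eq_Rintegral => w _; ring.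
    have i1 := im _ _ _ _ mh mk hM kK; have i2 := im _ _ _ _ mh ml hM lK.
    have ik := ib mk (ex_intro _ K kK); have il := ib ml (ex_intro _ K' lK).
    have iak : P.-integrable setT (EFin \o (fun w => a * k w)).
      by rewrite (_ : _ \o _ = (fun w => a%:E * (k w)%:E)%E)//; exact: integrableZl.
    have iahk : P.-integrable setT (EFin \o (fun w => a * (h w * k w))).
      by rewrite (_ : _ \o _ = (fun w => a%:E * (h w * k w)%:E)%E)//; exact: integrableZl.
    rewrite RintegralD// RintegralZl// ihk ihl RintegralD// RintegralZl//.
    by ring.
  - have mk n := bcl_measurable mC (Ck n).
    have l1 := bounded_cvg_Rintegral mk kN kk.
    have l2 : (\int[P]_w (h w * k_ n w))%R @[n --> \oo] --> (\int[P]_w (h w * k w))%R.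
      apply: (@bounded_cvg_Rintegral (M * N)) => [n|n w|w].
      - exact: measurable_funM.
      - by rewrite normrM ler_pM.
      - by apply: cvgMr; exact: kk.
    apply: (cvg_unique _ l2) => //=.
    under eq_fun => n do rewrite ih.
    exact: cvgMr.
move=> Bf; move: g; elim: Bf => {f} [f Bf|a f h Bf ihf Bh ihh|M f_ f Bf ih fM ff] g Cg.
- exact: H.
- have mf := bcl_measurable mB Bf; have mh := bcl_measurable mB Bh.
  have mg := bcl_measurable mC Cg.
  have [K fK] := bcl_bounded bB Bf; have [K' hK] := bcl_bounded bB Bh.
  have [N gN] := bcl_bounded bC Cg.
  have -> : (\int[P]_w ((a * f w + h w) * g w) =
      \int[P]_w (a * (f w * g w) + h w * g w))%R.
    by apply: eq_Rintegral => w _; ring.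
  have i1 := im _ _ _ _ mf mg fK gN; have i2 := im _ _ _ _ mh mg hK gN.
  have if_ := ib mf (ex_intro _ K fK); have ih_ := ib mh (ex_intro _ K' hK).
  have iaf : P.-integrable setT (EFin \o (fun w => a * f w)).
    by rewrite (_ : _ \o _ = (fun w => a%:E * (f w)%:E)%E)//; exact: integrableZl.
  have iafg : P.-integrable setT (EFin \o (fun w => a * (f w * g w))).
    by rewrite (_ : _ \o _ = (fun w => a%:E * (f w * g w)%:E)%E)//; exact: integrableZl.
  rewrite RintegralD// RintegralZl// ihf// ihh// RintegralD// RintegralZl//.
  by ring.
- have [N gN] := bcl_bounded bC Cg; have mg := bcl_measurable mC Cg.
  have mf n := bcl_measurable mB (Bf n).
  have l1 := bounded_cvg_Rintegral mf fM ff.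
  have l2 : (\int[P]_w (f_ n w * g w))%R @[n --> \oo] --> (\int[P]_w (f w * g w))%R.
    apply: (@bounded_cvg_Rintegral (M * N)) => [n|n w|w].
    - exact: measurable_funM.
    - by rewrite normrM ler_pM.
    - by apply: cvgMl; exact: ff.
  apply: (cvg_unique _ l2) => //=.
  under eq_fun => n do rewrite ih//.
  exact: cvgMl.
Qed.

Lemma bcl_indep (X Y : set T) : bcl B (\1_X : T -> R) -> bcl C (\1_Y : T -> R) ->
  P (X `&` Y) = (P X * P Y)%E.
Proof.
move=> BX CY.
have mX : measurable X by apply/(@measurable_indicP _ _ R); exact: bcl_measurable BX.
have mY : measurable Y by apply/(@measurable_indicP _ _ R); exact: bcl_measurable CY.
have RI (Z : set T) : measurable Z -> ((\int[P]_w \1_Z w)%R)%:E = P Z.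
  move=> mZ; rewrite /Rintegral integral_indic// setIT fineK//.
  exact: fin_num_measure.
have := bcl_uncorrelated BX CY.
under eq_Rintegral => w _ do rewrite -[_ * _]/((\1_X \* \1_Y) w) -indicI.
by move=> h; rewrite -(RI _ (measurableI _ _ mX mY)) h EFinM !RI.
Qed.

End uncorrelated.

(** * Independence of generated sigma-algebras *)

Section independence.
Context (R : realType) (d : measure_display) (T : measurableType d)
  (P : probability T R).

(** The pi-lambda argument, with the indicators of [F] and [G] as bases: stability under
    intersection is exactly stability of these bases under products. *)
Lemma indep_setI (F G : set (set T)) :
  setI_closed F -> setI_closed G -> F setT -> G setT ->
  F `<=` measurable -> G `<=` measurable ->
  independent2 P F G -> independent2 P <<s F>> <<s G>>.
Proof.
move=> IF IG FT GT mF mG FG.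
pose base (H : set (set T)) := [set (\1_A : T -> R) | A in H].
have bb H : bounded_base (base H).
  by move=> _ [A _ <-]; exists 1 => w; rewrite indicE; case: (_ \in _); rewrite /= ?normr1 ?normr0.
have bm H : setI_closed H -> mul_base (base H).
  move=> IH _ _ [A HA <-] [B HB <-]; apply: bcl_base; exists (A `&` B); first exact: IH.
  by rewrite indicI.
have b1 H : H setT -> bcl (base H) (cst 1).
  by move=> HT; apply: bcl_base; exists setT => //; rewrite indicT.
have bme H : H `<=` measurable -> forall g, base H g -> measurable_fun setT g.
  by move=> mH _ [A HA <-]; apply: measurable_indic; exact: mH.
have Eb : forall f g, base F f -> base G g ->
  (\int[P]_w (f w * g w) = (\int[P]_w f w) * (\int[P]_w g w))%R.
  move=> _ _ [A FA <-] [B GB <-].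
  have := FG _ _ FA GB.
  under eq_Rintegral => w _ do rewrite -[_ * _]/((\1_A \* \1_B) w) -indicI.
  have mA := mF _ FA; have mB := mG _ GB.
  rewrite /Rintegral !integral_indic// ?setIT; last exact: measurableI.
  move=> h; apply: etrans (congr1 fine h) _.
  by rewrite fineM//; exact: fin_num_measure.
move=> A B FA GB.
apply: (bcl_indep (bme _ mF) (bme _ mG) (bb _) (bb _) Eb).
  by apply: (bcl_g_sigma (bb _) (bm _ IF) (b1 _ FT) _ FA) => C FC; apply: bcl_base; exists C.
by apply: (bcl_g_sigma (bb _) (bm _ IG) (b1 _ GT) _ GB) => C GC; apply: bcl_base; exists C.
Qed.

Lemma indep2_sub (F G F' G' : set (set T)) : F `<=` F' -> G `<=` G' ->
  independent2 P F' G' -> independent2 P F G.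
Proof. by move=> FF GG h A B /FF A' /GG B'; exact: h. Qed.

Lemma g_sigma_sub (F G : set (set T)) : F `<=` <<s G>> -> <<s F>> `<=` <<s G>>.
Proof. by move=> FG; apply: smallest_sub => //; exact: smallest_sigma_algebra. Qed.

(** The finite intersections of events attached to [J], with [setT] in the other coordinates, form a
    generating family stable under intersection; the same holds for the complement of [J], and two
    such intersections combine into one to which the product rule applies. *)
Lemma mutually_independent_split (I : finType) (F : I -> set (set T)) (J : pred I) :
  (forall i, setI_closed (F i)) -> (forall i, F i setT) ->
  (forall i, F i `<=` measurable) ->
  mutually_independent P F ->
  independent2 P <<s \bigcup_(i in [set i | J i]) F i>>
                 <<s \bigcup_(i in [set i | ~~ J i]) F i>>.
Proof.
move=> IF FT mF ind.
pose cyl (K : pred I) : set (set T) := [set X | exists2 A : I -> set T,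
   (forall i, F i (A i)) /\ (forall i, ~~ K i -> A i = setT) &
   X = \bigcap_(i in [set: I]) A i].
have cylI K : setI_closed (cyl K).
  move=> X Y [A [FA AT] ->] [B [FB BT] ->]; exists (fun i => A i `&` B i).
    by split=> [i|i Ki]; [exact: IF|rewrite AT// BT// setIT].
  by rewrite bigcapI.
have cylT K : cyl K setT.
  exists (fun=> setT) => //.
  by apply/seteqP; split.
have mcyl K : cyl K `<=` measurable.
  move=> X [A [FA _] ->]; apply: fin_bigcap_measurable; first exact: finite_finset.
  by move=> i _; exact/mF/FA.
have sub (K : pred I) : \bigcup_(i in [set i | K i]) F i `<=` cyl K.
  move=> X [i /= Ki FX]; exists (fun j => if j == i then X else setT).
    split=> [j|j]; case: eqP => [->//|_ //].
    by rewrite Ki.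
  apply/seteqP; split => [w Xw j _|w /(_ i Logic.I)]; first by case: eqP.
  by rewrite eqxx.
have := @indep_setI (cyl J) (cyl (predC J)) (cylI _) (cylI _) (cylT _) (cylT _) (mcyl _) (mcyl _).
move=> h; apply: (indep2_sub _ _ (h _)).
- by apply: g_sigma_sub => X /sub; exact: sub_sigma_algebra.
- by apply: g_sigma_sub => X /(sub (predC J)); exact: sub_sigma_algebra.
move=> _ _ [A [FA AT] ->] [B [FB BT] ->].
rewrite -bigcapI !ind//; last by move=> i; exact: IF.
rewrite -big_split/=; apply: eq_bigr => i _.
have [Ji|Ji] := boolP (J i).
  by rewrite (BT i) ?setIT ?probability_setT ?mule1//= Ji.
by rewrite (AT i)// setTI probability_setT mul1e.
Qed.

Lemma RintegralDl_bounded (Q : probability (measurableTypeR R) R) (a b : R) (f g : R -> R) :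
  measurable_fun setT f -> measurable_fun setT g ->
  (forall x, `|f x| <= 1) -> (forall x, `|g x| <= 1) ->
  (\int[Q]_x (a * f x + b * g x))%R = (a * (\int[Q]_x f x) + b * (\int[Q]_x g x))%R.
Proof.
move=> mf mg f1 g1.
have if_ : Q.-integrable setT (EFin \o f) by exact: (@bounded_integrable _ _ _ Q f 1).
have ig_ : Q.-integrable setT (EFin \o g) by exact: (@bounded_integrable _ _ _ Q g 1).
have ia (c : R) (h : R -> R) : Q.-integrable setT (EFin \o h) ->
    Q.-integrable setT (EFin \o (fun x => c * h x)).
  by move=> ih; rewrite (_ : _ \o _ = (fun w => c%:E * (h w)%:E)%E)//; exact: integrableZl.
by rewrite RintegralD ?RintegralZl//; exact: ia.
Qed.

(** The characteristic function of N(0, v) at 1. It is real because the sine integrates to 0; its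
    multiplicativity in [v] is what the independence argument uses. *)
Definition normal_cf (v : R) : R :=
  if v == 0 then 1 else (\int[normal_prob 0 (Num.sqrt v)]_x cos x)%R.

Let mcos : measurable_fun [set: measurableTypeR R] (@cos R).
Proof. by apply: continuous_measurable_fun; exact: continuous_cos. Qed.

Let msin : measurable_fun [set: measurableTypeR R] (@sin R).
Proof. by apply: continuous_measurable_fun; exact: continuous_sin. Qed.

Let cos1 (x : R) : `|cos x| <= 1. Proof. by rewrite ler_norml cos_geN1 cos_le1. Qed.
Let sin1 (x : R) : `|sin x| <= 1. Proof. by rewrite ler_norml sin_geN1 sin_le1. Qed.

(** The convolution identity concerns nonnegative functions, hence the passage through 1 + cos. In
    the expansion of cos(x + y) the sine term vanishes by symmetry. *)
Lemma Rintegral_cos_conv (Q' Q Q2 : probability (measurableTypeR R) R) :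
  (\int[Q]_x sin x)%R = 0 ->
  (forall f : measurableTypeR R -> \bar R, measurable_fun [set: measurableTypeR R] f ->
    (forall x, 0%E <= f x)%E ->
    (\int[Q']_x \int[Q]_y f (x + y)%R = \int[Q2]_x f x)%E) ->
  (\int[Q2]_x cos x)%R = (\int[Q']_x cos x)%R * (\int[Q]_x cos x)%R.
Proof.
move=> S0 conv.
have f0 (x : measurableTypeR R) : (0%R <= (1 + cos x)%:E)%E.
  by rewrite lee_fin; have := cos_geN1 x; lra.
have mf : measurable_fun [set: measurableTypeR R] (fun x : R => (1 + cos x)%:E).
  by apply: measurableT_comp => //; exact: measurable_funD.
have e2 := conv _ mf f0.
have E (Q0 : probability (measurableTypeR R) R) (c : R) (h : R -> R) :
    measurable_fun setT h -> (forall x, `|h x| <= 1) ->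
    (\int[Q0]_x (1 + c * h x)%:E = (1 + c * (\int[Q0]_x h x)%R)%:E)%E.
  move=> mh h1.
  have h11 (x : R) : `|cst (1 : R) x| <= 1 by rewrite normr1.
  have := @RintegralDl_bounded Q0 1 c (cst 1) h (measurable_cst _) mh h11 h1.
  rewrite Rintegral_cst// [X in fine X](@probability_setT _ _ _ Q0) /= !mul1r => <-.
  rewrite /Rintegral fineK.
    by apply: eq_integral => x _; rewrite ?mul1r.
  apply: integrable_fin_num => //.
  apply: (@bounded_integrable _ _ _ Q0 _ (1 + `|c|)).
    by apply: measurable_funD => //; apply: measurable_funM.
  move=> x; rewrite ?mul1r (le_trans (ler_normD _ _))// normr1 lerD2l normrM.
  by rewrite ler_piMr.
have inner x : (\int[Q]_y (1 + cos (x + y))%:E =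
    (1 + (\int[Q]_y cos y)%R * cos x)%:E)%E.
  transitivity (\int[Q]_y (1 + 1 * cos (x + y))%:E)%E.
    by apply: eq_integral => y _; rewrite mul1r.
  rewrite (E Q 1 (fun y => cos (x + y))); last 2 first.
  - by apply: measurableT_comp => //; exact: measurable_funD.
  - by move=> y; exact: cos1.
  congr (_ + _)%:E; rewrite mul1r.
  have := RintegralDl_bounded Q (cos x) (- sin x) mcos msin cos1 sin1.
  rewrite S0 mulr0 addr0 mulrC => <-.
  by apply: eq_Rintegral => y _; rewrite cosD mulNr.
have e3 : (\int[Q']_x \int[Q]_y (1 + cos (x + y))%:E =
   (1 + (\int[Q]_y cos y)%R * (\int[Q']_x cos x)%R)%:E)%E.
  by rewrite -(E Q' (\int[Q]_y cos y)%R (@cos R) mcos cos1); apply: eq_integral => x _; rewrite inner.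
have e1 : (\int[Q2]_x (1 + cos x)%:E = (1 + (\int[Q2]_x cos x)%R)%:E)%E.
  rewrite -[X in (_ + X)%:E]mul1r -(E Q2 1 (@cos R) mcos cos1).
  by apply: eq_integral => x _; rewrite mul1r.
by move: e2; rewrite e3 e1 => -[] /addrI <-; rewrite mulrC.
Qed.

Lemma normal_cfD (s t : R) : 0 <= s -> 0 <= t ->
  normal_cf (s + t) = normal_cf s * normal_cf t.
Proof.
move=> s0 t0; rewrite /normal_cf paddr_eq0//.
have [->|sn] := eqVneq s 0; have [->|tn] := eqVneq t 0; rewrite /= ?mul1r ?mulr1 ?add0r ?addr0//.
have sp : 0 < s by rewrite lt0r sn.
have tp : 0 < t by rewrite lt0r tn.
apply: Rintegral_cos_conv; last by move=> f; exact: integral_normal_conv.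
have tn0 : Num.sqrt t != 0 by rewrite gt_eqF ?sqrtr_gt0.
rewrite -[RHS]/(fine 0%E) -(integral_normal_sin tn0 1); congr fine.
by apply: eq_integral => x _; rewrite mul1r.
Qed.

Lemma law_Rintegral_cos (Z : T -> R) (v : R) : has_centered_normal_law P Z v ->
  (\int[P]_w cos (Z w))%R = normal_cf v.
Proof.
move=> lZ; rewrite /Rintegral (@integral_law _ _ _ P Z v (@cos R) lZ mcos) /normal_cf.
by case: ifPn => //= _; rewrite cos0.
Qed.

Lemma law_Rintegral_sin (Z : T -> R) (v : R) : 0 <= v -> has_centered_normal_law P Z v ->
  (\int[P]_w sin (Z w))%R = 0.
Proof. by move=> v0 lZ; rewrite /Rintegral (law_integral_sin v0 lZ). Qed.

(* Two spaces of random variables such that [U + V] has the law that it would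
   have if [U] and [V] were independent. *)
Definition uncorrelated_normal (L1 L2 : set (T -> R)) :=
  forall U V, L1 U -> L2 V -> exists s t : R,
    [/\ 0 <= s /\ 0 <= t, has_centered_normal_law P U s,
      has_centered_normal_law P V t &
      has_centered_normal_law P (fun w => U w + V w) (s + t)].

Definition linear_space (L : set (T -> R)) := L (cst 0) /\
  forall (a : R) U V, L U -> L V -> L (fun w => a * U w + V w).

(** Products of cosines and sines of [U] and [V] are combinations of cosines and sines of U + V and
    U - V, whose laws are those of the independent case. The product rule thus holds on the
    trigonometric bases, and the bounded closure carries it to all events. *)
Lemma normal_indep (L1 L2 : set (T -> R)) (F G : set (set T)) :
  linear_space L1 -> linear_space L2 -> uncorrelated_normal L1 L2 ->
  (forall A, F A -> exists U (Y : set (measurableTypeR R)), [/\ L1 U, measurable Y & A = U @^-1` Y]) ->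
  (forall A, G A -> exists U (Y : set (measurableTypeR R)), [/\ L2 U, measurable Y & A = U @^-1` Y]) ->
  independent2 P <<s F>> <<s G>>.
Proof.
move=> [L10 L1l] [L20 L2l] un hF hG.
have mL1 U : L1 U -> measurable_fun setT U.
  by move=> LU; have [s [t [_ [mU _] _ _]]] := un _ _ LU L20.
have mL2 U : L2 U -> measurable_fun setT U.
  by move=> LU; have [s [t [_ _ [mU _] _]]] := un _ _ L10 LU.
have mt (L : set (T -> R)) : (forall U, L U -> measurable_fun setT U) ->
    forall g, trig_base L g -> measurable_fun setT g.
  by move=> mL _ [U LU [->|->]]; apply: measurableT_comp => //; exact: mL.
have unc f g : trig_base L1 f -> trig_base L2 g ->
  (\int[P]_w (f w * g w) = (\int[P]_w f w) * (\int[P]_w g w))%R.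
  move=> [U LU fU] [V LV gV].
  have [s [t [[s0 t0] lU lV lUV]]] := un _ _ LU LV.
  have LNV : L2 (fun w => -1 * V w + cst 0 w) by exact: L2l.
  (* The hypothesis applied to [U] and [- V] only asserts that some variances exist; second moments
     identify them with [s] and [t]. *)
  have ls : has_centered_normal_law P (fun w => U w - V w) (s + t).
    have [s' [t' [[s0' t0'] lU' lNV lUNV]]] := un _ _ LU LNV.
    have v2 (Z : T -> R) (a : R) : 0 <= a -> has_centered_normal_law P Z a ->
       fine (\int[P]_w (Z w ^+ 2)%:E)%E = a.
      by move=> a0 lZ; rewrite (law_integral_pow2 a0 lZ).
    have ss : s = s' by rewrite -(v2 _ _ s0 lU) (v2 _ _ s0' lU').
    have tt' : t = t'.
      rewrite -(v2 _ _ t0 lV) -(v2 _ _ t0' lNV).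
      by congr fine; apply: eq_integral => w _; congr (_%:E); rewrite /=; ring.
    rewrite ss tt'; move: lUNV; congr (has_centered_normal_law P _ _).
    by apply/funext => w; rewrite /=; ring.
  have st0 : 0 <= s + t by exact: addr_ge0.
  have mU := mL1 _ LU; have mV := mL2 _ LV.
  have mUV : measurable_fun setT (fun w => U w + V w) by exact: measurable_funD.
  have mUB : measurable_fun setT (fun w => U w - V w) by exact: measurable_funB.
  have ic (W : T -> R) (c : R) : measurable_fun setT W -> P.-integrable setT (EFin \o (fun w => c * cos (W w))).
    move=> mW; apply: (@bounded_integrable _ _ _ P _ `|c|).
      by apply: measurable_funM => //; exact: (measurableT_comp mcos).
    by move=> w; rewrite normrM ler_piMr.
  have is_ (W : T -> R) (c : R) : measurable_fun setT W -> P.-integrable setT (EFin \o (fun w => c * sin (W w))).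
    move=> mW; apply: (@bounded_integrable _ _ _ P _ `|c|).
      by apply: measurable_funM => //; exact: (measurableT_comp msin).
    by move=> w; rewrite normrM ler_piMr.
  have ic1 (W : T -> R) : measurable_fun setT W -> P.-integrable setT (EFin \o (fun w => cos (W w))).
    by move=> mW; have := ic W 1 mW; under eq_fun do rewrite mul1r.
  have is1 (W : T -> R) : measurable_fun setT W -> P.-integrable setT (EFin \o (fun w => sin (W w))).
    by move=> mW; have := is_ W 1 mW; under eq_fun do rewrite mul1r.
  case: fU => ->; case: gV => ->.
  - transitivity (\int[P]_w (2^-1 * cos (U w + V w) + 2^-1 * cos (U w - V w)))%R.
      by apply: eq_Rintegral => w _; rewrite cosB cosD; field.
    rewrite RintegralD//; try exact: ic.
    rewrite !RintegralZl//; try exact: ic1.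
    rewrite (law_Rintegral_cos lUV) (law_Rintegral_cos ls) (law_Rintegral_cos lU) (law_Rintegral_cos lV).
    rewrite -mulrDl normal_cfD// (_ : 2^-1 + 2^-1 = 1) ?mul1r//.
    by field.
  - rewrite (law_Rintegral_sin t0 lV) mulr0.
    transitivity (\int[P]_w (2^-1 * sin (U w + V w) + (- 2^-1) * sin (U w - V w)))%R.
      by apply: eq_Rintegral => w _; rewrite sinB sinD; field.
    rewrite RintegralD//; try exact: is_.
    rewrite !RintegralZl//; try exact: is1.
    by rewrite (law_Rintegral_sin st0 lUV) (law_Rintegral_sin st0 ls) !mulr0 addr0.
  - rewrite (law_Rintegral_sin s0 lU) mul0r.
    transitivity (\int[P]_w (2^-1 * sin (U w + V w) + 2^-1 * sin (U w - V w)))%R.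
      by apply: eq_Rintegral => w _; rewrite sinB sinD; field.
    rewrite RintegralD//; try exact: is_.
    rewrite !RintegralZl//; try exact: is1.
    by rewrite (law_Rintegral_sin st0 lUV) (law_Rintegral_sin st0 ls) !mulr0 addr0.
  - rewrite (law_Rintegral_sin s0 lU) mul0r.
    transitivity (\int[P]_w (2^-1 * cos (U w - V w) + (- 2^-1) * cos (U w + V w)))%R.
      by apply: eq_Rintegral => w _; rewrite cosB cosD; field.
    rewrite RintegralD//; try exact: ic.
    rewrite !RintegralZl//; try exact: ic1.
    by rewrite (law_Rintegral_cos lUV) (law_Rintegral_cos ls); field.
move=> A B FA GB.
apply: (bcl_indep (mt _ mL1) (mt _ mL2) (@trig_bounded _ _ _) (@trig_bounded _ _ _) unc).
  apply: (bcl_g_sigma (@trig_bounded _ _ _) (trig_mul L10 L1l) (trig1 L10) _ FA) => C /hF[U [Y [LU mY ->]]].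
  exact: trig_preimage.
apply: (bcl_g_sigma (@trig_bounded _ _ _) (trig_mul L20 L2l) (trig1 L20) _ GB) => C /hG[U [Y [LU mY ->]]].
exact: trig_preimage.
Qed.

End independence.

(** * Quadratic forms and resolvents *)

Section quadratic_forms.
Context {R : realFieldType}.

Definition dotv n (u v : 'cV[R]_n) : R := \sum_i u i 0 * v i 0.
Definition qf n (M : 'M[R]_n) (v : 'cV[R]_n) : R := dotv v (M *m v).
Definition posdef n (M : 'M[R]_n) := M^T = M /\ forall v, v != 0 -> 0 < qf M v.

Section dotv.
Variable n : nat.
Implicit Types u v w : 'cV[R]_n.

Lemma dotvE u v : dotv u v = (u^T *m v) 0 0.
Proof. by rewrite mxE; apply: eq_bigr => i _; rewrite mxE. Qed.

Lemma dotvC u v : dotv u v = dotv v u.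
Proof. by apply: eq_bigr => i _; rewrite mulrC. Qed.

Lemma dotvDr u v w : dotv u (v + w) = dotv u v + dotv u w.
Proof. by rewrite -big_split; apply: eq_bigr => i _; rewrite mxE mulrDr. Qed.

Lemma dotvZr a u v : dotv u (a *: v) = a * dotv u v.
Proof. by rewrite mulr_sumr; apply: eq_bigr => i _; rewrite mxE mulrCA. Qed.

Lemma dotvDl u v w : dotv (u + v) w = dotv u w + dotv v w.
Proof. by rewrite dotvC dotvDr !(dotvC w). Qed.

Lemma dotvZl a u v : dotv (a *: u) v = a * dotv u v.
Proof. by rewrite dotvC dotvZr dotvC. Qed.

Lemma dotvNr u v : dotv u (- v) = - dotv u v.
Proof. by rewrite -scaleN1r dotvZr mulN1r. Qed.

Lemma dotvBr u v w : dotv u (v - w) = dotv u v - dotv u w.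
Proof. by rewrite dotvDr dotvNr. Qed.

Lemma dotvBl u v w : dotv (u - v) w = dotv u w - dotv v w.
Proof. by rewrite dotvC dotvBr !(dotvC w). Qed.

Lemma dotv0 u : dotv u 0 = 0.
Proof. by rewrite /dotv big1// => i _; rewrite mxE mulr0. Qed.

Lemma dotvv_ge0 u : 0 <= dotv u u.
Proof. by apply: sumr_ge0 => i _; rewrite -expr2 sqr_ge0. Qed.

Lemma dotvv_eq0 u : (dotv u u == 0) = (u == 0).
Proof.
apply/eqP/eqP => [h|->]; last exact: dotv0.
apply/matrixP => i j; rewrite ord1 mxE; apply/eqP; rewrite -sqrf_eq0.
have := h; rewrite /dotv (bigD1 i)//= => /eqP.
rewrite paddr_eq0 ?sumr_ge0 -?expr2 ?sqr_ge0// => [|k _]; first by case/andP.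
by rewrite -expr2 sqr_ge0.
Qed.

Lemma dotv_delta u i : dotv u (delta_mx i 0) = u i 0.
Proof.
rewrite /dotv (bigD1 i)//= big1 => [|k ki]; rewrite !mxE ?eqxx ?mulr1 ?addr0//.
by rewrite (negbTE ki) mulr0.
Qed.

Lemma CauchySchwarz_dotv u v : dotv u v ^+ 2 <= dotv u u * dotv v v.
Proof.
have [->|v0] := eqVneq v 0; first by rewrite !dotv0 expr0n mulr0.
have vv : 0 < dotv v v by rewrite lt0r dotvv_eq0 v0 dotvv_ge0.
have := dotvv_ge0 (u - (dotv u v / dotv v v) *: v).
rewrite dotvBl !dotvBr !dotvZl !dotvZr (dotvC v u).
rewrite -(pmulr_lge0 _ vv).
have -> : (dotv u u - dotv u v / dotv v v * dotv u v - (dotv u v / dotv v v * dotv u v -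
   dotv u v / dotv v v * (dotv u v / dotv v v * dotv v v))) * dotv v v =
   dotv u u * dotv v v - dotv u v ^+ 2.
  by field; rewrite gt_eqF.
by rewrite subr_ge0.
Qed.

End dotv.

Lemma dotv_adj m n (M : 'M[R]_(m, n)) u v : dotv u (M *m v) = dotv (M^T *m u) v.
Proof. by rewrite !dotvE trmx_mul trmxK mulmxA. Qed.

Lemma qfE n (M : 'M[R]_n) v : qf M v = \sum_i \sum_k M i k * (v i 0 * v k 0).
Proof.
apply: eq_bigr => i _; rewrite mxE mulr_sumr; apply: eq_bigr => k _; ring.
Qed.

Lemma qfZ n (M : 'M[R]_n) a v : qf M (a *: v) = a ^+ 2 * qf M v.
Proof. by rewrite /qf -scalemxAr dotvZl dotvZr mulrA expr2. Qed.

Lemma qfD n (M M' : 'M[R]_n) v : qf (M + M') v = qf M v + qf M' v.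
Proof. by rewrite /qf mulmxDl dotvDr. Qed.

Lemma qf_scalar n (a : R) (v : 'cV[R]_n) : qf a%:M v = a * dotv v v.
Proof. by rewrite /qf mul_scalar_mx dotvZr. Qed.

Lemma qf_gram m n (C : 'M[R]_(m, n)) v : qf (C^T *m C) v = dotv (C *m v) (C *m v).
Proof. by rewrite /qf -mulmxA dotv_adj trmxK. Qed.

Lemma qf_delta n (M : 'M[R]_n) i : qf M (delta_mx i 0) = M i i.
Proof.
rewrite /qf dotvC dotv_delta mxE (bigD1 i)//= big1 => [|k ki]; rewrite !mxE ?eqxx ?mulr1 ?addr0//.
by rewrite (negbTE ki) mulr0.
Qed.

Lemma dotv_delta2 n (i : 'I_n) : dotv (delta_mx i 0) (delta_mx i 0) = 1.
Proof. by rewrite dotv_delta mxE !eqxx. Qed.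

Section posdef.
Variables (n : nat) (M : 'M[R]_n) (pM : posdef M).

Lemma posdef_ge0 v : 0 <= qf M v.
Proof.
have [->|v0] := eqVneq v 0; first by rewrite /qf mulmx0 dotv0.
by apply: ltW; apply: pM.2.
Qed.

Lemma posdef_unit : M \in unitmx.
Proof.
rewrite -row_free_unit; apply: inj_row_free => v vM.
apply/eqP; apply: contraT => v0.
have : v^T != 0 by rewrite -(inj_eq trmx_inj) trmxK trmx0.
move=> /pM.2; rewrite /qf dotvC dotvE trmx_mul trmxK pM.1 vM mul0mx mxE.
by rewrite ltxx.
Qed.

Lemma posdef_mulVK (u : 'cV[R]_n) : M *m (invmx M *m u) = u.
Proof. by rewrite mulmxA mulmxV ?posdef_unit// mul1mx. Qed.

Lemma trmx_posdef_inv : (invmx M)^T = invmx M.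
Proof. by rewrite trmx_inv pM.1. Qed.

Lemma qf_inv u : qf M (invmx M *m u) = qf (invmx M) u.
Proof. by rewrite /qf posdef_mulVK dotvC. Qed.

Lemma posdef_inv : posdef (invmx M).
Proof.
split; first exact: trmx_posdef_inv.
move=> v v0; rewrite -qf_inv; apply: pM.2; apply: contra v0 => /eqP h.
by rewrite -(posdef_mulVK v) h mulmx0.
Qed.

(** Expanding the form of [M] at v - M^-1 u, which is nonnegative. Every test vector [v] thus yields
    a lower bound for the inverse. *)
Lemma qf_dual u v : 2 * dotv v u - qf M v <= qf (invmx M) u.
Proof.
rewrite -subr_ge0; have := posdef_ge0 (v - invmx M *m u).
rewrite /qf mulmxBr posdef_mulVK dotvBl !dotvBr.
have -> : dotv (invmx M *m u) (M *m v) = dotv v u.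
  by rewrite dotv_adj pM.1 posdef_mulVK dotvC.
by rewrite (dotvC u (invmx M *m u)) => ?; lra.
Qed.

Lemma CauchySchwarz_posdef u v : dotv v u ^+ 2 <= qf M v * qf (invmx M) u.
Proof.
have [->|v0] := eqVneq v 0.
  by rewrite dotvC dotv0 expr0n /qf mulmx0 dotv0 mul0r.
have qv := pM.2 _ v0.
have := qf_dual u ((dotv v u / qf M v) *: v); rewrite dotvZl qfZ => h.
rewrite mulrC -ler_pdivrMr//; apply: le_trans h.
rewrite le_eqVlt; apply/orP; left; apply/eqP.
by field; rewrite gt_eqF.
Qed.

(** Summing [CauchySchwarz_posdef] over the coordinate vectors: the smallest eigenvalue is at least
    the inverse of the trace of the inverse. *)
Lemma dotv_le_trace v : dotv v v <= qf M v * \tr (invmx M).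
Proof.
rewrite /mxtrace mulr_sumr; apply: ler_sum => i _.
have := CauchySchwarz_posdef (delta_mx i 0) v.
by rewrite dotv_delta qf_delta expr2.
Qed.

(** At v = M^-1 e_i the hypothesis reads D x^2 <= x with x the diagonal entry of the inverse. *)
Lemma inv_diag_le (i : 'I_n) (D : R) : 0 < D -> (forall v : 'cV[R]_n, D * v i 0 ^+ 2 <= qf M v) ->
  invmx M i i <= D^-1.
Proof.
move=> D0 h; have := h (invmx M *m delta_mx i 0).
rewrite qf_inv qf_delta -[X in D * X ^+ 2]dotv_delta dotvC -/(qf _ _) qf_delta.
have x0 : 0 < invmx M i i.
  rewrite -qf_delta; apply: posdef_inv.2.
  by rewrite -dotvv_eq0 dotv_delta2 oner_eq0.
move=> h2; rewrite -(ler_pM2l D0) mulfV ?gt_eqF//.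
by rewrite -(ler_pM2r x0) mul1r -mulrA -expr2.
Qed.

End posdef.

Lemma qf_inv_le n (M M' : 'M[R]_n) k u : posdef M -> posdef M' ->
  (forall v, qf M v <= k * qf M' v) -> qf (invmx M') u <= k * qf (invmx M) u.
Proof.
move=> pM pM' h.
have [->|u0] := eqVneq u 0; first by rewrite /qf !mulmx0 !dotv0 mulr0.
have q0 := (posdef_inv pM').2 _ u0; have q1 := (posdef_inv pM).2 _ u0.
have := CauchySchwarz_posdef pM u (invmx M' *m u).
rewrite dotvC -/(qf _ _) => cs.
have h2 := h (invmx M' *m u); rewrite (qf_inv pM') in h2.
rewrite -(ler_pM2r q0) -expr2; apply: (le_trans cs).
by rewrite mulrAC ler_wpM2r// ltW.
Qed.

Lemma gram_posdef m n (C : 'M[R]_(m, n)) (e : R) : 0 < e -> posdef (C^T *m C + e%:M).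
Proof.
move=> e0; split; first by rewrite linearD/= trmx_mul trmxK tr_scalar_mx.
move=> v v0; rewrite qfD qf_gram qf_scalar ltr_wpDl ?dotvv_ge0// mulr_gt0//.
by rewrite lt0r dotvv_eq0 v0 dotvv_ge0.
Qed.

(* [resolvent C e] tends to the orthogonal projection onto the kernel of [C]
   when [e] tends to 0. *)
Definition resolvent m n (C : 'M[R]_(m, n)) (e : R) : 'M[R]_n :=
  e *: invmx (C^T *m C + e%:M).

Section resolvent.
Variables (m n : nat) (C : 'M[R]_(m, n)) (e : R) (e0 : 0 < e).
Let Q := resolvent C e.
Let pH := gram_posdef C e0.

Lemma trmx_resolvent : Q^T = Q.
Proof. by rewrite /Q /resolvent linearZ/= (trmx_posdef_inv pH). Qed.

Lemma gram_resolvent : C^T *m C *m Q = e *: (1%:M - Q).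
Proof.
have : (C^T *m C + e%:M) *m Q = e%:M.
  by rewrite /Q /resolvent -scalemxAr mulmxV ?posdef_unit// scalemx1.
rewrite mulmxDl mul_scalar_mx => h.
by rewrite scalerBr scalemx1 -h addrK.
Qed.

Let qeq (v : 'cV[R]_n) : C^T *m (C *m (Q *m v)) = e *: (v - Q *m v).
Proof. by rewrite !mulmxA gram_resolvent -scalemxAl mulmxBl mul1mx. Qed.

Let gramq (v : 'cV[R]_n) : e * (dotv v (Q *m v) - dotv (Q *m v) (Q *m v)) =
  dotv (C *m (Q *m v)) (C *m (Q *m v)).
Proof.
by rewrite -{1}(trmxK C) -dotv_adj qeq dotvZr dotvBr (dotvC _ v).
Qed.

(** Times [e], the gap is |C Q v|^2. This is the relation Q^2 <= Q, which replaces the idempotence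
    of a projection; 0 <= Q <= 1 follows from it. *)
Lemma resolvent_sqr_le v : dotv (Q *m v) (Q *m v) <= qf Q v.
Proof.
by rewrite -subr_ge0 -(pmulr_rge0 _ e0) gramq dotvv_ge0.
Qed.

Lemma resolvent_ge0 v : 0 <= qf Q v.
Proof. by apply: le_trans (resolvent_sqr_le v); exact: dotvv_ge0. Qed.

Lemma resolvent_le v : qf Q v <= dotv v v.
Proof.
have h := resolvent_sqr_le v; have := dotvv_ge0 (v - Q *m v).
rewrite dotvBl !dotvBr (dotvC (Q *m v) v) -/(qf Q v) => ?; lra.
Qed.

Lemma resolvent_contraction v : dotv (Q *m v) (Q *m v) <= dotv v v.
Proof. exact: le_trans (resolvent_sqr_le v) (resolvent_le v). Qed.

Lemma resolvent_diag_ge0 i : 0 <= Q i i.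
Proof. by rewrite -qf_delta resolvent_ge0. Qed.

Lemma resolvent_diag_le1 i : Q i i <= 1.
Proof. by rewrite -qf_delta (le_trans (resolvent_le _))// dotv_delta2. Qed.

Lemma resolvent_row_le i : \sum_k Q i k ^+ 2 <= Q i i.
Proof.
rewrite -[leRHS]qf_delta; apply: le_trans (resolvent_sqr_le _).
rewrite le_eqVlt; apply/orP; left; apply/eqP; apply: eq_bigr => k _.
have -> : (Q *m delta_mx i 0 : 'cV_n) k 0 = Q i k.
  rewrite mxE (bigD1 i)//= big1 => [|l li].
    by rewrite [delta_mx _ _ _ _]mxE !eqxx mulr1 addr0 -[in LHS]trmx_resolvent mxE.
  by rewrite [delta_mx _ _ _ _]mxE (negbTE li) mulr0.
by rewrite expr2.
Qed.

(* The regularized least squares problem is solved by [w = C Q y / e]. *)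
Lemma resolvent_min y (w : 'cV[R]_m) :
  qf Q y <= dotv (y - C^T *m w) (y - C^T *m w) + e * dotv w w.
Proof.
set q := Q *m y; set w0 := e^-1 *: (C *m q).
have yq : y - C^T *m w0 = q.
  rewrite /w0 -scalemxAr qeq scalerA mulVf ?gt_eqF// scale1r.
  by rewrite opprB addrC subrK.
have -> : y - C^T *m w = q - C^T *m (w - w0).
  by rewrite -[in RHS]yq mulmxBr opprB addrA subrK.
set h := w - w0; have wE : w = w0 + h by rewrite /h addrC subrK.
have cross : dotv q (C^T *m h) = e * dotv w0 h.
  by rewrite dotv_adj trmxK /w0 dotvZl mulrA mulfV ?gt_eqF// mul1r.
have qf_ : qf Q y = dotv q q + e * dotv w0 w0.
  have yE : y = q + C^T *m w0 by rewrite -yq subrK.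
  rewrite /qf -/q {1}yE dotvDl (_ : dotv (C^T *m w0) q = e * dotv w0 w0)//.
  have Cq : C *m q = e *: w0 by rewrite /w0 scalerA mulfV ?gt_eqF// scale1r.
  by rewrite dotvC dotv_adj trmxK Cq dotvZl.
rewrite qf_ (_ : dotv w w = dotv (w0 + h) (w0 + h)); last by rewrite -wE.
clearbody h.
rewrite dotvBl !dotvBr dotvDl !dotvDr (dotvC _ q) cross (dotvC h w0).
have h1 := dotvv_ge0 (C^T *m h); have h2 := dotvv_ge0 h.
have h3 : 0 <= e * dotv h h by rewrite mulr_ge0// ltW.
lra.
Qed.

End resolvent.

(** The resolvents of [C] and of its transpose have the same defect from the identity in trace, and
    the second one has size [m] and nonnegative trace. *)
Lemma resolvent_trace m n (C : 'M[R]_(m, n)) (e : R) : 0 < e ->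
  n%:R - m%:R <= \tr (resolvent C e).
Proof.
move=> e0; set Q := resolvent C e; pose Q' := resolvent C^T e.
(* The push-through identity: C commutes with functions of the two Gram matrices C^T C and C C^T. *)
have push : C *m Q = Q' *m C.
  have pH := gram_posdef C e0; have pK := gram_posdef C^T e0; rewrite trmxK in pK.
  have h : (C *m C^T + e%:M) *m C = C *m (C^T *m C + e%:M).
    by rewrite mulmxDl mulmxDr !mulmxA mul_scalar_mx mul_mx_scalar.
  rewrite /Q /Q' /resolvent trmxK -scalemxAr -scalemxAl; congr (_ *: _).
  apply: (can_inj (mulmxK (posdef_unit pH))); rewrite -[RHS]mulmxA -h mulmxKV ?posdef_unit//.
  by rewrite mulKmx ?posdef_unit.
have e1 : e * \tr (1%:M - Q) = e * \tr (1%:M - Q').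
  rewrite -!mxtraceZ -gram_resolvent// -(gram_resolvent C^T)// trmxK.
  by rewrite -mulmxA push mulmxA mxtrace_mulC mulmxA.
have := mulfI (lt0r_neq0 e0) e1; rewrite !linearB/= !mxtrace1.
have : 0 <= \tr Q' by apply: sumr_ge0 => i _; exact: resolvent_diag_ge0.
lra.
Qed.

Section weights.
Variables (m n : nat) (C : 'M[R]_(m, n)) (e : R) (e0 : 0 < e).
Let Q := resolvent C e.
Variables (s : 'I_n -> R) (smax : R).
Hypothesis smax0 : 0 <= smax.
Hypothesis s01 : forall l, 0 <= s l <= smax.

(** Up to the ridge, [Q] removes at most [m] directions, and each of them carries a weight at most
    [smax]. *)
Lemma resolvent_weighted_trace : \sum_l s l - smax * m%:R <= \sum_l s l * Q l l.
Proof.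
have h : \sum_l s l * (1 - Q l l) <= smax * (n%:R - \tr Q).
  rewrite -mxtrace1 /mxtrace -sumrB mulr_sumr; apply: ler_sum => l _.
  have /andP[h0 h1] := s01 l; rewrite [1%:M _ _]mxE eqxx.
  by rewrite ler_wpM2r// subr_ge0 resolvent_diag_le1.
have : smax * (n%:R - \tr Q) <= smax * m%:R.
  rewrite ler_wpM2l//.
  by have := resolvent_trace C e0; rewrite -/Q; lra.
move: h; under eq_bigr do rewrite mulrBr mulr1.
by rewrite sumrB; lra.
Qed.

(** Up to a factor 2 the left-hand side is the variance of the Gaussian quadratic form of [Q] with
    variances [s], and the sum on the right is its mean: the mean alone controls the
    fluctuations. *)
Lemma resolvent_weighted_sqr :
  \sum_l \sum_k s l * s k * Q l k ^+ 2 <= smax * \sum_l s l * Q l l.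
Proof.
rewrite mulr_sumr; apply: ler_sum => l _; have /andP[h0 h1] := s01 l.
apply: (@le_trans _ _ (smax * s l * \sum_k Q l k ^+ 2)).
  rewrite mulr_sumr; apply: ler_sum => k _; have /andP[k0 k1] := s01 k.
  by rewrite ler_wpM2r ?sqr_ge0// mulrC ler_wpM2r.
by rewrite mulrA ler_wpM2l ?resolvent_row_le// mulr_ge0// (le_trans h0).
Qed.

End weights.

(** Zeroing the row instead of deleting it keeps the shape of the matrix, and the rows still span
    what the others span. *)
Definition zero_row m n (i : 'I_m) (Y : 'M[R]_(m, n)) : 'M[R]_(m, n) :=
  \matrix_(k, l) (if k == i then 0 else Y k l).

(** Y^T v is v_i times row [i] plus a combination of the other rows, so the ridged form at [v] is
    the value of a regularized least squares problem, which [resolvent_min] bounds below. *)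
Lemma gram_inv_diag_le m n (Y : 'M[R]_(m, n)) (e D : R) (i : 'I_m) : 0 < e -> 0 < D ->
  D <= qf (resolvent (zero_row i Y) e) (row i Y)^T ->
  invmx (Y *m Y^T + e%:M) i i <= D^-1.
Proof.
move=> e0 D0 h; have := gram_posdef Y^T e0; rewrite trmxK => pM.
apply: (inv_diag_le pM D0) => v.
have YE : Y *m Y^T = (Y^T)^T *m Y^T by rewrite trmxK.
rewrite qfD YE qf_gram qf_scalar.
have -> : Y^T *m v = v i 0 *: (row i Y)^T - (zero_row i Y)^T *m (- v).
  rewrite mulmxN opprK; apply/matrixP => l z; rewrite ord1 !mxE (bigD1 i)//= !mxE.
  rewrite mulrC; congr (_ + _).
  rewrite [RHS](bigD1 i)//= !mxE eqxx mul0r add0r.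
  by apply: eq_bigr => k ki; rewrite !mxE (negbTE ki).
have -> : dotv v v = dotv (- v) (- v) by rewrite dotvNr dotvC dotvNr opprK.
apply: le_trans (resolvent_min _ e0 _ _).
by rewrite qfZ mulrC ler_wpM2l ?sqr_ge0.
Qed.

(* For each [i], test [qf_dual] against the vector [t Q e_i]. *)
Lemma trace_inv_ge m n (B : 'M[R]_n) (C : 'M[R]_(m, n)) (t : R) :
  posdef B -> 0 < t -> (m < n)%N ->
  (forall e, 0 < e -> \tr (resolvent C e *m (B - C^T *m C) *m resolvent C e) <= t) ->
  (n%:R - m%:R) ^+ 2 / (2 * t) <= \tr (invmx B).
Proof.
move=> pB t0 mn h.
have n0 : 0 < n%:R :> R by rewrite ltr0n (leq_ltn_trans _ mn).
(* With this ridge tr(Q C^T C Q) <= e tr(Q) <= e n = t, as much as the hypothesis allows for the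
   rest of [B]. *)
pose e := t / n%:R; have e0 : 0 < e by rewrite divr_gt0.
set Q := resolvent C e; have QT : Q^T = Q := trmx_resolvent C e0.
have nm : 0 < n%:R - m%:R :> R by rewrite subr_gt0 ltr_nat.
have QHQ : \tr (Q *m (C^T *m C) *m Q) <= t.
  rewrite -mulmxA gram_resolvent// -/Q -scalemxAr mxtraceZ mulmxBr mulmx1 linearB/=.
  have -> : t = e * n%:R by rewrite /e divfK ?gt_eqF.
  rewrite ler_pM2l//; apply: (@le_trans _ _ (\tr Q)).
    rewrite lerBlDr lerDl; apply: sumr_ge0 => i _; rewrite mxE; apply: sumr_ge0 => k _.
    have -> : Q k i = Q i k by rewrite -{1}QT mxE.
    by rewrite -expr2 sqr_ge0.
  rewrite -[leRHS]mxtrace1; apply: ler_sum => i _; rewrite [leRHS]mxE eqxx.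
  exact: resolvent_diag_le1.
have QBQ : \tr (Q *m B *m Q) <= 2 * t.
  have := lerD (h _ e0) QHQ; rewrite -/Q -mxtraceD -mulmxDl -mulmxDr subrK.
  by rewrite mulrDl mul1r.
have trQ : n%:R - m%:R <= \tr Q by exact: resolvent_trace.
(* This scale maximizes 2 r x - r^2 (2 t) at x = n - m. *)
pose r := (n%:R - m%:R) / (2 * t).
have r0 : 0 < r by rewrite divr_gt0// mulr_gt0.
have key : 2 * r * \tr Q - r ^+ 2 * \tr (Q *m B *m Q) <= \tr (invmx B).
  rewrite /mxtrace !mulr_sumr -sumrB; apply: ler_sum => i _.
  have := qf_dual pB (delta_mx i 0) (r *: (Q *m delta_mx i 0)).
  rewrite qfZ dotvZl qf_delta mulrA dotvC -/(qf Q _) qf_delta.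
  have -> : qf B (Q *m delta_mx i 0) = (Q *m B *m Q) i i.
    by rewrite /qf dotvC dotv_adj QT dotvC !mulmxA -/(qf _ _) qf_delta.
  by [].
apply: le_trans key.
have -> : (n%:R - m%:R) ^+ 2 / (2 * t) = 2 * r * (n%:R - m%:R) - r ^+ 2 * (2 * t).
  by rewrite /r; field; rewrite gt_eqF.
apply: lerB; first by rewrite ler_pM2l// mulr_gt0.
by rewrite ler_pM2l// exprn_gt0.
Qed.

(** A Sherman-Morrison computation: a a^T lam is a multiple of [a], and pairing the solved equation
    with [a] leaves a scalar equation for that multiple. *)
Lemma rank_one_solve n (B : 'M[R]_n) (a lam e : 'cV[R]_n) (b : R) : posdef B ->
  (a *m a^T + B) *m lam = b *: a + e ->
  dotv a lam - b = (dotv a (invmx B *m e) - b) / (1 + qf (invmx B) a).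
Proof.
move=> pB h; have uB := posdef_unit pB.
have s0 : 0 <= qf (invmx B) a := posdef_ge0 (posdef_inv pB) a.
have aa : a *m a^T *m lam = dotv a lam *: a.
  rewrite -mulmxA; apply/matrixP => i j; rewrite ord1 !mxE big_ord1 mulrC; congr (_ * _).
  by rewrite dotvE.
have : lam = (b - dotv a lam) *: (invmx B *m a) + invmx B *m e.
  have Bl : B *m lam = (b - dotv a lam) *: a + e.
    by move: h; rewrite mulmxDl aa scalerBl addrAC => <-; rewrite addrC addKr.
  by rewrite scalemxAr -mulmxDr -Bl mulmxA mulVmx// mul1mx.
move=> /(congr1 (dotv a)); rewrite dotvDr dotvZr -/(qf _ a) => e1.
have p : 1 + qf (invmx B) a != 0 by rewrite gt_eqF// ltr_pwDl.
apply: (mulIf p); rewrite divfK//; lra.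
Qed.

End quadratic_forms.

(** * Orthonormal bases in dimension p *)

Section l2.
Context {R : realType} {p : option nat}.
Implicit Types (x y z : vec R p) (c : nat -> R).

Lemma zextM x y n : zext (fun i => x i * y i) n = zext x n * zext y n.
Proof. by rewrite /zext; case: insub => //=; rewrite mulr0. Qed.

Lemma zextD x y n : zext (fun i => x i + y i) n = zext x n + zext y n.
Proof. by rewrite /zext; case: insub => //=; rewrite addr0. Qed.

Lemma zextZ (a : R) x n : zext (fun i => a * x i) n = a * zext x n.
Proof. by rewrite /zext; case: insub => //=; rewrite mulr0. Qed.

Lemma zext_val x (i : idx p) : zext x (val i) = x i.
Proof. by rewrite /zext valK. Qed.

Lemma zext_out x n : in_dim p n = false -> zext x n = 0.
Proof. by rewrite /zext => h; case: insubP => //= i; rewrite h. Qed.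

Definition sqr_series x := series (fun n => zext x n ^+ 2).

Lemma RpE x : Rp x <-> cvgn (sqr_series x).
Proof.
rewrite /Rp /mkset /sqr_series (_ : zext (fun i => x i ^+ 2) = fun n => zext x n ^+ 2)//.
by apply/funext => n; rewrite expr2 -zextM.
Qed.

Lemma sqr_series_ndecr x : {homo sqr_series x : m n / (m <= n)%N >-> m <= n}.
Proof.
apply/nondecreasing_seqP => n; rewrite /sqr_series /series/= big_nat_recr//= lerDl.
exact: sqr_ge0.
Qed.

Lemma Rp_bounded x (M : R) : (forall n, \sum_(l < n) zext x l ^+ 2 <= M) -> Rp x.
Proof.
move=> h; apply/RpE; apply: nondecreasing_is_cvgn; first exact: sqr_series_ndecr.
by exists M => _ [n _ <-]; rewrite /sqr_series /series/= big_mkord.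
Qed.

Lemma dot_series x y :
  series (zext (fun i => x i * y i)) = series (fun n => zext x n * zext y n).
Proof. by congr series; apply/funext => n; rewrite zextM. Qed.

Lemma is_cvg_dot x y : Rp x -> Rp y -> cvgn (series (fun n => zext x n * zext y n)).
Proof.
move=> /RpE cx /RpE cy; apply: normed_cvg.
apply: (@series_le_cvg _ _ (fun n => zext x n ^+ 2 + zext y n ^+ 2)) => [n|n|n|].
- exact: normr_ge0.
- by rewrite addr_ge0 ?sqr_ge0.
- rewrite /= normrM -(real_normK (num_real (zext x n))) -(real_normK (num_real (zext y n))).
  by have := sqr_ge0 (`|zext x n| - `|zext y n|); have := sqr_ge0 (`|zext x n| + `|zext y n|); nra.
- by rewrite seriesD; apply: is_cvgD.
Qed.

Lemma cvg_dot x y : Rp x -> Rp y ->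
  \sum_(l < n) zext x l * zext y l @[n --> \oo] --> dot x y.
Proof.
move=> Rx Ry; rewrite /dot /psum dot_series.
have E : series (fun n => zext x n * zext y n) = (fun n => \sum_(l < n) zext x l * zext y l).
  by apply/funext => n; rewrite /series/= big_mkord.
by have := is_cvg_dot Rx Ry; rewrite E.
Qed.

Lemma zext0 n : zext ((fun=> 0) : vec R p) n = 0.
Proof. by rewrite /zext; case: insub. Qed.

Lemma dot0l x : dot (fun=> 0) x = 0.
Proof.
rewrite /dot /psum dot_series; apply: cvg_lim => //.
apply: cvg_near_cst; near=> n; rewrite /series/= big1// => l _.
by rewrite zext0 mul0r.
Unshelve. all: end_near. Qed.

Lemma dotC x y : dot x y = dot y x.
Proof. by congr psum; apply/funext => i; rewrite mulrC. Qed.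

Lemma RpZ (a : R) x : Rp x -> Rp (fun i => a * x i).
Proof.
move=> /RpE cx; apply/RpE; rewrite /sqr_series.
under eq_fun do rewrite zextZ exprMn.
by rewrite (_ : series _ = (fun n => a ^+ 2 * sqr_series x n)) ?is_cvgMr//;
  [exact: is_cvgMr|apply/funext => n; rewrite /sqr_series /series/= mulr_sumr].
Qed.

Lemma RpD x y : Rp x -> Rp y -> Rp (fun i => x i + y i).
Proof.
move=> Rx Ry; have := is_cvg_dot Rx Ry; move/RpE : Rx => cx; move/RpE : Ry => cy cxy.
apply/RpE; rewrite /sqr_series.
under eq_fun do rewrite zextD sqrrD.
rewrite (_ : series _ = (fun n => sqr_series x n + (2 * series (fun n => zext x n * zext y n) n + sqr_series y n))).
  apply: is_cvgD => //; apply: is_cvgD => //; exact: is_cvgMr.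
apply/funext => n; rewrite /sqr_series /series/= mulr_sumr -!big_split/=.
by apply: eq_bigr => l _; rewrite mulr2n; ring.
Qed.

Lemma Rp_vsub x y : Rp x -> Rp y -> Rp (vsub x y).
Proof.
move=> Rx Ry; rewrite (_ : vsub x y = (fun i => x i + (-1) * y i)).
  by apply: RpD => //; exact: RpZ.
by apply/funext => i; rewrite mulN1r.
Qed.

Lemma Rp0 : Rp (fun=> 0 : R) (p := p).
Proof. by apply: (@Rp_bounded _ 0) => n; rewrite big1// => l _; rewrite /zext; case: insub => [?|] /=; rewrite expr0n. Qed.

Lemma dotDl x y z : Rp x -> Rp y -> Rp z -> dot (fun i => x i + y i) z = dot x z + dot y z.
Proof.
move=> Rx Ry Rz; have h2 := cvg_dot (RpD Rx Ry) Rz.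
have h1 : \sum_(l < n) zext (fun i => x i + y i) l * zext z l @[n --> \oo] --> dot x z + dot y z.
  rewrite (_ : (fun n => _) = (fun n => \sum_(l < n) zext x l * zext z l +
      \sum_(l < n) zext y l * zext z l)).
    by apply: cvgD; exact: cvg_dot.
  apply/funext => n; rewrite -big_split/=.
  by apply: eq_bigr => l _; rewrite zextD mulrDl.
exact: (cvg_unique _ h2 h1).
Qed.

Lemma dotZl (a : R) x y : Rp x -> Rp y -> dot (fun i => a * x i) y = a * dot x y.
Proof.
move=> Rx Ry; have Ra : Rp (fun i => a * x i) by exact: RpZ.
have h2 := cvg_dot Ra Ry.
have h1 : \sum_(l < n) zext (fun i => a * x i) l * zext y l @[n --> \oo] --> a * dot x y.
  rewrite (_ : (fun n => _) = (fun n => a * \sum_(l < n) zext x l * zext y l)).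
    by apply: cvgMr; exact: cvg_dot.
  apply/funext => n; rewrite mulr_sumr.
  by apply: eq_bigr => l _; rewrite zextZ mulrA.
exact: (cvg_unique _ h2 h1).
Qed.

Lemma dotBl x y z : Rp x -> Rp y -> Rp z -> dot (vsub x y) z = dot x z - dot y z.
Proof.
move=> Rx Ry Rz; rewrite (_ : vsub x y = (fun i => x i + (-1) * y i)); last first.
  by apply/funext => i; rewrite mulN1r.
rewrite dotDl//; last exact: RpZ.
by rewrite dotZl// mulN1r.
Qed.

Lemma dotBr x y z : Rp x -> Rp y -> Rp z -> dot x (vsub y z) = dot x y - dot x z.
Proof. by move=> Rx Ry Rz; rewrite dotC dotBl// dotC (dotC z). Qed.

Lemma psum_sqr_le x n : Rp x -> \sum_(l < n) zext x l ^+ 2 <= dot x x.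
Proof.
move=> Rx; have h := cvg_dot Rx Rx.
rewrite -(cvg_lim (@Rhausdorff R) h).
apply: (@nondecreasing_cvgn_le _ (fun n => \sum_(l < n) zext x l * zext x l)); last first.
  by apply/cvg_ex; exists (dot x x).
apply/nondecreasing_seqP => m; rewrite big_ord_recr/= lerDl -expr2; exact: sqr_ge0.
Qed.

Lemma dot_ge0 x : Rp x -> 0 <= dot x x.
Proof. by move=> Rx; have := psum_sqr_le 0 Rx; rewrite big_ord0. Qed.

Lemma dot_le_bound x (M : R) : (forall n, \sum_(l < n) zext x l ^+ 2 <= M) -> dot x x <= M.
Proof.
move=> h; have Rx := Rp_bounded h; have c := cvg_dot Rx Rx.
rewrite -(cvg_lim (@Rhausdorff R) c); apply: limr_le; first by apply/cvg_ex; exists (dot x x).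
by near=> n; apply: le_trans (h n); under eq_bigr do rewrite -expr2.
Unshelve. all: end_near. Qed.

Lemma dot_eq0 x : Rp x -> dot x x = 0 -> forall i, x i = 0.
Proof.
move=> Rx x0 i; have := psum_sqr_le (val i).+1 Rx; rewrite x0 big_ord_recr/=.
rewrite zext_val => h; apply/eqP; rewrite -sqrf_eq0 eq_le sqr_ge0 andbT.
by apply: le_trans h; rewrite lerDr; apply: sumr_ge0 => l _; exact: sqr_ge0.
Qed.

Lemma CauchySchwarz_dot x y : Rp x -> Rp y -> dot x y ^+ 2 <= dot x x * dot y y.
Proof.
move=> Rx Ry; have [y0|yn0] := eqVneq (dot y y) 0.
  have y0' : y = fun=> 0 by apply/funext; exact: dot_eq0.
  by rewrite y0 mulr0 y0' dotC dot0l expr0n.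
have yy : 0 < dot y y by rewrite lt0r yn0 dot_ge0.
pose t := dot x y / dot y y.
have Rt : Rp (fun i => t * y i) by exact: RpZ.
have := dot_ge0 (Rp_vsub Rx Rt).
rewrite dotBl//; last exact: Rp_vsub.
rewrite !dotBr// !(dotC _ (fun i => t * y i)) !dotZl// (dotC y x).
rewrite -(pmulr_lge0 _ yy).
have -> : (dot x x - t * dot x y - (t * dot x y - t * dot y (fun i => t * y i))) * dot y y =
   dot x x * dot y y - dot x y ^+ 2.
  by rewrite (dotC y (fun i => t * y i)) dotZl// /t; field.
by rewrite subr_ge0.
Qed.

Lemma Rp_basis (i : idx p) : Rp (basis_vec R i).
Proof.
apply: (@Rp_bounded _ 1) => n.
have h l : zext (basis_vec R i) l ^+ 2 <= (l == val i)%:R.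
  rewrite /zext; case: insubP => [j _ jl|_] /=; last by rewrite expr0n ler0n.
  by rewrite /basis_vec -jl eq_sym; case: eqVneq => [->|ij]; rewrite ?eqxx ?expr1n// expr0n ler0n.
apply: (le_trans (ler_sum _ (fun (l : 'I_n) _ => h l))).
case: (ltnP (val i) n) => [vn|nv].
  rewrite (bigD1 (Ordinal vn))//= eqxx big1 ?addr0// => l /eqP lv.
  by case: eqP => // e; case: lv; exact/val_inj.
rewrite big1// => l _; case: eqP => // e; move: nv; rewrite leqNgt -e.
by rewrite ltn_ord.
Qed.

Lemma dot_basis (i : idx p) x : dot (basis_vec R i) x = x i.
Proof.
rewrite /dot /psum; apply: cvg_lim => //.
apply: cvg_near_cst; near=> n; rewrite /series/= big_mkord.
have vn : (val i < n)%N by near: n; exact: nbhs_infty_gt.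
rewrite (bigD1 (Ordinal vn))//= zext_val /basis_vec eqxx mul1r big1 ?addr0// => l /eqP lv.
rewrite /zext; case: insubP => //= j _ jl.
case: eqVneq => [e|]; last by rewrite mul0r.
by case: lv; apply/val_inj; rewrite /= -jl e.
Unshelve. all: end_near. Qed.

End l2.

Section orthonormal_basis.
Context {R : realType} {p : option nat}.
Variable u : idx p -> vec R p.
Hypotheses (uRp : forall j, Rp (u j))
  (uon : forall j l, dot (u j) (u l) = (j == l)%:R).

(** The basis is indexed by all natural numbers, with 0 beyond the dimension, so that finite and
    infinite [p] are treated by the same sums. *)
Definition bv (l : nat) : vec R p := oapp u (fun=> 0) (insub l).

Lemma bv_val (j : idx p) : bv (val j) = u j.
Proof. by rewrite /bv valK. Qed.

Lemma Rp_bv l : Rp (bv l).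
Proof. by rewrite /bv; case: insub => //=; exact: Rp0. Qed.

Lemma dot_bv j l : dot (bv j) (bv l) = (in_dim p j && (j == l))%:R.
Proof.
rewrite /bv; case: insubP => [j' pj jj|/negbTE pj] /=; last by rewrite pj dot0l.
rewrite pj/=; case: insubP => [l' pl ll|/negbTE pl] /=.
  by rewrite uon -(inj_eq val_inj) /= jj ll.
rewrite dotC dot0l; case: eqVneq => // jl; by rewrite -jl pj in pl.
Qed.

Definition basis_coef (x : vec R p) (l : nat) : R := dot (bv l) x.

Lemma coef_out x l : in_dim p l = false -> Rp x -> basis_coef x l = 0.
Proof.
move=> pl Rx; have := CauchySchwarz_dot (@Rp_bv l) Rx.
rewrite dot_bv pl/= mul0r => h; apply/eqP; rewrite -sqrf_eq0 eq_le h sqr_ge0//.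
Qed.

Definition comb (c : nat -> R) (n : nat) : vec R p := fun i => \sum_(l < n) c l * bv l i.

Lemma combS c n : comb c n.+1 = fun i => comb c n i + c n * bv n i.
Proof. by apply/funext => i; rewrite /comb big_ord_recr. Qed.

Lemma Rp_comb c n : Rp (comb c n).
Proof.
elim: n => [|n ih].
  rewrite (_ : comb c 0 = (fun=> 0)); first exact: Rp0.
  by apply/funext => i; rewrite /comb big_ord0.
by rewrite combS; apply: RpD => //; apply: RpZ; exact: Rp_bv.
Qed.

Lemma dot_comb c n x : Rp x -> dot (comb c n) x = \sum_(l < n) c l * basis_coef x l.
Proof.
move=> Rx; elim: n => [|n ih].
  rewrite big_ord0 -[RHS](dot0l x); congr dot.
  by apply/funext => i; rewrite /comb big_ord0.
rewrite combS dotDl//; [|exact: Rp_comb|by apply: RpZ; exact: Rp_bv].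
by rewrite ih big_ord_recr/= dotZl//; exact: Rp_bv.
Qed.

Lemma coef_comb c n j : basis_coef (comb c n) j = if (j < n)%N && in_dim p j then c j else 0.
Proof.
rewrite /basis_coef dotC dot_comb; last exact: Rp_bv.
rewrite /basis_coef; under eq_bigr => l _ do rewrite dot_bv.
case: (ltnP j n) => [jn|nj] /=; last first.
  rewrite big1// => l _; case: eqP => [lj|]; last by rewrite andbF mulr0.
  by move: (ltn_ord l); rewrite lj ltnNge nj.
rewrite (bigD1 (Ordinal jn))//= eqxx andbT big1 ?addr0 => [|l /eqP lj].
  by case: ifP => _; rewrite ?mulr1 ?mulr0.
case: eqP => [e|]; last by rewrite andbF mulr0.
by case: lj; apply/val_inj.
Qed.

Lemma dot_comb2 c n : dot (comb c n) (comb c n) <= \sum_(l < n) c l ^+ 2.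
Proof.
rewrite dot_comb; last exact: Rp_comb.
apply: ler_sum => l _; rewrite coef_comb ltn_ord/=.
by case: ifP => _; rewrite ?mulr0 ?sqr_ge0// expr2.
Qed.

Lemma bessel x n : Rp x -> \sum_(l < n) basis_coef x l ^+ 2 <= dot x x.
Proof.
move=> Rx; have Rc := @Rp_comb (basis_coef x) n.
have := dot_ge0 (Rp_vsub Rx Rc).
rewrite dotBl//; last exact: Rp_vsub.
rewrite !dotBr// (dotC x (comb _ _)) dot_comb//.
have e : dot (comb (basis_coef x) n) (comb (basis_coef x) n) = \sum_(l < n) basis_coef x l * basis_coef x l.
  rewrite dot_comb//; apply: eq_bigr => l _; congr (_ * _); rewrite coef_comb ltn_ord/=.
  by case: ifP => // /coef_out ->.
rewrite e; under [X in _ -> X <= _]eq_bigr do rewrite expr2.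
by move=> ?; lra.
Qed.

Implicit Types c : nat -> R.

Definition sqr_summable c := exists M : R, forall n, \sum_(l < n) c l ^+ 2 <= M.

Lemma coef_sqr_summable x : Rp x -> sqr_summable (basis_coef x).
Proof. by move=> Rx; exists (dot x x) => n; exact: bessel. Qed.

Lemma sqr_summable_cvg c : sqr_summable c -> cvgn (series (fun l => c l ^+ 2)).
Proof.
move=> [M h]; apply: nondecreasing_is_cvgn.
  by apply/nondecreasing_seqP => n; rewrite /series/= big_nat_recr//= lerDl sqr_ge0.
by exists M => _ [n _ <-]; rewrite /series/= big_mkord.
Qed.

Definition synth c : vec R p := fun i => limn (fun n => comb c n i).

Lemma cvg_comb c i : sqr_summable c -> comb c n i @[n --> \oo] --> synth c i.
Proof.
move=> hc; suff : cvgn (fun n => comb c n i) by [].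
have hb : sqr_summable (fun l => bv l i).
  have [M h] := coef_sqr_summable (@Rp_basis _ _ i); exists M => n.
  rewrite (le_trans _ (h n))//; apply: ler_sum => l _.
  by rewrite /basis_coef dotC dot_basis.
have h1 := sqr_summable_cvg hc; have h2 := sqr_summable_cvg hb.
have : cvgn (series (fun l => c l * bv l i)).
  apply: normed_cvg.
  apply: (@series_le_cvg _ _ (fun n => c n ^+ 2 + bv n i ^+ 2)) => [n|n|n|].
  - exact: normr_ge0.
  - by rewrite addr_ge0 ?sqr_ge0.
  - rewrite /= normrM -(real_normK (num_real (c n))) -(real_normK (num_real (bv n i))).
    by have := sqr_ge0 (`|c n| - `|bv n i|); have := sqr_ge0 (`|c n| + `|bv n i|); nra.
  - by rewrite seriesD; apply: is_cvgD.
rewrite (_ : series _ = (comb c)^~ i)//.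
by apply/funext => n; rewrite /series/= big_mkord.
Qed.

Lemma cvg_sum_ord n (f : nat -> nat -> R) (g : nat -> R) :
  (forall i, f m i @[m --> \oo] --> g i) ->
  \sum_(i < n) f m i @[m --> \oo] --> \sum_(i < n) g i.
Proof.
move=> fg; elim: n => [|n ih].
  by rewrite big_ord0; under eq_fun do rewrite big_ord0; exact: cvg_cst.
rewrite big_ord_recr/=; under eq_fun do rewrite big_ord_recr/=.
by apply: cvgD.
Qed.

(** A Fatou argument: the bound holds for each finite combination, hence for finitely many
    coordinates of the limit, hence for its norm. *)
Lemma synth_bound c (M : R) : (forall n, \sum_(l < n) c l ^+ 2 <= M) ->
  Rp (synth c) /\ dot (synth c) (synth c) <= M.
Proof.
move=> h; have hc : sqr_summable c by exists M.
have key n : \sum_(i < n) zext (synth c) i ^+ 2 <= M.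
  have cv : \sum_(i < n) zext (comb c m) i ^+ 2 @[m --> \oo] --> \sum_(i < n) zext (synth c) i ^+ 2.
    apply: (@cvg_sum_ord n (fun m i => zext (comb c m) i ^+ 2)
      (fun i => zext (synth c) i ^+ 2)) => i.
    have z : zext (comb c m) i @[m --> \oo] --> zext (synth c) i.
      rewrite /zext; case: insub => [j|] /=; first exact: cvg_comb.
      exact: cvg_cst.
    exact: (cvgM z z).
  rewrite -(cvg_lim (@Rhausdorff R) cv); apply: limr_le.
    by apply/cvg_ex; eexists; exact: cv.
  near=> m; apply: (le_trans (psum_sqr_le _ (@Rp_comb c m))).
  exact: le_trans (dot_comb2 _ _) (h _).
by split; [exact: Rp_bounded key|exact: dot_le_bound].
Unshelve. all: end_near. Qed.

Lemma Rp_synth c : sqr_summable c -> Rp (synth c).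
Proof. by move=> [M /synth_bound[]]. Qed.

Lemma synth_tail c n : sqr_summable c ->
  vsub (synth c) (comb c n) = synth (fun l => if (l < n)%N then 0 else c l).
Proof.
move=> hc; apply/funext => i; rewrite /vsub; apply/esym; apply: cvg_lim => //.
have h : comb c m i - comb c n i @[m --> \oo] --> synth c i - comb c n i.
  by apply: cvgB; [exact: cvg_comb|exact: cvg_cst].
apply: cvg_trans h; apply: near_eq_cvg; near=> m.
have nm : (n <= m)%N by near: m; exact: nbhs_infty_ge.
rewrite /comb -(subnKC nm) !big_split_ord/= addrAC subrr add0r.
rewrite [X in X + _]big1 ?add0r => [|l _]; last by rewrite ltn_ord mul0r.
by apply: eq_bigr => l _; rewrite ltnNge leq_addr.
Unshelve. all: end_near. Qed.

(** The coordinatewise convergence that defines [synth] becomes convergence in norm: the remainder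
    is itself a [synth], and [synth_bound] controls it by the tail of the series of squares. *)
Lemma synth_dist c : sqr_summable c ->
  dot (vsub (synth c) (comb c n)) (vsub (synth c) (comb c n)) @[n --> \oo] --> 0.
Proof.
move=> hc; have := sqr_summable_cvg hc; set S := series _ => cS.
have h : limn S - S n @[n --> \oo] --> 0.
  by rewrite -[X in _ --> X](subrr (limn S)); apply: cvgB => //; exact: cvg_cst.
apply: (squeeze_cvgr _ (cvg_cst (0 : R)) h); near=> n.
have Rd : Rp (vsub (synth c) (comb c n)).
  by apply: Rp_vsub; [exact: Rp_synth|exact: Rp_comb].
rewrite dot_ge0//=; rewrite synth_tail//.
apply: (proj2 (synth_bound _)) => m.
have Snd : nondecreasing_seq S.
  by apply/nondecreasing_seqP => k; rewrite /S /series/= big_nat_recr//= lerDl sqr_ge0.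
apply: (@le_trans _ _ (S (n + m)%N - S n)); last first.
  by rewrite lerB//; apply: nondecreasing_cvgn_le.
rewrite /S /series/= !big_mkord big_split_ord/= addrAC subrr add0r.
pose f l : R := (if (l < n)%N then 0 else c l) ^+ 2.
apply: (@le_trans _ _ (\sum_(l < m + n) f l)).
  by rewrite big_split_ord/= lerDl; apply: sumr_ge0 => l _; exact: sqr_ge0.
rewrite addnC big_split_ord/= big1 ?add0r => [|l _]; last by rewrite /f ltn_ord expr0n.
by apply: ler_sum => l _; rewrite /f ltnNge leq_addr.
Unshelve. all: end_near. Qed.

Lemma cvg_dot_synth c y : sqr_summable c -> Rp y ->
  \sum_(l < n) c l * basis_coef y l @[n --> \oo] --> dot (synth c) y.
Proof.
move=> hc Ry.
have h0 : dot (vsub (synth c) (comb c n)) (vsub (synth c) (comb c n)) * dot y y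
   @[n --> \oo] --> 0.
  by rewrite -[X in _ --> X](mul0r (dot y y)); apply: cvgMl; exact: synth_dist.
have Rs := Rp_synth hc.
have h1 : (dot (synth c) y - \sum_(l < n) c l * basis_coef y l) ^+ 2 @[n --> \oo] --> 0.
  apply: (squeeze_cvgr _ (cvg_cst (0 : R)) h0); near=> n.
  rewrite sqr_ge0/= -(dot_comb c n Ry) -dotBl//; last exact: Rp_comb.
  by apply: CauchySchwarz_dot => //; apply: Rp_vsub => //; exact: Rp_comb.
have h2 : `|dot (synth c) y - \sum_(l < n) c l * basis_coef y l| @[n --> \oo] --> 0.
  have := cvg_comp _ _ h1 (@sqrt_continuous R 0); rewrite sqrtr0.
  by apply: cvg_trans; apply: near_eq_cvg; near=> n; rewrite /= sqrtr_sqr.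
have h3 : (dot (synth c) y - \sum_(l < n) c l * basis_coef y l) @[n --> \oo] --> 0.
  exact: norm_cvg0.
have h4 : dot (synth c) y - (dot (synth c) y - \sum_(l < n) c l * basis_coef y l)
   @[n --> \oo] --> dot (synth c) y - 0.
  by apply: cvgB => //; exact: cvg_cst.
rewrite -[X in _ --> X]subr0; move: h4; apply: cvg_trans.
by apply: near_eq_cvg; near=> n; rewrite opprB addrC subrK.
Unshelve. all: end_near. Qed.

Lemma coef_synth c j : sqr_summable c -> in_dim p j -> basis_coef (synth c) j = c j.
Proof.
move=> hc pj; rewrite /basis_coef dotC.
have h := cvg_dot_synth hc (@Rp_bv j); apply/esym/(cvg_unique _ _ h) => //.
apply: cvg_near_cst; near=> n.
have jn : (j < n)%N by near: n; exact: nbhs_infty_gt.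
have := coef_comb c n j; rewrite jn pj/= => <-.
by rewrite /basis_coef dotC dot_comb//; exact: Rp_bv.
Unshelve. all: end_near. Qed.

Hypothesis ucomplete : forall v, Rp v -> (forall j, dot (u j) v = 0) -> forall i, v i = 0.

Lemma synth_coef x : Rp x -> synth (basis_coef x) = x.
Proof.
move=> Rx; have hc := coef_sqr_summable Rx; have Rs := Rp_synth hc.
apply/funext => i; suff /eqP : vsub (synth (basis_coef x)) x i = 0 by rewrite subr_eq0 => /eqP.
apply: ucomplete => [|j]; first exact: Rp_vsub.
have pj : in_dim p (val j) by exact: (valP j).
by rewrite dotBr// -bv_val -!/(basis_coef _ _) coef_synth// subrr.
Qed.

Lemma parseval x y : Rp x -> Rp y ->
  \sum_(l < n) basis_coef x l * basis_coef y l @[n --> \oo] --> dot x y.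
Proof.
move=> Rx Ry; rewrite -{2}(synth_coef Rx); apply: cvg_dot_synth => //.
exact: coef_sqr_summable.
Qed.

Lemma coef_vsub x y l : Rp x -> Rp y -> basis_coef (vsub x y) l = basis_coef x l - basis_coef y l.
Proof. by move=> Rx Ry; rewrite /basis_coef dotBr//; exact: Rp_bv. Qed.

Lemma zext_in (f : vec R p) l : in_dim p l -> exists2 j : idx p, l = val j & zext f l = f j.
Proof. by move=> pl; exists (exist _ l pl) => //; rewrite -zext_val. Qed.

Section spec.
Variables (f : vec R p) (M : R).
Hypothesis fM : forall l, `|zext f l| <= M.

Lemma spec_sqr_summable v : Rp v -> sqr_summable (fun l => zext f l * basis_coef v l).
Proof.
move=> Rv; have M0 : 0 <= M by apply: le_trans (fM 0).
exists (M ^+ 2 * dot v v) => n; apply: (@le_trans _ _ (M ^+ 2 * \sum_(l < n) basis_coef v l ^+ 2)).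
  rewrite mulr_sumr; apply: ler_sum => l _; rewrite exprMn ler_wpM2r ?sqr_ge0//.
  by rewrite -(real_normK (num_real (zext f l))) ler_sqr ?nnegrE.
by rewrite ler_wpM2l ?sqr_ge0// bessel.
Qed.

Lemma specE v : Rp v -> spec u f v = synth (fun l => zext f l * basis_coef v l).
Proof.
move=> Rv; apply/funext => i; rewrite /spec /psum /synth; congr (limn _).
apply/funext => n; rewrite /series/= big_mkord; apply: eq_bigr => l _.
rewrite /basis_coef /bv /zext; case: insub => //=; by rewrite !mul0r.
Qed.

Lemma Rp_spec v : Rp v -> Rp (spec u f v).
Proof. by move=> Rv; rewrite specE//; apply: Rp_synth; exact: spec_sqr_summable. Qed.

Lemma coef_spec v l : Rp v -> basis_coef (spec u f v) l = zext f l * basis_coef v l.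
Proof.
move=> Rv; have [pl|pl] := boolP (in_dim p l).
  by rewrite specE// coef_synth//; exact: spec_sqr_summable.
by rewrite !coef_out ?mulr0//; [exact: negbTE|exact: negbTE|exact: Rp_spec].
Qed.

Lemma cvg_norm2_spec v : Rp v ->
  \sum_(l < n) (zext f l * basis_coef v l) ^+ 2 @[n --> \oo] --> norm2 (spec u f v) ^+ 2.
Proof.
move=> Rv; have Rs := Rp_spec Rv; rewrite /norm2 sqr_sqrtr ?dot_ge0//.
have := parseval Rs Rs; apply: cvg_trans; apply: near_eq_cvg; near=> n.
by apply: eq_bigr => l _; rewrite coef_spec// expr2.
Unshelve. all: end_near. Qed.

Lemma norm2_spec_ge v n : Rp v ->
  \sum_(l < n) (zext f l * basis_coef v l) ^+ 2 <= norm2 (spec u f v) ^+ 2.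
Proof.
move=> Rv; have Rs := Rp_spec Rv; rewrite /norm2 sqr_sqrtr ?dot_ge0//.
apply: le_trans (bessel n Rs); apply: ler_sum => l _.
by rewrite coef_spec.
Qed.

End spec.

End orthonormal_basis.

(** * The covariance operator *)

Section covariance.
Context {R : realType} {p : option nat}.
Variables (S : idx p -> vec R p) (sigma : vec R p) (u : idx p -> vec R p).
Hypothesis cov : is_covariance S sigma u.

Let uRp := cov_basis_Rp cov.
Let uon := cov_orthonormal cov.
Let ucp := cov_complete cov.
Local Notation sg := (zext sigma).
Local Notation coef := (basis_coef u).
Local Notation bv := (bv u).

Lemma zext_sigma_ge0 l : 0 <= sg l.
Proof.
have [pl|pl] := boolP (in_dim p l); last by rewrite zext_out ?(negbTE pl).
by have [j -> ->] := zext_in sigma pl; rewrite ltW// (cov_pos cov).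
Qed.

Lemma zext_sigma_gt0 l : in_dim p l -> 0 < sg l.
Proof. by move=> pl; have [j -> ->] := zext_in sigma pl; rewrite (cov_pos cov). Qed.

Lemma in_dim_le l m : (l <= m)%N -> in_dim p m -> in_dim p l.
Proof. by case: (p) => //= n lm; exact: leq_ltn_trans. Qed.

Lemma zext_sigma_noninc l m : (l <= m)%N -> sg m <= sg l.
Proof.
move=> lm; have [pm|pm] := boolP (in_dim p m); last first.
  by rewrite [sg m]zext_out ?(negbTE pm)// zext_sigma_ge0.
have [j ml ->] := zext_in sigma pm.
have [k kl ->] := zext_in sigma (in_dim_le lm pm).
by apply: (cov_noninc cov); rewrite -ml -kl.
Qed.

Lemma zext_map (f : R -> R) l : f 0 = 0 ->
  zext ((fun j => f (sigma j)) : vec R p) l = f (sg l).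
Proof. by move=> f0; rewrite /zext; case: insub => //=. Qed.

Lemma zext_tail k (f : vec R p) l : zext (tail k f) l = if (l < k)%N then 0 else zext f l.
Proof.
rewrite /zext; case: insubP => /= [j pj jl|]; last by case: ifP.
by rewrite /tail -jl.
Qed.

Lemma zext_head k (f : vec R p) l : zext (Defs.head k f) l = if (l < k)%N then zext f l else 0.
Proof.
rewrite /zext; case: insubP => /= [j pj jl|]; last by case: ifP.
by rewrite /head -jl.
Qed.

Definition nneg_sum (f : nat -> R) : R := limn (fun n => \sum_(l < n) f l).

Lemma nneg_sum_cvg (f : nat -> R) (M : R) : (forall l, 0 <= f l) ->
  (forall n, \sum_(l < n) f l <= M) ->
  \sum_(l < n) f l @[n --> \oo] --> nneg_sum f /\ forall n, \sum_(l < n) f l <= nneg_sum f.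
Proof.
move=> f0 fM.
have nd : nondecreasing_seq (fun n => \sum_(l < n) f l).
  by apply/nondecreasing_seqP => n; rewrite big_ord_recr/= lerDl.
have c : cvgn (fun n => \sum_(l < n) f l).
  by apply: nondecreasing_is_cvgn => //; exists M => _ [n _ <-].
by split => // n; exact: nondecreasing_cvgn_le.
Qed.

Lemma nneg_sum_le (f : nat -> R) (M : R) : (forall l, 0 <= f l) ->
  (forall n, \sum_(l < n) f l <= M) -> nneg_sum f <= M.
Proof.
move=> f0 fM; have [c _] := nneg_sum_cvg f0 fM; apply: limr_le.
  by apply/cvg_ex; eexists; exact: c.
by near=> n; exact: fM.
Unshelve. all: end_near. Qed.

Lemma sum_sigma_le n : \sum_(l < n) sg l <= limn (series sg).
Proof.
rewrite -(big_mkord xpredT) -/(series _ n); apply: nondecreasing_cvgn_le.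
  by apply/nondecreasing_seqP => m; rewrite /series/= big_nat_recr//= lerDl zext_sigma_ge0.
exact: (cov_trace cov).
Qed.

Section trace.
Variables (f : vec R p) (M : R).
Hypotheses (f0 : forall l, 0 <= zext f l) (fM : forall n, \sum_(l < n) zext f l <= M).

Let fb l : `|zext f l| <= M.
Proof.
rewrite ger0_norm//; apply: le_trans (fM l.+1).
by rewrite big_ord_recr/= lerDr sumr_ge0.
Qed.

(** The trace is taken in the coordinate basis while [f] lives in the eigenbasis. Both sums are
    compared with the double series of f_l u_l(i)^2, whose terms are nonnegative. *)
Lemma trace_spec : trace (spec u f) = nneg_sum (zext f).
Proof.
have [cf lef] := nneg_sum_cvg f0 fM.
pose a : vec R p := fun i => spec u f (basis_vec R i) i.
have -> : trace (spec u f) = psum a.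
  by rewrite /trace; congr psum; apply/funext => i; rewrite dot_basis.
have ca i : \sum_(l < m) zext f l * zext (bv l) i ^+ 2 @[m --> \oo] --> zext a i.
  have [pi|pi] := boolP (in_dim p i); last first.
    rewrite zext_out ?(negbTE pi)//; apply: cvg_near_cst; near=> m.
    by rewrite big1// => l _; rewrite [zext (bv l) i]zext_out ?(negbTE pi)// expr0n mulr0.
  have [j -> ->] := zext_in a pi; rewrite /a specE; last exact: Rp_basis.
  have := cvg_comb uRp uon (i:=j) (spec_sqr_summable uRp uon fb (@Rp_basis R p j)).
  apply: cvg_trans; apply: near_eq_cvg; near=> m; apply: eq_bigr => l _.
  by rewrite zext_val /basis_coef dotC dot_basis expr2 mulrA.
have a0 i : 0 <= zext a i.
  rewrite -(cvg_lim (@Rhausdorff R) (ca i)); apply: limr_ge.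
    by apply/cvg_ex; eexists; exact: ca.
  by near=> m; apply: sumr_ge0 => l _; rewrite mulr_ge0 ?sqr_ge0.
have cs n : \sum_(l < m) zext f l * (\sum_(i < n) zext (bv l) i ^+ 2) @[m --> \oo] -->
    \sum_(i < n) zext a i.
  rewrite (_ : (fun m => _) = (fun m => \sum_(i < n) \sum_(l < m) zext f l * zext (bv l) i ^+ 2)).
    by apply: (@cvg_sum_ord R n (fun m i => \sum_(l < m) zext f l * zext (bv l) i ^+ 2)).
  by apply/funext => m; rewrite exchange_big/=; apply: eq_bigr => l _; rewrite mulr_sumr.
(* For finitely many coordinates, each u_l contributes at most |u_l|^2 <= 1. *)
have aM n : \sum_(i < n) zext a i <= nneg_sum (zext f).
  rewrite -(cvg_lim (@Rhausdorff R) (cs n)); apply: limr_le.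
    by apply/cvg_ex; eexists; exact: cs.
  near=> m; apply: le_trans (lef m); apply: ler_sum => l _.
  rewrite ler_piMr//; apply: (le_trans (psum_sqr_le _ (@Rp_bv _ _ _ uRp l))).
  by rewrite dot_bv//; case: (_ && _).
have -> : psum a = nneg_sum (zext a).
  by rewrite /psum /nneg_sum; congr (limn _); apply/funext => n; rewrite /series/= big_mkord.
have [cva lea] := nneg_sum_cvg a0 aM.
apply/eqP; rewrite eq_le (nneg_sum_le a0 aM)/=.
(* Conversely, for finitely many [l], letting the number of coordinates grow restores |u_l|^2 = 1 in
   front of each f_l. *)
apply: (nneg_sum_le f0) => m.
have cm : \sum_(l < m) zext f l * (\sum_(i < n) zext (bv l) i ^+ 2) @[n --> \oo] -->
    \sum_(l < m) zext f l * dot (bv l) (bv l).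
  apply: (@cvg_sum_ord R m (fun n l => zext f l * (\sum_(i < n) zext (bv l) i ^+ 2))
    (fun l => zext f l * dot (bv l) (bv l))) => l.
  apply: cvgMr; have := cvg_dot (@Rp_bv _ _ _ uRp l) (@Rp_bv _ _ _ uRp l).
  by apply: cvg_trans; apply: near_eq_cvg; near=> n; apply: eq_bigr => i _; rewrite expr2.
have -> : \sum_(l < m) zext f l = \sum_(l < m) zext f l * dot (bv l) (bv l).
  apply: eq_bigr => l _; rewrite dot_bv// eqxx andbT.
  by case: (boolP (in_dim p l)) => [|/negbTE/zext_out ->]; rewrite ?mulr1// mul0r.
rewrite -(cvg_lim (@Rhausdorff R) cm); apply: limr_le.
  by apply/cvg_ex; eexists; exact: cm.
near=> n; apply: le_trans (lea n).
rewrite -(cvg_lim (@Rhausdorff R) (cs n)).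
apply: (@nondecreasing_cvgn_le _ (fun m => \sum_(l < m) zext f l * (\sum_(i < n) zext (bv l) i ^+ 2))).
  apply/nondecreasing_seqP => k; rewrite big_ord_recr/= lerDl mulr_ge0// sumr_ge0// => i _.
  exact: sqr_ge0.
by apply/cvg_ex; eexists; exact: cs.
Unshelve. all: end_near. Qed.

End trace.

Lemma trace_ext (A B : vec R p -> vec R p) :
  (forall i, A (basis_vec R i) = B (basis_vec R i)) -> trace A = trace B.
Proof.
by move=> E; rewrite /trace; congr (psum _); apply: funext => i; congr (dot _ _); exact: E.
Qed.

Definition tail_sigma k l : R := if (l < k)%N then 0 else sg l.
Definition tail_trace k : R := nneg_sum (tail_sigma k).

Lemma tail_sigma_ge0 k l : 0 <= tail_sigma k l.
Proof. by rewrite /tail_sigma; case: ifP => // _; exact: zext_sigma_ge0. Qed.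

Lemma sum_tail_sigma_le k n : \sum_(l < n) tail_sigma k l <= limn (series sg).
Proof.
apply: le_trans (sum_sigma_le n); apply: ler_sum => l _.
by rewrite /tail_sigma; case: ifP => // _; exact: zext_sigma_ge0.
Qed.

Lemma zext_tail_sigma k : zext (tail k sigma) = tail_sigma k.
Proof. by apply/funext => l; rewrite zext_tail. Qed.

Lemma tail_trace_cvg k :
  \sum_(l < n) tail_sigma k l @[n --> \oo] --> tail_trace k /\
  forall n, \sum_(l < n) tail_sigma k l <= tail_trace k.
Proof. exact: (nneg_sum_cvg (tail_sigma_ge0 k) (sum_tail_sigma_le k)). Qed.

Lemma trace_Sigma_tail k : trace (Sigma_tail sigma u k) = tail_trace k.
Proof.
rewrite /Sigma_tail (@trace_spec _ (limn (series sg))) ?zext_tail_sigma//.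
  exact: tail_sigma_ge0.
exact: sum_tail_sigma_le.
Qed.

Lemma tail_sigma_le k l : tail_sigma k l <= sg k.
Proof.
rewrite /tail_sigma; case: (ltnP l k) => [_|kl]; first exact: zext_sigma_ge0.
exact: zext_sigma_noninc.
Qed.

Lemma tail_sigma_bound k l : `|zext (tail k sigma) l| <= sg k.
Proof. by rewrite zext_tail_sigma ger0_norm ?tail_sigma_ge0// tail_sigma_le. Qed.

Lemma tail_traceS k : tail_trace k.+1 <= tail_trace k.
Proof.
have [c1 l1] := tail_trace_cvg k.
apply: (nneg_sum_le (tail_sigma_ge0 k.+1)) => n; apply: le_trans (l1 n).
apply: ler_sum => l _; rewrite /tail_sigma; case: (ltnP l k) => [lk|kl].
  by rewrite ltnW.
by case: ifP => // _; exact: zext_sigma_ge0.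
Qed.

Definition tail_trace2 k : R := nneg_sum (fun l => tail_sigma k l ^+ 2).

Lemma trace_Sigma_tail2 k :
  trace (fun v => Sigma_tail sigma u k (Sigma_tail sigma u k v)) = tail_trace2 k.
Proof.
pose f : vec R p := fun j => tail k sigma j ^+ 2.
have zf : zext f = fun l => tail_sigma k l ^+ 2.
  by apply/funext => l; rewrite -zext_tail_sigma /zext; case: insub => //=; rewrite expr0n.
have fb : forall l, `|zext f l| <= sg k ^+ 2.
  by move=> l; rewrite zf normrX ler_sqr ?nnegrE ?zext_sigma_ge0// -zext_tail_sigma tail_sigma_bound.
have fs n : \sum_(l < n) zext f l <= sg k * limn (series sg).
  rewrite zf; apply: (@le_trans _ _ (sg k * \sum_(l < n) tail_sigma k l)).
    rewrite mulr_sumr; apply: ler_sum => l _.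
    by rewrite expr2 ler_wpM2r ?tail_sigma_ge0// tail_sigma_le.
  by rewrite ler_wpM2l ?zext_sigma_ge0// sum_tail_sigma_le.
have f0 l : 0 <= zext f l by rewrite zf sqr_ge0.
transitivity (trace (spec u f)); last by rewrite (trace_spec f0 fs) zf.
suff E i : Sigma_tail sigma u k (Sigma_tail sigma u k (basis_vec R i)) = spec u f (basis_vec R i).
  exact: trace_ext E.
have Re := @Rp_basis R p i; have tb := tail_sigma_bound k.
have Rs : Rp (Sigma_tail sigma u k (basis_vec R i)) by exact: (Rp_spec uRp uon tb).
rewrite {1}/Sigma_tail (specE _ _ Rs) (specE _ _ Re); congr synth; apply/funext => l.
by rewrite (coef_spec uRp uon tb)// zf zext_tail_sigma mulrA expr2.
Qed.

Lemma opnorm_Sigma_tail k : opnorm (Sigma_tail sigma u k) = sg k.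
Proof.
have tb := tail_sigma_bound k.
have sk0 := zext_sigma_ge0 k.
set E := [set norm2 (Sigma_tail sigma u k v) | v in [set v | Rp v /\ norm2 v <= 1]].
have ub : ubound E (sg k).
  move=> _ [v [Rv v1] <-].
  rewrite -(ler_sqr (_ : _ \is Num.nneg) (_ : _ \is Num.nneg)) ?nnegrE ?sqrtr_ge0//.
  have c := cvg_norm2_spec uRp uon ucp tb Rv.
  rewrite -/(Sigma_tail sigma u k) in c.
  rewrite -(cvg_lim (@Rhausdorff R) c); apply: limr_le.
    by apply/cvg_ex; eexists; exact: c.
  near=> n; apply: (@le_trans _ _ (sg k ^+ 2 * \sum_(l < n) coef v l ^+ 2)).
    rewrite mulr_sumr; apply: ler_sum => l _; rewrite exprMn ler_wpM2r ?sqr_ge0//.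
    by rewrite -(real_normK (num_real (zext _ _))) ler_sqr ?nnegrE.
  rewrite ler_piMr ?sqr_ge0//; apply: (le_trans (bessel uRp uon n Rv)).
  by rewrite -(sqr_sqrtr (dot_ge0 Rv)) expr_le1// sqrtr_ge0.
(* With indices starting at 0, [sg k] is the largest eigenvalue of the tail, attained at [bv k].
   Beyond the dimension both [bv k] and [sg k] are 0 and the supremum is still attained. *)
have inE : E (sg k).
  have Rb : Rp (bv k) by exact: Rp_bv.
  exists (bv k).
    split=> //; rewrite /norm2 dot_bv// eqxx andbT.
    by case: (in_dim _ _); rewrite ?sqrtr1// sqrtr0.
  have -> : Sigma_tail sigma u k (bv k) = synth u (fun l => zext (tail k sigma) l * coef (bv k) l).
    by exact: specE.
  have -> : synth u (fun l => zext (tail k sigma) l * coef (bv k) l) =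
      (fun i => sg k * bv k i).
    apply/funext => i; apply: cvg_lim => //; apply: cvg_near_cst; near=> n.
    have kn : (k < n)%N by near: n; exact: nbhs_infty_gt.
    rewrite /comb (bigD1 (Ordinal kn))//= big1 ?addr0 => [|l /eqP lk].
      rewrite zext_tail_sigma /tail_sigma ltnn /basis_coef dot_bv// eqxx andbT.
      case: (boolP (in_dim p k)) => pk; first by rewrite mulr1.
      by rewrite mulr0 [sg k]zext_out ?(negbTE pk)// !mul0r.
    rewrite /basis_coef dot_bv//; case: eqP => [e|_]; last by rewrite andbF mulr0 mul0r.
    by case: lk; apply/val_inj.
  rewrite /norm2 dotZl//; last exact: RpZ.
  rewrite dotC dotZl// dot_bv// eqxx andbT.
  case: (boolP (in_dim p k)) => pk; last first.
    by rewrite [sg k]zext_out ?(negbTE pk)// mul0r sqrtr0.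
  by rewrite mulr1 -expr2 sqrtr_sqr ger0_norm.
rewrite /opnorm -/E; apply/eqP; rewrite eq_le; apply/andP; split.
  by apply: ge_sup => //; exists (sg k).
by apply: ub_le_sup => //; exists (sg k).
Unshelve. all: end_near. Qed.

(** The last claim is the minimality of [k]: the effective rank at k - 1 is below b N, which bounds
    the tail trace at k - 1, hence also at [k], by b N times the eigenvalue of index k - 1 and thus
    of any smaller index. *)
Lemma kstar_facts (b : R) (N k : nat) : 0 < b -> (0 < N)%N -> is_kstar sigma u b N k ->
  [/\ 0 < sg k, b * N%:R * sg k <= tail_trace k &
  forall j, (j < k)%N -> tail_trace k <= b * N%:R * sg j].
Proof.
move=> b0 N0 [h1 h2]; have bN : 0 < b * N%:R by rewrite mulr_gt0// ltr0n.
rewrite /eff_rank trace_Sigma_tail opnorm_Sigma_tail in h1.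
have sk : 0 < sg k.
  (* If [sg k] were 0, division by 0 would make the effective rank 0, below b N > 0. *)
  rewrite lt0r zext_sigma_ge0 andbT; apply: contraTneq h1 => ->.
  by rewrite invr0 mulr0 -ltNge.
split=> //; first by rewrite -ler_pdivlMr.
move=> j jk; case: k => // k in h1 h2 sk jk *.
have sk' : 0 < sg k by apply: lt_le_trans sk _; exact: zext_sigma_noninc.
apply: (le_trans (tail_traceS k)).
apply: (@le_trans _ _ (b * N%:R * sg k)); last first.
  by rewrite ler_wpM2l ?(ltW bN)// zext_sigma_noninc.
rewrite leNgt; apply/negP => h3.
have : (k.+1 <= k)%N.
  apply: h2; rewrite /eff_rank trace_Sigma_tail opnorm_Sigma_tail.
  by rewrite ler_pdivlMr// ltW.
by rewrite ltnn.
Qed.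

Lemma sqrt_sigma_bound k l : `|zext (tail k (fun j => Num.sqrt (sigma j))) l| <= Num.sqrt (sg 0).
Proof.
rewrite zext_tail; case: ifP => _; first by rewrite normr0 sqrtr_ge0.
rewrite (zext_map _ (sqrtr0 R)) ger0_norm ?sqrtr_ge0// ler_wsqrtr//.
exact: zext_sigma_noninc.
Qed.

Lemma norm2_Sigma_sqrt_ge v n : Rp v ->
  \sum_(l < n) sg l * coef v l ^+ 2 <= norm2 (Sigma_sqrt sigma u v) ^+ 2.
Proof.
move=> Rv.
have fb l : `|zext ((fun j => Num.sqrt (sigma j)) : vec R p) l| <= Num.sqrt (sg 0).
  rewrite (zext_map _ (sqrtr0 R)) ger0_norm ?sqrtr_ge0// ler_wsqrtr//.
  exact: zext_sigma_noninc.
have := norm2_spec_ge uRp uon fb n Rv; rewrite -/(Sigma_sqrt sigma u).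
apply: le_trans; apply: ler_sum => l _.
by rewrite (zext_map _ (sqrtr0 R)) exprMn sqr_sqrtr ?zext_sigma_ge0.
Qed.

Lemma proj_bound h k l :
  `|zext ((if h then Defs.head k (fun=> 1) else tail k (fun=> 1)) : vec R p) l| <= 1.
Proof.
have z1 : 0 <= zext ((fun=> 1) : vec R p) l <= 1.
  by rewrite /zext; case: insub => /= [_|]; rewrite ?ler01 lexx.
case: h; rewrite ?zext_head ?zext_tail; case: ifP => _; rewrite ?normr0// ger0_norm;
  by case/andP: z1.
Qed.

Lemma zext1 l : in_dim p l -> zext ((fun=> 1) : vec R p) l = 1.
Proof. by move=> pl; have [j _ ->] := zext_in ((fun=> 1) : vec R p) pl. Qed.

Lemma cvg_bias_tail k beta : Rp beta ->
  \sum_(l < n) tail_sigma k l * coef beta l ^+ 2 @[n --> \oo] -->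
  norm2 (Sigma_tail_sqrt sigma u k (proj_tail u k beta)) ^+ 2.
Proof.
move=> Rb; have Rpb : Rp (proj_tail u k beta) by exact: (Rp_spec uRp uon (proj_bound false k)).
have := cvg_norm2_spec uRp uon ucp (sqrt_sigma_bound k) Rpb.
apply: cvg_trans; apply: near_eq_cvg; near=> n; apply: eq_bigr => l _.
rewrite /proj_tail (coef_spec uRp uon (proj_bound false k))// !zext_tail /tail_sigma.
case: ifP => _; first by rewrite !mul0r expr0n.
rewrite (zext_map _ (sqrtr0 R)); have [pl|pl] := boolP (in_dim p l).
  by rewrite zext1// mul1r exprMn sqr_sqrtr// zext_sigma_ge0.
by rewrite [sg l]zext_out ?(negbTE pl)// sqrtr0 !mul0r expr0n.
Unshelve. all: end_near. Qed.

Lemma bias_head k beta : Rp beta ->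
  norm2 (Sigma_head_invsqrt sigma u k (proj_head u k beta)) ^+ 2 =
  \sum_(l < k) coef beta l ^+ 2 / sg l.
Proof.
move=> Rb; have Rpb : Rp (proj_head u k beta) by exact: (Rp_spec uRp uon (proj_bound true k)).
have ze l : zext ((fun j => (Num.sqrt (sigma j))^-1) : vec R p) l = (Num.sqrt (sg l))^-1.
  by rewrite (@zext_map (fun x => (Num.sqrt x)^-1))// sqrtr0 invr0.
have s0 (m : nat) : 0 <= (Num.sqrt (sg m))^-1 by rewrite invr_ge0 sqrtr_ge0.
have hb l : `|zext (Defs.head k (fun j => (Num.sqrt (sigma j))^-1)) l| <=
    \sum_(m < k) (Num.sqrt (sg m))^-1.
  rewrite zext_head; case: ifP => lk; last by rewrite normr0 sumr_ge0.
  by rewrite ze ger0_norm// (bigD1 (Ordinal lk))//= lerDl sumr_ge0.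
have c := cvg_norm2_spec uRp uon ucp hb Rpb.
apply: (cvg_unique _ c) => //; apply: cvg_near_cst; near=> n.
have kn : (k <= n)%N by near: n; exact: nbhs_infty_ge.
rewrite -(subnKC kn) big_split_ord/= [X in _ + X]big1 ?addr0 => [|l _]; last first.
  by rewrite zext_head ltnNge leq_addr/= mul0r expr0n.
apply: eq_bigr => l _; rewrite /proj_head (coef_spec uRp uon (proj_bound true k))//.
rewrite !zext_head ltn_ord ze.
have [pl|pl] := boolP (in_dim p l).
  by rewrite zext1// mul1r exprMn exprVn sqr_sqrtr ?zext_sigma_ge0// mulrC.
by rewrite [sg l]zext_out ?(negbTE pl)// sqrtr0 invr0 !(mul0r, mulr0) expr0n.
Unshelve. all: end_near. Qed.

(** Parseval between row [i] of [S] and [v]: the eigenvector equations give the coefficients of that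
    row. *)
Lemma coef_mulmv v i : Rp v -> mulmv S v i = spec u sigma v i.
Proof.
move=> Rv; have sb l : `|sg l| <= sg 0.
  by rewrite ger0_norm ?zext_sigma_ge0// zext_sigma_noninc.
have RS : Rp (S i) by exact: (cov_rows cov).
have c1 := parseval uRp uon ucp RS Rv.
have c2 := cvg_comb uRp uon (i:=i) (spec_sqr_summable uRp uon sb Rv).
rewrite specE//; apply: (cvg_unique _ c1) => //; move: c2.
apply: cvg_trans; apply: near_eq_cvg; near=> n; apply: eq_bigr => l _.
have -> : coef (S i) l = sg l * bv l i.
  have [pl|pl] := boolP (in_dim p l).
    have [j -> ->] := zext_in sigma pl.
    by rewrite /basis_coef bv_val dotC -(cov_eigen cov).
  rewrite (coef_out uRp uon) ?(negbTE pl)//.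
  by rewrite [sg l]zext_out ?(negbTE pl)// mul0r.
by ring.
Unshelve. all: end_near. Qed.

Definition cov_form v : R := dot v (mulmv S v).

Lemma cvg_qcov v : Rp v -> \sum_(l < n) sg l * coef v l ^+ 2 @[n --> \oo] --> cov_form v.
Proof.
move=> Rv; have sb l : `|sg l| <= sg 0.
  by rewrite ger0_norm ?zext_sigma_ge0// zext_sigma_noninc.
rewrite /cov_form (_ : mulmv S v = spec u sigma v); last by apply/funext => i; exact: coef_mulmv.
have Rs := Rp_spec uRp uon sb Rv.
have := parseval uRp uon ucp Rv Rs; apply: cvg_trans; apply: near_eq_cvg; near=> n.
by apply: eq_bigr => l _; rewrite (coef_spec uRp uon sb)//; ring.
Unshelve. all: end_near. Qed.

Lemma qcov_ge0 v : Rp v -> 0 <= cov_form v.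
Proof.
move=> Rv; have c := cvg_qcov Rv; rewrite -(cvg_lim (@Rhausdorff R) c); apply: limr_ge.
  by apply/cvg_ex; eexists; exact: c.
by near=> n; apply: sumr_ge0 => l _; rewrite mulr_ge0 ?sqr_ge0 ?zext_sigma_ge0.
Unshelve. all: end_near. Qed.

Lemma qcov_comb c n : cov_form (comb u c n) = \sum_(l < n) sg l * c l ^+ 2.
Proof.
have Rc := @Rp_comb _ _ _ uRp c n.
apply: (cvg_unique _ (cvg_qcov Rc)) => //; apply: cvg_near_cst; near=> m.
have nm : (n <= m)%N by near: m; exact: nbhs_infty_ge.
rewrite -(subnKC nm) big_split_ord/= [X in _ + X]big1 ?addr0 => [|l _]; last first.
  by rewrite coef_comb// ltnNge leq_addr/= expr0n mulr0.
apply: eq_bigr => l _; rewrite coef_comb// ltn_ord/=.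
case: (boolP (in_dim p l)) => // pl.
by rewrite [sg l]zext_out ?(negbTE pl)// !mul0r.
Unshelve. all: end_near. Qed.

(* [u_j] is an eigenvector, hence orthogonality to it is preserved. *)
Lemma qcov_add_orth (j : nat) (a : R) v : Rp v -> coef v j = 0 ->
  cov_form (fun i => a * bv j i + v i) = sg j * a ^+ 2 + cov_form v.
Proof.
move=> Rv vj; have Rb := @Rp_bv _ _ _ uRp j.
have Rab : Rp (fun i => a * bv j i) by exact: RpZ.
have Rs : Rp (fun i => a * bv j i + v i) by exact: RpD.
have c1 := cvg_qcov Rs; have c2 := cvg_qcov Rv.
have c3 : sg j * a ^+ 2 + \sum_(l < n) sg l * coef v l ^+ 2 @[n --> \oo] --> sg j * a ^+ 2 + cov_form v.
  by apply: cvgD => //; exact: cvg_cst.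
apply: (cvg_unique _ c1) => //; move: c3; apply: cvg_trans; apply: near_eq_cvg; near=> n.
have jn : (j < n)%N by near: n; exact: nbhs_infty_gt.
have ce l : coef (fun i => a * bv j i + v i) l = a * (in_dim p l && (l == j))%:R + coef v l.
  have Rbl := @Rp_bv _ _ _ uRp l.
  rewrite /basis_coef dotC dotDl// dotZl// dotC dot_bv// dotC.
  by case: eqVneq => [->|]; rewrite ?andbF// eqxx andbT.
rewrite (bigD1 (Ordinal jn))//= [in RHS](bigD1 (Ordinal jn))//= addrA; congr (_ + _).
  rewrite ce eqxx andbT vj; case: (boolP (in_dim p j)) => pj /=; first by ring.
  by rewrite [sg j]zext_out ?(negbTE pj)//; ring.
apply: eq_bigr => l /eqP lj; rewrite ce; case: eqP => [e|_]; last by rewrite andbF mulr0 add0r.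
by case: lj; apply/val_inj.
Unshelve. all: end_near. Qed.

End covariance.

(** * Moments of Gaussian quadratic forms *)

Section finite_moments.
Context (R : realType) (d : measure_display) (T : measurableType d)
  (P : probability T R).
Implicit Types f g : T -> R.

(** Asking for all powers makes the class an algebra, products being controlled by 2 |f g|^n <=
    f^{2n} + g^{2n}; polynomials in Gaussian variables then need no separate integrability
    proofs. *)
Definition finite_moments f := measurable_fun setT f /\
  forall n, P.-integrable setT (EFin \o (fun w => f w ^+ n)).

Lemma finite_moments_cst (a : R) : finite_moments (fun=> a).
Proof. by split=> [|n]; [exact: measurable_cst|exact: finite_measure_integrable_cst]. Qed.

Lemma finite_moments_integrable f : finite_moments f -> P.-integrable setT (EFin \o f).
Proof. by move=> [_ /(_ 1%N)]. Qed.

Lemma finite_momentsM f g : finite_moments f -> finite_moments g ->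
  finite_moments (fun w => f w * g w).
Proof.
move=> [mf fi] [mg gi]; split=> [|n]; first exact: measurable_funM.
have i : P.-integrable setT (fun w => (f w ^+ (n * 2))%:E + (g w ^+ (n * 2))%:E)%E.
  by apply: integrableD => //; [exact: fi|exact: gi].
apply: (le_integrable measurableT _ _ i).
  by apply: measurableT_comp => //; apply: measurable_funX; exact: measurable_funM.
move=> w _; rewrite -EFinD !abse_EFin lee_fin exprMn !exprM.
have h1 := sqr_ge0 (f w ^+ n + g w ^+ n); have h2 := sqr_ge0 (f w ^+ n - g w ^+ n).
rewrite [leRHS]ger0_norm; last by rewrite addr_ge0// sqr_ge0.
by rewrite ler_norml; apply/andP; split; nra.
Qed.

Lemma finite_momentsX f n : finite_moments f -> finite_moments (fun w => f w ^+ n).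
Proof.
move=> mf; elim: n => [|n ih].
  by under eq_fun do rewrite expr0; exact: finite_moments_cst.
by under eq_fun do rewrite exprS; exact: finite_momentsM.
Qed.

Lemma finite_momentsZ (a : R) f : finite_moments f -> finite_moments (fun w => a * f w).
Proof. by move=> mf; apply: finite_momentsM => //; exact: finite_moments_cst. Qed.

Lemma finite_momentsD f g : finite_moments f -> finite_moments g ->
  finite_moments (fun w => f w + g w).
Proof.
move=> mf mg; split=> [|n]; first by apply: measurable_funD; [case: mf|case: mg].
under eq_fun do rewrite exprDn.
rewrite (_ : _ \o _ = (fun w => \sum_(i < n.+1) (f w ^+ (n - i) * g w ^+ i *+ 'C(n, i))%:E)%E); last first.
  by apply/funext => w; rewrite /= sumEFin.
apply: integrable_sum => // i _.
under eq_fun do rewrite -mulr_natl.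
apply: finite_moments_integrable; apply: finite_momentsZ.
by apply: finite_momentsM; exact: finite_momentsX.
Qed.

Lemma finite_moments_sum (I : Type) (r : seq I) (f : I -> T -> R) :
  (forall i, finite_moments (f i)) -> finite_moments (fun w => \sum_(i <- r) f i w).
Proof.
move=> mf; elim: r => [|i r ih].
  by under eq_fun do rewrite big_nil; exact: finite_moments_cst.
by under eq_fun do rewrite big_cons; exact: finite_momentsD.
Qed.

Definition Ex f : R := (\int[P]_w f w)%R.

Lemma Ex_cst (a : R) : Ex (fun=> a) = a.
Proof.
by rewrite /Ex Rintegral_cst// [X in fine X](@probability_setT _ _ _ P) mulr1.
Qed.

Lemma ExD f g : finite_moments f -> finite_moments g ->
  Ex (fun w => f w + g w) = Ex f + Ex g.
Proof. by move=> /finite_moments_integrable mf /finite_moments_integrable mg; exact: RintegralD. Qed.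

Lemma ExZ (a : R) f : finite_moments f -> Ex (fun w => a * f w) = a * Ex f.
Proof. by move=> /finite_moments_integrable mf; exact: RintegralZl. Qed.

Lemma Ex_sum (I : Type) (r : seq I) (f : I -> T -> R) :
  (forall i, finite_moments (f i)) -> Ex (fun w => \sum_(i <- r) f i w) = \sum_(i <- r) Ex (f i).
Proof.
move=> mf; elim: r => [|i r ih].
  by rewrite big_nil; under eq_fun do rewrite big_nil; exact: Ex_cst.
rewrite big_cons -ih -ExD//; last exact: finite_moments_sum.
by congr Ex; apply/funext => w; rewrite big_cons.
Qed.

Lemma ExE f : finite_moments f -> (\int[P]_w (f w)%:E = (Ex f)%:E)%E.
Proof.
by move=> /finite_moments_integrable mf; rewrite /Ex /Rintegral fineK//; exact: integrable_fin_num.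
Qed.

Lemma law_finite_moments Z (v : R) : 0 <= v -> has_centered_normal_law P Z v ->
  finite_moments Z.
Proof. by move=> v0 lZ; split=> [|n]; [case: lZ|exact: law_integrable_pow lZ n]. Qed.

End finite_moments.

(** * Wick formulas and quadratic forms of a Gaussian vector *)

Section gaussian_vector.
Context (R : realType) (d : measure_display) (T : measurableType d)
  (P : probability T R) (n : nat).
Variables (Y : 'I_n -> T -> R) (s : 'I_n -> R).

(** A centered Gaussian vector with diagonal covariance [s], described by the laws of its linear
    forms, the form in which the model provides it. *)
Definition gaussian_vector := (forall i, 0 <= s i) /\
  forall a : 'I_n -> R, has_centered_normal_law P (fun w => \sum_i a i * Y i w)
    (\sum_i s i * a i ^+ 2).

Hypothesis gY : gaussian_vector.
Local Notation Ex := (Ex P).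
Local Notation fm := (finite_moments P).

Let L (a : 'I_n -> R) w := \sum_i a i * Y i w.
Let b (a c : 'I_n -> R) : R := \sum_i s i * (a i * c i).

Let q0 a : 0 <= \sum_i s i * a i ^+ 2.
Proof. by apply: sumr_ge0 => i _; rewrite mulr_ge0 ?sqr_ge0//; apply gY.1. Qed.

Let fmL a : fm (L a).
Proof. exact: law_finite_moments (q0 a) (gY.2 a). Qed.

Let L4 a : Ex (fun w => L a w ^+ 4) = 3 * b a a ^+ 2.
Proof. by rewrite /Ex /Rintegral (law_integral_pow4 (q0 a) (gY.2 a)). Qed.

Let L2 a : Ex (fun w => L a w ^+ 2) = b a a.
Proof. by rewrite /Ex /Rintegral (law_integral_pow2 (q0 a) (gY.2 a)). Qed.

Let bD a1 a2 a3 a4 (t2 t3 t4 : R) :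
  b (fun i => a1 i + t2 * a2 i + t3 * a3 i + t4 * a4 i)
    (fun i => a1 i + t2 * a2 i + t3 * a3 i + t4 * a4 i) =
  b a1 a1 + t2 ^+ 2 * b a2 a2 + t3 ^+ 2 * b a3 a3 + t4 ^+ 2 * b a4 a4 +
  2 * t2 * b a1 a2 + 2 * t3 * b a1 a3 + 2 * t4 * b a1 a4 +
  2 * (t2 * t3) * b a2 a3 + 2 * (t2 * t4) * b a2 a4 + 2 * (t3 * t4) * b a3 a4.
Proof.
rewrite /b !mulr_sumr -!big_split/=; apply: eq_bigr => i _; ring.
Qed.

Let LD a1 a2 a3 a4 (t2 t3 t4 : R) w :
  L (fun i => a1 i + t2 * a2 i + t3 * a3 i + t4 * a4 i) w =
  L a1 w + t2 * L a2 w + t3 * L a3 w + t4 * L a4 w.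
Proof. rewrite /L !mulr_sumr -!big_split/=; apply: eq_bigr => i _; ring. Qed.

(** Wick's formula by polarization: summing t2 t3 t4 (L1 + t2 L2 + t3 L3 + t4 L4)^4 over the eight
    choices of signs leaves 8 times 24 = 192 times the product, and the fourth moments of linear
    forms are known. *)
Let polar4 a1 a2 a3 a4 : Ex (fun w => L a1 w * L a2 w * L a3 w * L a4 w) =
  b a1 a2 * b a3 a4 + b a1 a3 * b a2 a4 + b a1 a4 * b a2 a3.
Proof.
pose F (t2 t3 t4 : R) w := (t2 * t3 * t4 / 192) *
  L (fun i => a1 i + t2 * a2 i + t3 * a3 i + t4 * a4 i) w ^+ 4.
have fF t2 t3 t4 : fm (F t2 t3 t4) by apply: finite_momentsZ; exact: finite_momentsX.
have EF t2 t3 t4 : Ex (F t2 t3 t4) = (t2 * t3 * t4 / 192) * (3 *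
  (b (fun i => a1 i + t2 * a2 i + t3 * a3 i + t4 * a4 i)
    (fun i => a1 i + t2 * a2 i + t3 * a3 i + t4 * a4 i)) ^+ 2).
  by rewrite ExZ ?L4//; exact: finite_momentsX.
pose ts : seq (R * R * R) := [:: (1, 1, 1); (1, 1, -1); (1, -1, 1); (1, -1, -1);
  (-1, 1, 1); (-1, 1, -1); (-1, -1, 1); (-1, -1, -1)].
have -> : (fun w => L a1 w * L a2 w * L a3 w * L a4 w) =
    (fun w => \sum_(t <- ts) F t.1.1 t.1.2 t.2 w).
  by apply/funext => w; rewrite /ts !big_cons big_nil /F !LD /=; field.
rewrite Ex_sum => [|t]; last exact: fF.
by rewrite /ts !big_cons big_nil !EF !bD /=; field.
Qed.

Let polar2 a1 a2 : Ex (fun w => L a1 w * L a2 w) = b a1 a2.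
Proof.
(* The two zero coefficients allow the four-term expansions [LD] and [bD] to be reused. *)
pose F (t : R) w := (t / 4) * L (fun i => a1 i + t * a2 i + 0 * a2 i + 0 * a2 i) w ^+ 2.
have fF t : fm (F t) by apply: finite_momentsZ; exact: finite_momentsX.
have EF t : Ex (F t) = (t / 4) * (b (fun i => a1 i + t * a2 i + 0 * a2 i + 0 * a2 i)
    (fun i => a1 i + t * a2 i + 0 * a2 i + 0 * a2 i)).
  by rewrite ExZ ?L2//; exact: finite_momentsX.
have -> : (fun w => L a1 w * L a2 w) = (fun w => F 1 w + F (-1) w).
  by apply/funext => w; rewrite /F !LD; field.
by rewrite ExD// !EF !bD; field.
Qed.

Let e (i : 'I_n) : 'I_n -> R := fun k => (k == i)%:R.

Let sum_delta (i : 'I_n) (F : 'I_n -> R) : \sum_k (k == i)%:R * F k = F i.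
Proof. by rewrite (bigD1 i)//= eqxx mul1r big1 ?addr0// => k /negbTE ->; rewrite mul0r. Qed.

Let Le i : L (e i) = Y i.
Proof. by apply/funext => w; exact: sum_delta. Qed.

Let be i k : b (e i) (e k) = s i * (k == i)%:R.
Proof.
rewrite /b; under eq_bigr => j _ do rewrite mulrCA /e.
by rewrite sum_delta eq_sym.
Qed.

Lemma gaussian_vector_finite_moments i : fm (Y i).
Proof. by rewrite -Le. Qed.

Lemma gaussian_vector_moment2 i k : Ex (fun w => Y i w * Y k w) = s i * (k == i)%:R.
Proof. by rewrite -!Le polar2 be. Qed.

Lemma gaussian_vector_moment4 i k l m : Ex (fun w => Y i w * Y k w * Y l w * Y m w) =
  (s i * (k == i)%:R) * (s l * (m == l)%:R) + (s i * (l == i)%:R) * (s k * (m == k)%:R)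
  + (s i * (m == i)%:R) * (s k * (l == k)%:R).
Proof. by rewrite -!Le polar4 !be. Qed.

Definition rv_qf (B : 'M[R]_n) w := \sum_i \sum_k B i k * (Y i w * Y k w).

Let fmYY i k : fm (fun w => Y i w * Y k w).
Proof. by apply: finite_momentsM; exact: gaussian_vector_finite_moments. Qed.

Lemma rv_qf_finite_moments B : fm (rv_qf B).
Proof.
by apply: finite_moments_sum => i; apply: finite_moments_sum => k; exact: finite_momentsZ.
Qed.

Lemma Ex_rv_qf B : Ex (rv_qf B) = \sum_i s i * B i i.
Proof.
rewrite Ex_sum => [|i]; last by apply: finite_moments_sum => k; exact: finite_momentsZ.
apply: eq_bigr => i _; rewrite Ex_sum => [|k]; last exact: finite_momentsZ.
under eq_bigr => k _ do rewrite ExZ// gaussian_vector_moment2 mulrA mulrC.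
by rewrite sum_delta mulrC.
Qed.

(** Of the three pairings in Wick's formula one gives the squared mean, and the other two coincide
    because [B] is symmetric. *)
Lemma Ex_rv_qf_sqr B : B^T = B -> Ex (fun w => rv_qf B w ^+ 2) =
  (\sum_i s i * B i i) ^+ 2 + 2 * \sum_i \sum_k s i * s k * B i k ^+ 2.
Proof.
move=> BT.
have -> : (fun w => rv_qf B w ^+ 2) = (fun w => \sum_i \sum_k \sum_l \sum_m
    (B i k * B l m) * (Y i w * Y k w * Y l w * Y m w)).
  apply/funext => w; rewrite expr2 {1}/rv_qf mulr_suml; apply: eq_bigr => i _.
  rewrite mulr_suml; apply: eq_bigr => k _; rewrite mulr_sumr; apply: eq_bigr => l _.
  rewrite mulr_sumr; apply: eq_bigr => m _; ring.
have fm4 i k l m : fm (fun w => (B i k * B l m) * (Y i w * Y k w * Y l w * Y m w)).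
  by apply: finite_momentsZ; apply: finite_momentsM => //;
    [apply: finite_momentsM => //|]; exact: gaussian_vector_finite_moments.
have fm3 i k l : fm (fun w => \sum_m (B i k * B l m) * (Y i w * Y k w * Y l w * Y m w)).
  exact: finite_moments_sum.
have fm2 i k : fm (fun w => \sum_l \sum_m (B i k * B l m) * (Y i w * Y k w * Y l w * Y m w)).
  exact: finite_moments_sum.
have fm1 i : fm (fun w => \sum_k \sum_l \sum_m (B i k * B l m) * (Y i w * Y k w * Y l w * Y m w)).
  exact: finite_moments_sum.
have fm4' i k l m : fm (fun w => Y i w * Y k w * Y l w * Y m w).
  by apply: finite_momentsM => //;
    [apply: finite_momentsM => //|]; exact: gaussian_vector_finite_moments.
rewrite Ex_sum//.
have inner i k : Ex (fun w => \sum_l \sum_m (B i k * B l m) * (Y i w * Y k w * Y l w * Y m w)) =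
    (s i * B i k * (k == i)%:R) * (\sum_l s l * B l l) + 2 * (s i * s k * B i k ^+ 2).
  rewrite Ex_sum//.
  have h l : Ex (fun w => \sum_m (B i k * B l m) * (Y i w * Y k w * Y l w * Y m w)) =
     (s i * B i k * (k == i)%:R) * (s l * B l l) +
     (l == i)%:R * (s i * s k * (B i k * B l k)) + (l == k)%:R * (s i * s k * (B i k * B l i)).
    rewrite Ex_sum//.
    under eq_bigr => m _ do rewrite ExZ// gaussian_vector_moment4.
    transitivity (\sum_m (m == l)%:R * (B i k * B l m * (s i * (k == i)%:R * s l)) +
       \sum_m (m == k)%:R * (B i k * B l m * (s i * (l == i)%:R * s k)) +
       \sum_m (m == i)%:R * (B i k * B l m * (s i * (s k * (l == k)%:R)))).
      by rewrite -!big_split/=; apply: eq_bigr => m _; ring.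
    by rewrite !sum_delta; ring.
  under eq_bigr => l _ do rewrite h.
  rewrite !big_split/= -mulr_sumr !sum_delta -addrA; congr (_ + _).
  have -> : B k i = B i k by rewrite -{1}BT mxE.
  by ring.
transitivity (\sum_i ((s i * B i i) * (\sum_l s l * B l l) + 2 * \sum_k (s i * s k * B i k ^+ 2))).
  apply: eq_bigr => i _; rewrite Ex_sum//.
  under eq_bigr => k _ do rewrite inner.
  rewrite big_split/= -mulr_sumr; congr (_ + _).
  rewrite -mulr_suml; congr (_ * _).
  by under eq_bigr => k _ do rewrite mulrC; rewrite sum_delta.
by rewrite big_split/= -mulr_suml -mulr_sumr expr2.
Qed.

End gaussian_vector.

(** * Random matrices and probability bounds *)

Section measurable_matrix.
Context (R : realType).

Lemma measurable_inv : measurable_fun [set: R] (fun x : R => x^-1).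
Proof.
rewrite -(setUv [set (0:R)]); apply/measurable_funU => //; first exact: measurableC.
split; first exact: measurable_fun_set1.
apply: open_continuous_measurable_fun.
  by rewrite openC; exact: closed_eq.
by move=> x; rewrite inE => /eqP x0; exact: inv_continuous.
Qed.

Context (d : measure_display) (T : measurableType d).

Definition measurable_mx m n (A : T -> 'M[R]_(m, n)) :=
  forall i j, measurable_fun setT (fun w => A w i j).

Lemma measurable_mx_cst m n (A : 'M[R]_(m, n)) : measurable_mx (fun=> A).
Proof. by move=> i j; exact: measurable_cst. Qed.

Lemma measurable_mxD m n (A B : T -> 'M[R]_(m, n)) :
  measurable_mx A -> measurable_mx B -> measurable_mx (fun w => A w + B w).
Proof. by move=> mA mB i j; under eq_fun do rewrite mxE; exact: measurable_funD. Qed.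

Lemma measurable_mxZ m n (f : T -> R) (A : T -> 'M[R]_(m, n)) :
  measurable_fun setT f -> measurable_mx A -> measurable_mx (fun w => f w *: A w).
Proof. by move=> mf mA i j; under eq_fun do rewrite mxE; exact: measurable_funM. Qed.

Lemma measurable_mulmx m n q (A : T -> 'M[R]_(m, n)) (B : T -> 'M[R]_(n, q)) :
  measurable_mx A -> measurable_mx B -> measurable_mx (fun w => A w *m B w).
Proof.
move=> mA mB i j; under eq_fun do rewrite mxE.
by apply: measurable_sum => k; exact: measurable_funM.
Qed.

Lemma measurable_trmx m n (A : T -> 'M[R]_(m, n)) :
  measurable_mx A -> measurable_mx (fun w => (A w)^T).
Proof. by move=> mA i j; under eq_fun do rewrite mxE; exact: mA. Qed.

Lemma measurable_det n (A : T -> 'M[R]_n) :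
  measurable_mx A -> measurable_fun setT (fun w => \det (A w)).
Proof.
move=> mA; apply: measurable_sum => s; apply: measurable_funM => //.
by apply: measurable_prod => i _; exact: mA.
Qed.

Lemma measurable_trace n (A : T -> 'M[R]_n) :
  measurable_mx A -> measurable_fun setT (fun w => \tr (A w)).
Proof. by move=> mA; apply: measurable_sum => s; exact: mA. Qed.

Lemma measurable_dotv n (u v : T -> 'cV[R]_n) :
  measurable_mx u -> measurable_mx v -> measurable_fun setT (fun w => dotv (u w) (v w)).
Proof. by move=> mu mv; apply: measurable_sum => i; exact: measurable_funM. Qed.

Lemma measurable_qf n (A : T -> 'M[R]_n) (v : T -> 'cV[R]_n) :
  measurable_mx A -> measurable_mx v -> measurable_fun setT (fun w => qf (A w) (v w)).
Proof. by move=> mA mv; apply: measurable_dotv => //; exact: measurable_mulmx. Qed.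

Lemma measurable_cV n (f : 'I_n -> T -> R) : (forall i, measurable_fun setT (f i)) ->
  measurable_mx (fun w => \col_i f i w).
Proof. by move=> mf i j; under eq_fun do rewrite mxE; exact: mf. Qed.

(* Unlike [invmx], this is a rational function of the entries everywhere. *)
Definition inv0 n (A : 'M[R]_n) : 'M[R]_n := (\det A)^-1 *: \adj A.

Lemma inv0E n (A : 'M[R]_n) : A \in unitmx -> inv0 A = invmx A.
Proof. by rewrite /invmx => ->. Qed.

Lemma measurable_inv0 n (A : T -> 'M[R]_n) :
  measurable_mx A -> measurable_mx (fun w => inv0 (A w)).
Proof.
move=> mA; apply: measurable_mxZ.
  by apply: measurableT_comp; [exact: measurable_inv|exact: measurable_det].
move=> i j; under eq_fun do rewrite mxE; apply: measurable_funM => //.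
by apply: measurable_det => k l; under eq_fun do rewrite !mxE; exact: mA.
Qed.

Lemma measurable_unit n (A : T -> 'M[R]_n) :
  measurable_mx A -> measurable_fun setT (fun w => A w \in unitmx).
Proof.
move=> mA; under eq_fun do rewrite unitmxE unitfE.
apply: measurable_neg; apply: measurable_fun_eqr => //; exact: measurable_det.
Qed.

Lemma measurable_bool (b : T -> bool) : measurable_fun setT b ->
  measurable_fun setT (fun w => (b w)%:R : R).
Proof.
move=> mb; rewrite (_ : (fun w => _) = (fun w => if b w then 1 else 0)).
  exact: measurable_fun_ifT.
by apply/funext => w; case: (b w).
Qed.

End measurable_matrix.

Lemma measurable_mx_comp (R : realType) d d' (T : measurableType d) (T' : measurableType d')
    (f : T' -> T) m n (A : T -> 'M[R]_(m, n)) :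
  measurable_fun setT f -> measurable_mx A -> measurable_mx (A \o f).
Proof. by move=> mf mA i j; exact: (measurableT_comp (mA i j) mf). Qed.

Section events.
Context (R : realType) (d : measure_display) (T : measurableType d)
  (P : probability T R).
Local Notation fm := (finite_moments P).
Local Notation Ex := (Ex P).

(** The integral of a nonnegative function is a supremum over the simple functions below it, which
    makes it monotone. *)
Lemma ge0_le_integral_nonmeasurable (f g : T -> \bar R) :
  (forall w, 0 <= f w)%E -> (forall w, f w <= g w)%E ->
  (\int[P]_w f w <= \int[P]_w g w)%E.
Proof.
move=> f0 fg; rewrite !ge0_integralTE//; last by move=> w; exact: le_trans (fg w).
apply: le_ereal_sup => _ [h hf <-]; exists h => // w.
exact: le_trans (hf w) (fg w).
Qed.

Lemma finite_moments_bounded (f : T -> R) (M : R) : measurable_fun setT f ->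
  (forall w, `|f w| <= M) -> fm f.
Proof.
move=> mf fM; split => // n; apply: (@bounded_integrable _ _ _ _ _ (M ^+ n)).
  exact: measurable_funX.
move=> w; rewrite normrX; apply: lerXn2r; rewrite ?nnegrE//.
exact: le_trans (fM w).
Qed.

Definition pr (b : T -> bool) : R := Ex (fun w => (b w)%:R).

Lemma finite_moments_bool (b : T -> bool) : measurable_fun setT b -> fm (fun w => (b w)%:R).
Proof.
move=> mb; apply: (@finite_moments_bounded _ 1); first exact: measurable_bool.
move=> w.
by case: (b w); rewrite ?normr1 ?normr0.
Qed.

Lemma Ex_le f g : fm f -> fm g -> (forall w, f w <= g w) -> Ex f <= Ex g.
Proof.
move=> ff fg h; apply: le_Rintegral => //; exact: finite_moments_integrable.
Qed.

Lemma pr_le (b b' : T -> bool) : measurable_fun setT b -> measurable_fun setT b' ->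
  (forall w, b w -> b' w) -> pr b <= pr b'.
Proof.
move=> mb mb' h; apply: Ex_le; [exact: finite_moments_bool..|].
by move=> w; rewrite ler_nat; have := h w; case: (b w) => // ->.
Qed.

Lemma pr_ge0 (b : T -> bool) : 0 <= pr b.
Proof. by apply: Rintegral_ge0. Qed.

Lemma pr_not (b : T -> bool) : measurable_fun setT b -> pr (fun w => ~~ b w) = 1 - pr b.
Proof.
move=> mb; have fb := finite_moments_bool mb.
rewrite /pr -{2}(Ex_cst P 1) -[- Ex _]mulN1r -ExZ// -ExD//; last 2 first.
- exact: finite_moments_cst.
- exact: finite_momentsZ.
by congr Ex; apply/funext => w; case: (b w) => /=; ring.
Qed.

Lemma pr_and (b b' : T -> bool) : measurable_fun setT b -> measurable_fun setT b' ->
  pr b + pr b' - 1 <= pr (fun w => b w && b' w).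
Proof.
move=> mb mb'; have fb := finite_moments_bool mb; have fb' := finite_moments_bool mb'.
have -> : pr b + pr b' - 1 = Ex (fun w => (b w)%:R + (b' w)%:R + (- 1)).
  by rewrite ExD; [rewrite ExD// Ex_cst|exact: finite_momentsD|exact: finite_moments_cst].
apply: Ex_le.
- by apply: finite_momentsD; [exact: finite_momentsD|exact: finite_moments_cst].
- by apply: finite_moments_bool; exact: measurable_and.
- by move=> w; case: (b w); case: (b' w) => /=; lra.
Qed.

Lemma markov_pr (f : T -> R) (c : R) : fm f -> (forall w, 0 <= f w) ->
  0 <= c -> c * pr (fun w => c < f w) <= Ex f.
Proof.
move=> ff f0 c0; have mb : measurable_fun setT (fun w => c < f w).
  by apply: measurable_fun_ltr => //; case: ff.
rewrite -ExZ; last exact: finite_moments_bool.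
apply: Ex_le => //; first by apply: finite_momentsZ; exact: finite_moments_bool.
by move=> w; case: ltP => [/ltW|_]; rewrite ?mulr1 ?mulr0.
Qed.

Lemma chebyshev_pr (f : T -> R) (c : R) : fm f -> c <= Ex f ->
  (Ex f - c) ^+ 2 * pr (fun w => f w <= c) <= Ex (fun w => f w ^+ 2) - Ex f ^+ 2.
Proof.
move=> ff cf; set m := Ex f; have mb : measurable_fun setT (fun w => f w <= c).
  by apply: measurable_fun_ler => //; case: ff.
have fb := finite_moments_bool mb.
have f2 := finite_momentsX 2 ff.
have fl : fm (fun w => f w ^+ 2 + (- (2 * m) * f w + m ^+ 2)).
  by apply: finite_momentsD => //; apply: finite_momentsD;
    [exact: finite_momentsZ|exact: finite_moments_cst].
have -> : Ex (fun w => f w ^+ 2) - m ^+ 2 = Ex (fun w => f w ^+ 2 + (- (2 * m) * f w + m ^+ 2)).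
  rewrite ExD//; last by apply: finite_momentsD; [exact: finite_momentsZ|exact: finite_moments_cst].
  rewrite ExD; [|exact: finite_momentsZ|exact: finite_moments_cst].
  by rewrite ExZ// Ex_cst -/m; ring.
rewrite -ExZ//; apply: Ex_le => //; first exact: finite_momentsZ.
move=> w; have -> : f w ^+ 2 + (- (2 * m) * f w + m ^+ 2) = (m - f w) ^+ 2 by ring.
case: (boolP (f w <= c)) => h; rewrite ?mulr0 ?sqr_ge0// mulr1.
by rewrite ler_sqr ?nnegrE ?subr_ge0 ?lerB//; exact: le_trans cf.
Qed.

(* Paley-Zygmund: [f <= m / 2 + f ^+ 2 / (12 * m) + 3 * m] on [m / 2 <= f], by AM-GM. *)
Lemma paley_zygmund (f : T -> R) : fm f -> (forall w, 0 <= f w) -> 0 < Ex f ->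
  Ex (fun w => f w ^+ 2) <= 3 * Ex f ^+ 2 -> 12^-1 <= pr (fun w => Ex f / 2 <= f w).
Proof.
move=> ff f0; set m := Ex f => m0 h; set b := fun w => m / 2 <= f w.
have mb : measurable_fun setT b by apply: measurable_fun_ler => //; case: ff.
have fb := finite_moments_bool mb; have f2 := finite_momentsX 2 ff.
have h1 : m <= Ex (fun w => m / 2 + ((12 * m)^-1 * f w ^+ 2 + 3 * m * (b w)%:R)).
  apply: Ex_le => //.
    by apply: finite_momentsD; [exact: finite_moments_cst|apply: finite_momentsD; exact: finite_momentsZ].
  move=> w; have e : f w = f w by []; move: e.
  have : 0 <= (12 * m)^-1 * f w ^+ 2 by rewrite mulr_ge0 ?sqr_ge0// invr_ge0 mulr_ge0// ltW.
  rewrite /b; case: (boolP (m / 2 <= f w)) => [h2 _ _|]; last by rewrite -ltNge => h2 h3 _; rewrite mulr0 addr0; lra.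
  have -> : m / 2 + ((12 * m)^-1 * f w ^+ 2 + 3 * m * true%:R) =
    f w + (12 * m)^-1 * (f w - 6 * m) ^+ 2 + m / 2.
    by rewrite /=; field; rewrite gt_eqF.
  rewrite -addrA lerDl addr_ge0//; last by rewrite divr_ge0// ltW.
  by rewrite mulr_ge0 ?sqr_ge0// invr_ge0 mulr_ge0// ltW.
rewrite ExD in h1; [|exact: finite_moments_cst|by apply: finite_momentsD; exact: finite_momentsZ].
rewrite ExD in h1; [|exact: finite_momentsZ..].
rewrite Ex_cst !ExZ// -/(pr b) in h1.
have h2 : (12 * m)^-1 * Ex (fun w => f w ^+ 2) <= m / 4.
  rewrite ler_pdivrMl; last by rewrite mulr_gt0.
  by apply: le_trans h _; rewrite le_eqVlt; apply/orP; left; apply/eqP; field.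
have : m * (1 / 4) <= m * (3 * pr b) by lra.
by rewrite ler_pM2l//; lra.
Qed.

Lemma pr_le_integral (b : T -> bool) (g : T -> R) (c : R) : measurable_fun setT b ->
  0 <= c -> (forall w, 0 <= g w) -> (forall w, b w -> c <= g w) ->
  ((c * pr b)%:E <= \int[P]_w (g w)%:E)%E.
Proof.
move=> mb c0 g0 h; have fb := finite_moments_bool mb.
rewrite -ExZ// -ExE; last exact: finite_momentsZ.
apply: ge0_le_integral_nonmeasurable => w; rewrite lee_fin; first by rewrite mulr_ge0.
by have := h w; case: (b w) => [/(_ isT)|_]; rewrite ?mulr1 ?mulr0.
Qed.

Variables (F G : set (set T)).
Hypotheses (mF : F `<=` measurable) (mG : G `<=` measurable)
  (FG : independent2 P <<s F>> <<s G>>).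

Lemma measurable_fun_g_sigma (H : set (set T)) d' (U : measurableType d') (f : T -> U) :
  H `<=` measurable -> measurable_fun setT (f : g_sigma_algebraType H -> U) ->
  measurable_fun setT f.
Proof.
move=> mH mf; rewrite (_ : f = (f : g_sigma_algebraType H -> U) \o id)//.
by apply: measurableT_comp => //; exact: measurable_id_g_sigma.
Qed.

Lemma measurable_snd_cst (w : T) d' (U : measurableType d')
    (phi : g_sigma_algebraType F * g_sigma_algebraType G -> U) :
  measurable_fun setT phi -> measurable_fun setT (fun v : T => phi (w, v)).
Proof.
move=> mphi; apply: (@measurable_fun_g_sigma G) => //.
by apply: (measurableT_comp mphi); exact: measurable_pair1.
Qed.

Lemma measurable_diag d' (U : measurableType d')
    (phi : g_sigma_algebraType F * g_sigma_algebraType G -> U) :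
  measurable_fun setT phi -> measurable_fun setT (fun v : T => phi (v, v)).
Proof.
move=> mphi; apply: (measurableT_comp mphi).
by apply: measurable_fun_pair; exact: measurable_id_g_sigma.
Qed.

(** After decoupling, [phi (w, v)] with [w] frozen plays the role of an event conditional on the
    first sigma-algebra. *)
Lemma indep_pr_ge (b : T -> bool)
    (phi : g_sigma_algebraType F * g_sigma_algebraType G -> bool) (c : R) :
  measurable_fun setT (b : g_sigma_algebraType F -> bool) -> measurable_fun setT phi ->
  0 <= c -> (forall w, b w -> c <= pr (fun v => phi (w, v))) ->
  c * pr b <= pr (fun w => b w && phi (w, w)).
Proof.
move=> mb mphi c0 h.
pose psi (z : g_sigma_algebraType F * g_sigma_algebraType G) := b z.1 && phi z.
have mpsi : measurable_fun setT psi.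
  by apply: measurable_and => //; exact: (measurableT_comp mb measurable_fst).
have fpsi : fm (fun w => (psi (w, w))%:R).
  exact: finite_moments_bool (measurable_diag mpsi).
have mbT := measurable_fun_g_sigma mF mb.
rewrite -lee_fin -[pr (fun w => _ && _)]/(Ex _) -ExE//.
have -> : (\int[P]_w ((b w && phi (w, w))%:R)%:E = \int[P]_w \int[P]_v ((psi (w, v))%:R : R)%:E)%E.
  apply: (@ge0_integral_indep _ _ _ P F G (fun z => ((psi z)%:R : R)%:E)) => //.
  by apply/measurable_EFinP; exact: measurable_bool.
rewrite -ExZ; last exact: finite_moments_bool.
rewrite -ExE; last by apply: finite_momentsZ; exact: finite_moments_bool.
apply: ge0_le_integral_nonmeasurable => w; first by rewrite lee_fin mulr_ge0.
rewrite ExE; last exact: finite_moments_bool (measurable_snd_cst w mpsi).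
rewrite lee_fin /psi /=; have := h w; case: (b w) => [/(_ isT) h'|_]; rewrite ?mulr1 ?mulr0//.
exact: pr_ge0.
Qed.

Lemma indep_pr_le (phi : g_sigma_algebraType F * g_sigma_algebraType G -> bool) (c : R) :
  measurable_fun setT phi -> (forall w, pr (fun v => phi (w, v)) <= c) ->
  pr (fun w => phi (w, w)) <= c.
Proof.
move=> mphi h; have fphi := finite_moments_bool (measurable_diag mphi).
rewrite -lee_fin -[pr _]/(Ex _) -ExE//.
rewrite (@ge0_integral_indep _ _ _ P F G (fun z => ((phi z)%:R : R)%:E))//; last first.
  by apply/measurable_EFinP; exact: measurable_bool.
rewrite -(Ex_cst P c) -ExE; last exact: finite_moments_cst.
apply: ge0_le_integral_nonmeasurable => w; first by apply: integral_ge0 => v _; rewrite lee_fin.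
rewrite ExE ?lee_fin//; first exact: h.
exact: finite_moments_bool (measurable_snd_cst w mphi).
Qed.

End events.

(** * Deviation bounds for quadratic forms of a Gaussian column *)

Section gaussian_quadratic.
Context (R : realType) (d : measure_display) (T : measurableType d)
  (P : probability T R) (N : nat).
Variables (a : 'I_N -> T -> R) (v : R).
Hypotheses (v0 : 0 < v) (ga : gaussian_vector P a (fun=> v)).
Local Notation fm := (finite_moments P).
Local Notation Ex := (Ex P).
Local Notation pr := (pr P).

Definition rv_col w : 'cV[R]_N := \col_i a i w.

Lemma measurable_rv_col : measurable_mx rv_col.
Proof.
by apply: measurable_cV => i; case: (gaussian_vector_finite_moments ga i).
Qed.

Lemma qf_rv_col (B : 'M[R]_N) w : qf B (rv_col w) = rv_qf a B w.
Proof. by rewrite qfE; apply: eq_bigr => i _; apply: eq_bigr => k _; rewrite !mxE. Qed.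

Lemma finite_moments_qf (B : 'M[R]_N) : fm (fun w => qf B (rv_col w)).
Proof.
have h : fm (rv_qf a B) by exact: (rv_qf_finite_moments ga).
by rewrite (_ : (fun w => _) = rv_qf a B)//; apply/funext => w; rewrite qf_rv_col.
Qed.

Lemma Ex_qf (B : 'M[R]_N) : Ex (fun w => qf B (rv_col w)) = v * \tr B.
Proof.
by under eq_fun do rewrite qf_rv_col; rewrite (Ex_rv_qf ga) /mxtrace mulr_sumr.
Qed.

Lemma qf_markov (B : 'M[R]_N) (t : R) : (forall u, 0 <= qf B u) -> \tr B <= t -> 0 < t ->
  pr (fun w => 10 * (v * t) < qf B (rv_col w)) <= 1 / 10.
Proof.
move=> B0 Bt t0; have fB := finite_moments_qf B.
have c0 : 0 < v * t by rewrite mulr_gt0.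
have := markov_pr fB (fun w => B0 _) (_ : 0 <= 10 * (v * t)).
rewrite Ex_qf => /(_ _); rewrite mulr_ge0 ?(ltW c0)// => /(_ isT) h.
have h2 : v * \tr B <= v * t by rewrite ler_pM2l.
rewrite -(ler_pM2l c0); lra.
Qed.

Lemma linear_le0_half (c : 'cV[R]_N) : 1 / 2 <= pr (fun w => dotv c (rv_col w) <= 0).
Proof.
have [_ /(_ (fun i => c i 0)) lc] := ga.
have s0 : 0 <= \sum_i v * c i 0 ^+ 2.
  by apply: sumr_ge0 => i _; rewrite mulr_ge0 ?sqr_ge0// ltW.
have := law_le0_half s0 lc.
have e w : \sum_i c i 0 * a i w = dotv c (rv_col w).
  by apply: eq_bigr => i _; rewrite mxE.
have mb : measurable_fun setT (fun w => dotv c (rv_col w) <= 0).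
  apply: measurable_fun_ler => //; apply: measurable_dotv; first exact: measurable_mx_cst.
  exact: measurable_rv_col.
under eq_set do rewrite e.
rewrite -lee_fin -[pr _]/(Ex _) -ExE; last exact: finite_moments_bool.
rewrite div1r => /le_trans; apply; rewrite -[X in P X]setIT -integral_indic//; last first.
  by have := mb measurableT [set true]; rewrite setTI; exact.
apply: ge0_le_integral_nonmeasurable => w; rewrite lee_fin//.
by rewrite indicE; case: (boolP (w \in _)) => //=; rewrite inE/= => ->.
Qed.

(** The second moment is v^2 times (tr B)^2 + 2 |B|^2 in Frobenius norm, at most three times the
    squared mean, as [paley_zygmund] requires. *)
Lemma qf_paley_zygmund (B : 'M[R]_N) : B^T = B -> (forall u, 0 <= qf B u) -> 0 < \tr B ->
  \sum_i \sum_k B i k ^+ 2 <= (\tr B) ^+ 2 ->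
  12^-1 <= pr (fun w => v * \tr B / 2 <= qf B (rv_col w)).
Proof.
move=> sB B0 t0 hB; have fB := finite_moments_qf B.
have := paley_zygmund fB (fun w => B0 _); rewrite Ex_qf; apply; first by rewrite mulr_gt0.
under eq_fun do rewrite qf_rv_col; rewrite (Ex_rv_qf_sqr ga sB) -mulr_sumr -/(mxtrace B).
have -> : \sum_i \sum_k v * v * B i k ^+ 2 = v ^+ 2 * \sum_i \sum_k B i k ^+ 2.
  by rewrite mulr_sumr; apply: eq_bigr => i _; rewrite mulr_sumr; apply: eq_bigr => k _; rewrite expr2.
have : v ^+ 2 * \sum_i \sum_k B i k ^+ 2 <= v ^+ 2 * (\tr B) ^+ 2 by rewrite ler_wpM2l ?sqr_ge0.
by rewrite exprMn; lra.
Qed.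

End gaussian_quadratic.

Lemma posdef_sqr_le_trace (R : realFieldType) n (M : 'M[R]_n) : posdef M ->
  \sum_i \sum_k M i k ^+ 2 <= (\tr M) ^+ 2.
Proof.
move=> pM; have h i k : M i k ^+ 2 <= M i i * M k k.
  have := CauchySchwarz_posdef pM (M *m delta_mx k 0) (delta_mx i 0).
  rewrite -qf_inv// mulKmx ?posdef_unit// !qf_delta; apply: le_trans.
  by rewrite dotvC dotv_delta mxE (bigD1 k)//= big1 ?addr0 => [|l lk]; rewrite mxE ?eqxx ?mulr1// (negbTE lk) mulr0.
rewrite expr2 {1}/mxtrace mulr_suml; apply: ler_sum => i _.
by rewrite mulr_sumr; apply: ler_sum.
Qed.

(** * Upper bounds for the trace of an inverse Gram matrix *)

(** By [dotv_le_trace] the ridged matrix has smallest eigenvalue at least 1 / K, so the ridge 1 / (2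
    K) accounts for at most half of its form, and the rest is dominated by [B]. Invertibility of [B]
    comes along. *)
Lemma trace_inv_le_of_gram (R : realFieldType) n m (Y : 'M[R]_(n, m)) (B : 'M[R]_n) (K : R) :
  0 < K -> B^T = B -> (forall v, qf (Y *m Y^T) v <= qf B v) ->
  \tr (invmx (Y *m Y^T + ((2 * K)^-1)%:M)) <= K ->
  B \in unitmx /\ \tr (invmx B) <= 2 * K.
Proof.
move=> K0 sB YB; set M := Y *m Y^T + _ => tM.
have K2 : 0 < (2 * K)^-1 by rewrite invr_gt0 mulr_gt0.
have pM : posdef M by have := gram_posdef Y^T K2; rewrite trmxK.
have MB v : qf M v <= 2 * qf B v.
  have h1 := dotv_le_trace pM v.
  have h2 : dotv v v <= qf M v * K by apply: le_trans h1 _; rewrite ler_wpM2l// posdef_ge0.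
  have h3 : qf M v = qf (Y *m Y^T) v + (2 * K)^-1 * dotv v v by rewrite qfD qf_scalar.
  have h4 : (2 * K)^-1 * dotv v v <= qf M v / 2.
    by rewrite invfM mulrAC ler_pdivrMr// mulrAC ler_pdivlMr// mulrAC mulVf ?mul1r.
  by have := YB v; lra.
have pB : posdef B.
  split => // v v0; have := pM.2 v v0; have := MB v; lra.
split; first exact: posdef_unit.
apply: (@le_trans _ _ (2 * \tr (invmx M))); last by rewrite ler_pM2l.
rewrite /mxtrace mulr_sumr; apply: ler_sum => i _.
by have := qf_inv_le (delta_mx i 0) pM pB MB; rewrite !qf_delta.
Qed.

Section tail.
Context (R : realType) (d : measure_display) (T : measurableType d)
  (P : probability T R) (N m : nat).
Variables (Y : 'I_N -> 'I_m -> T -> R) (s : 'I_m -> R) (smax : R).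
Hypotheses (smax0 : 0 <= smax) (s01 : forall l, 0 <= s l <= smax).
Hypothesis gY : forall i, gaussian_vector P (Y i) s.
Variables F G : 'I_N -> set (set T).
Hypotheses (mF : forall i, F i `<=` measurable) (mG : forall i, G i `<=` measurable)
  (FG : forall i, independent2 P <<s F i>> <<s G i>>).
Hypothesis mYF : forall i k l, k != i ->
  measurable_fun setT (Y k l : g_sigma_algebraType (F i) -> R).
Hypothesis mYG : forall i l, measurable_fun setT (Y i l : g_sigma_algebraType (G i) -> R).
Variables t e : R.
Hypotheses (t0 : 0 < t) (e0 : 0 < e) (N0 : (0 < N)%N).
Hypotheses (ht : 7 / 8 * t <= \sum_l s l - smax * N%:R) (hs : smax * (24 * N%:R) <= t).
Local Notation pr := (pr P).

Definition data_mx w : 'M[R]_(N, m) := \matrix_(i, l) Y i l w.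

Let NR : 0 < N%:R :> R. Proof. by rewrite ltr0n. Qed.

Let resolvent0 (n : nat) (C : 'M[R]_(n, m)) : resolvent C e = e *: inv0 (C^T *m C + e%:M).
Proof. by rewrite inv0E// posdef_unit//; exact: gram_posdef. Qed.

(** The mean mu is at least 7 t / 8 and the variance at most 2 smax mu, while t / 5 lies at least 3
    mu / 4 below the mean. The ratio smax / t <= 1 / (24 N) then gives a failure probability small
    enough for N rows. *)
Lemma chebyshev_row (C : 'M[R]_(N, m)) i :
  pr (fun v => qf (resolvent C e) (\col_l Y i l v) <= t / 5) <= (5 * N%:R)^-1.
Proof.
set Q := resolvent C e; set p := pr _.
have fQ : finite_moments P (rv_qf (Y i) Q) by exact: (rv_qf_finite_moments (gY i)).
have E1 := Ex_rv_qf (gY i) Q; have E2 := Ex_rv_qf_sqr (gY i) (trmx_resolvent C e0).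
have eQ v : qf Q (\col_l Y i l v) = rv_qf (Y i) Q v.
  by rewrite qfE; apply: eq_bigr => a _; apply: eq_bigr => b _; rewrite !mxE.
have w1 := resolvent_weighted_trace C e0 smax0 s01.
have w2 := resolvent_weighted_sqr C e0 smax0 s01.
rewrite -/Q in E2 w1 w2; set mu := \sum_l s l * Q l l in E1 E2 w1 w2.
have mu1 : 7 / 8 * t <= mu by exact: le_trans ht w1.
have := @chebyshev_pr _ _ _ P _ (t / 5) fQ; rewrite E1 E2 => h.
have {}h : (mu - t / 5) ^+ 2 * p <= 2 * (smax * mu).
  rewrite /p; under [X in pr X]eq_fun do rewrite eQ.
  have h' : t / 5 <= mu by move: mu1 t0; lra.
  apply: le_trans (h h') _; rewrite addrAC subrr add0r.
  by rewrite ler_pM2l.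
have p0 : 0 <= p by exact: pr_ge0.
have mu0 : 0 < mu by move: mu1 t0; lra.
have h1 : (3 / 4 * mu) ^+ 2 * p <= (mu - t / 5) ^+ 2 * p.
  rewrite ler_wpM2r// ler_sqr ?nnegrE//.
  - by move: mu1 t0; lra.
  - by move: mu0; lra.
  - by move: mu1 t0; lra.
have h2 : (3 / 4) ^+ 2 * mu * p <= 2 * smax.
  rewrite -(ler_pM2r mu0) -[leRHS]mulrA; apply: le_trans h.
  by apply: le_trans h1; rewrite le_eqVlt; apply/orP; left; apply/eqP; ring.
have h3 : (3 / 4) ^+ 2 * (7 / 8 * t) * p <= 2 * smax.
  by apply: le_trans h2; rewrite ler_wpM2r// ler_wpM2l// sqr_ge0.
rewrite -[leRHS]mul1r ler_pdivlMr ?mulr_gt0//.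
have h4 : (3 / 4) ^+ 2 * (7 / 8 * t) * p * (24 * N%:R) <= 2 * t.
  apply: (@le_trans _ _ (2 * smax * (24 * N%:R))).
    by rewrite ler_wpM2r// mulr_ge0// ltW.
  by rewrite -mulrA ler_pM2l.
rewrite -(ler_pM2l t0).
(* 80 / 189 is the inverse of (9 / 16) (7 / 8) (24 / 5), and twice it is below 1. *)
have -> : t * (p * (5 * N%:R)) =
    (3 / 4) ^+ 2 * (7 / 8 * t) * p * (24 * N%:R) * (80 / 189).
  by field.
apply: (@le_trans _ _ (2 * t * (80 / 189))); first by rewrite ler_wpM2r.
by move: t0; lra.
Qed.

Lemma trace_gram_inv_le :
  let good w := \tr (invmx (data_mx w *m (data_mx w)^T + e%:M)) <= 5 * N%:R / t in
  measurable_fun setT good /\ 4 / 5 <= pr good.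
Proof.
set good := fun w => _.
have mY : measurable_mx data_mx.
  move=> i l; under eq_fun do rewrite mxE.
  by apply: (measurable_fun_g_sigma (@mG i)); exact: mYG.
have pM w : posdef (data_mx w *m (data_mx w)^T + e%:M).
  by have := gram_posdef (data_mx w)^T e0; rewrite trmxK.
have mgood : measurable_fun setT good.
  apply: measurable_fun_ler => //; under eq_fun do rewrite -inv0E ?posdef_unit//.
  apply: measurable_trace; apply: measurable_inv0; apply: measurable_mxD.
    by apply: measurable_mulmx => //; exact: measurable_trmx.
  exact: measurable_mx_cst.
(* The other rows are read from [z.1] and row [i] from [z.2], so that [indep_pr_le] can freeze the
   former and apply [chebyshev_row]. *)
pose phi i (z : g_sigma_algebraType (F i) * g_sigma_algebraType (G i)) : bool :=
  qf (resolvent (zero_row i (data_mx z.1)) e) (\col_l Y i l z.2) <= t / 5.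
have mphi i : measurable_fun setT (phi i).
  apply: measurable_fun_ler => //; apply: measurable_qf.
    under eq_fun do rewrite resolvent0.
    apply: measurable_mxZ => //; apply: measurable_inv0; apply: measurable_mxD; last exact: measurable_mx_cst.
    have mZ : measurable_mx (fun z : g_sigma_algebraType (F i) * g_sigma_algebraType (G i) =>
        zero_row i (data_mx z.1)).
      apply: (@measurable_mx_comp _ _ _ _ _ fst _ _
        ((fun w => zero_row i (data_mx w)) : g_sigma_algebraType (F i) -> _)) => // k l.
      under eq_fun do rewrite !mxE; case: eqVneq => [_|ki]; first exact: measurable_cst.
      exact: mYF.
    by apply: measurable_mulmx => //; exact: measurable_trmx.
  apply: (@measurable_mx_comp _ _ _ _ _ snd _ _
    ((fun w => \col_l Y i l w) : g_sigma_algebraType (G i) -> _)) => //.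
  exact: measurable_cV.
have hphi i : pr (fun w => phi i (w, w)) <= (5 * N%:R)^-1.
  have := @indep_pr_le _ _ _ P _ _ (@mF i) (@mG i) (@FG i) (phi i) (5 * N%:R)^-1 (mphi i).
  by apply=> w; exact: (chebyshev_row (zero_row i (data_mx w)) i).
have fphi i : finite_moments P (fun w => (phi i (w, w))%:R).
  by apply: finite_moments_bool; exact: (measurable_diag (@mF i) (@mG i) (mphi i)).
split => //; suff : pr (fun w => ~~ good w) <= \sum_i pr (fun w => phi i (w, w)).
  rewrite pr_not// => h; have : \sum_i pr (fun w => phi i (w, w)) <= 1 / 5.
    apply: (@le_trans _ _ (\sum_(i < N) (5 * N%:R)^-1)); first exact: ler_sum.
    rewrite sumr_const card_ord -mulr_natr le_eqVlt; apply/orP; left; apply/eqP.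
    by field; rewrite gt_eqF.
  lra.
rewrite -Ex_sum//; apply: Ex_le.
- by apply: finite_moments_bool; exact: measurable_neg.
- exact: finite_moments_sum.
move=> w; case: (boolP (good w)) => [_|/negP ng]; first by apply: sumr_ge0 => i _; rewrite ler0n.
have [[i hi]|hall] := pselect (exists i, phi i (w, w)); last first.
  exfalso; apply: ng; rewrite /good.
  have h i : invmx (data_mx w *m (data_mx w)^T + e%:M) i i <= (t / 5)^-1.
    apply: gram_inv_diag_le => //; first by rewrite divr_gt0.
    have : ~ phi i (w, w) by move=> hi; apply: hall; exists i.
    move=> /negP; rewrite /phi -ltNge /= => /ltW; congr (_ <= qf _ _).
    by apply/matrixP => a b; rewrite !mxE.
  apply: (@le_trans _ _ (\sum_(i < N) (t / 5)^-1)); first exact: ler_sum.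
  rewrite sumr_const card_ord -mulr_natr le_eqVlt; apply/orP; left; apply/eqP.
  by field; rewrite gt_eqF.
by rewrite (bigD1 i)//= hi lerDl sumr_ge0// => k _; rewrite ler0n.
Qed.

End tail.

(** * Conditioning on the other columns *)

(** A semidefinite form that vanishes at [v] has [v] in the kernel of its matrix, which
    invertibility excludes. *)
Lemma psd_unit_posdef (R : realFieldType) n (M : 'M[R]_n) :
  M^T = M -> (forall u, 0 <= qf M u) -> M \in unitmx -> posdef M.
Proof.
move=> sM M0 uM; split => // v v0; rewrite lt_neqAle M0 andbT eq_sym.
apply: contra_neq v0 => q0; set z := M *m v; set c := dotv z z.
suff /eqP : z = 0 by move=> /eqP z0; rewrite -(mulKmx uM v) -/z z0 mulmx0.
apply/eqP; rewrite -dotvv_eq0 -/c; apply/negPn/negP => c0.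
have cp : 0 < c by rewrite lt0r c0 dotvv_ge0.
set q := qf M z; have q1 : 0 < q + 1 by rewrite ltr_wpDl// M0.
(* Moving from [v] by c / (q + 1) against its image z would make the form negative; q + 1 is used
   since q may vanish. *)
have := M0 (- (c / (q + 1)) *: z + v).
have -> : qf M (- (c / (q + 1)) *: z + v) = (c / (q + 1)) ^+ 2 * q - 2 * (c / (q + 1)) * c.
  rewrite /qf mulmxDr dotvDr !dotvDl -scalemxAr !dotvZr !dotvZl -/(qf M z) -/q -/z -/c.
  by rewrite -[dotv v z]/(qf M v) q0 (dotv_adj M v z) sM -/z -/c; ring.
have -> : (c / (q + 1)) ^+ 2 * q - 2 * (c / (q + 1)) * c = - ((c / (q + 1)) ^+ 2 * (q + 2)).
  by field; rewrite gt_eqF.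
rewrite oppr_ge0 leNgt mulr_gt0//; first by rewrite exprn_gt0// divr_gt0.
by have := M0 z; rewrite -/q; lra.
Qed.

Section core.
Context (R : realType) (d : measure_display) (T : measurableType d)
  (P : probability T R) (N : nat).
Variables (F G : set (set T)).
Hypotheses (mF : F `<=` measurable) (mG : G `<=` measurable)
  (FG : independent2 P <<s F>> <<s G>>).
Variables (a : 'I_N -> T -> R) (v : R) (B : T -> 'M[R]_N).
Hypotheses (v0 : 0 < v) (ga : gaussian_vector P a (fun=> v)).
Hypothesis ma : forall i, measurable_fun setT (a i : g_sigma_algebraType G -> R).
Hypothesis mB : measurable_mx (B : g_sigma_algebraType F -> 'M[R]_N).
Hypotheses (sB : forall w, (B w)^T = B w) (B0 : forall w u, 0 <= qf (B w) u).
Local Notation pr := (pr P).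
Local Notation av := (rv_col a).
Local Notation FGT := (g_sigma_algebraType F * g_sigma_algebraType G)%type.

(** The squared error along u_j, set to 0 where [B] is singular; [inv0] keeps it measurable there.
    It is compared with the true error only through a lower bound, so the value 0 is harmless. *)
Definition regression_error (e : T -> 'cV[R]_N) (beta : R) w : R :=
  (B w \in unitmx)%:R *
  ((dotv (av w) (inv0 (B w) *m e w) - beta) / (1 + qf (inv0 (B w)) (av w))) ^+ 2.

Let pB w : B w \in unitmx -> posdef (B w).
Proof. by move=> u; exact: psd_unit_posdef. Qed.

Let inv0_ge0 w : B w \in unitmx -> forall u, 0 <= qf (inv0 (B w)) u.
Proof. by move=> uB u; rewrite inv0E//; apply: posdef_ge0; apply: posdef_inv; exact: pB. Qed.

Let mB1 : measurable_mx (fun z : FGT => inv0 (B z.1)).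
Proof. exact: (measurable_mx_comp measurable_fst (measurable_inv0 mB)). Qed.

Let ma2 : measurable_mx (fun z : FGT => av z.2).
Proof.
apply: (@measurable_mx_comp _ _ _ _ _ snd _ _ (av : g_sigma_algebraType G -> _)) => //.
exact: measurable_cV.
Qed.

Let regression_error_ge0 e beta w : 0 <= regression_error e beta w.
Proof. by rewrite mulr_ge0 ?sqr_ge0. Qed.

Lemma regression_error_bias (e : T -> 'cV[R]_N) (beta K : R) :
  measurable_mx (e : g_sigma_algebraType F -> 'cV[R]_N) -> 0 < K ->
  4 / 5 <= pr (fun w => (B w \in unitmx) && (\tr (inv0 (B w)) <= K)) ->
  ((beta ^+ 2 / (1 + 10 * (v * K)) ^+ 2 * (8 / 25))%:E <=
    \int[P]_w (regression_error e beta w)%:E)%E.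
Proof.
move=> me K0; set b := fun w => _ && _ => hb.
have mb : measurable_fun setT (b : g_sigma_algebraType F -> bool).
  apply: measurable_and; first exact: measurable_unit.
  by apply: measurable_fun_ler => //; apply: measurable_trace; exact: measurable_inv0.
(* Multiplying the linear form by [beta] expresses that the signs are opposite without
   distinguishing the sign of [beta]. *)
pose phi (z : FGT) := (qf (inv0 (B z.1)) (av z.2) <= 10 * (v * K)) &&
  (dotv (beta *: (inv0 (B z.1) *m e z.1)) (av z.2) <= 0).
have me1 : measurable_mx (fun z : FGT => e z.1) by exact: (measurable_mx_comp measurable_fst me).
have mphi1 : measurable_fun setT (fun z : FGT => qf (inv0 (B z.1)) (av z.2) <= 10 * (v * K)).
  by apply: measurable_fun_ler => //; exact: measurable_qf.
have mphi2 : measurable_fun setT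
    (fun z : FGT => dotv (beta *: (inv0 (B z.1) *m e z.1)) (av z.2) <= 0).
  apply: measurable_fun_ler => //; apply: measurable_dotv => //.
  by apply: measurable_mxZ => //; exact: measurable_mulmx.
have mphi : measurable_fun setT phi by exact: measurable_and.
(* 1/2 from symmetry minus 1/10 from Markov; times 4/5 for the event [b] this gives the 8/25 of the
   statement. *)
have h w : b w -> 2 / 5 <= pr (fun x => phi (w, x)).
  move=> /andP[uB tB]; have m1 := measurable_snd_cst mG w mphi1.
  have m2 := measurable_snd_cst mG w mphi2.
  have h1 := qf_markov v0 ga (inv0_ge0 uB) tB K0.
  have h2 := linear_le0_half v0 ga (beta *: (inv0 (B w) *m e w)).
  apply: le_trans (pr_and P m1 m2) => /=.
  have m3 : measurable_fun setT (fun x => 10 * (v * K) < qf (inv0 (B w)) (av x)).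
    by apply: measurable_fun_ltr => //; case: (finite_moments_qf ga (inv0 (B w))).
  have := pr_not P m3; under [X in pr X]eq_fun do rewrite -leNgt.
  by move=> ->; lra.
have h3 := indep_pr_ge mF mG FG mb mphi (_ : 0 <= 2 / 5) h.
have {}h3 : 8 / 25 <= pr (fun w => b w && phi (w, w)).
  by apply: le_trans (h3 _); lra.
have mbphi : measurable_fun setT (fun w => b w && phi (w, w)).
  apply: measurable_and; first exact: (measurable_fun_g_sigma mF).
  exact: measurable_diag.
set c := beta ^+ 2 / _; have c0 : 0 <= c by rewrite divr_ge0 ?sqr_ge0.
apply: (@le_trans _ _ (c * pr (fun w => b w && phi (w, w)))%:E).
  by rewrite lee_fin ler_wpM2l.
apply: pr_le_integral => // w /andP[/andP[uB _] /andP[/= hs hx]].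
rewrite /regression_error uB mul1r expr_div_n.
set s := qf _ _ in hs *; have s0 : 0 <= s by exact: inv0_ge0.
rewrite dotvC dotvZr in hx; set x := dotv _ _ in hx *.
apply: ler_pM => //; first exact: sqr_ge0.
- by rewrite invr_ge0 sqr_ge0.
- have -> : (x - beta) ^+ 2 = beta ^+ 2 + (x ^+ 2 - 2 * (beta * x)) by ring.
  by rewrite lerDl; have := sqr_ge0 x; lra.
have vK : 0 < v * K by rewrite mulr_gt0.
by rewrite lef_pV2 ?posrE ?exprn_gt0// ?ltr_wpDr//; [rewrite ler_sqr ?nnegrE; lra|lra].
Qed.

(** Two decouplings are used. The pair [F], [G] separates [B] from the column and gives the
    probability of the good event; the pair [F2], [G2] separates the design from the noise, so that
    the noise alone is integrated with everything else frozen. *)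
Lemma regression_error_variance (F2 G2 : set (set T)) (h : T -> 'cV[R]_N)
    (xi : 'I_N -> T -> R) (sxi beta L : R) :
  F2 `<=` measurable -> G2 `<=` measurable -> independent2 P <<s F2>> <<s G2>> ->
  measurable_mx (B : g_sigma_algebraType F2 -> 'M[R]_N) ->
  (forall i, measurable_fun setT (a i : g_sigma_algebraType F2 -> R)) ->
  measurable_mx (h : g_sigma_algebraType F2 -> 'cV[R]_N) ->
  (forall i, measurable_fun setT (xi i : g_sigma_algebraType G2 -> R)) ->
  gaussian_vector P xi (fun=> sxi ^+ 2) -> (0 < N)%N -> 0 < L ->
  1 / 2 <= pr (fun w => (B w \in unitmx) && (L <= \tr (inv0 (B w)))) ->
  ((sxi ^+ 2 * (v * L / 2 / (1 + v * L / 2)) ^+ 2 / (48 * N%:R * v) * (1 / 32))%:E <=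
    \int[P]_w (regression_error (fun w => h w + rv_col xi w) beta w)%:E)%E.
Proof.
move=> mF2 mG2 FG2 mB' ma' mh mxi gxi N0 L0; set b := fun w => _ && _ => hb.
have NR : 0 < N%:R :> R by rewrite ltr0n.
have Nv : 0 < 48 * N%:R * v by rewrite !mulr_gt0.
have mb : measurable_fun setT (b : g_sigma_algebraType F -> bool).
  apply: measurable_and; first exact: measurable_unit.
  by apply: measurable_fun_ler => //; apply: measurable_trace; exact: measurable_inv0.
pose phi (z : FGT) := (v * \tr (inv0 (B z.1)) / 2 <= qf (inv0 (B z.1)) (av z.2)) &&
  (qf 1%:M (av z.2) <= 48 * N%:R * v).
have mphi1 : measurable_fun setT
    (fun z : FGT => v * \tr (inv0 (B z.1)) / 2 <= qf (inv0 (B z.1)) (av z.2)).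
  apply: measurable_fun_ler; last exact: measurable_qf.
  apply: measurable_funM => //; apply: measurable_funM => //; exact: measurable_trace.
have mphi2 : measurable_fun setT (fun z : FGT => qf 1%:M (av z.2) <= 48 * N%:R * v).
  by apply: measurable_fun_ler => //; apply: measurable_qf => //; exact: measurable_mx_cst.
have mphi : measurable_fun setT phi by exact: measurable_and.
(* 1/12 from Paley-Zygmund minus 1/48 from Markov: |a|^2 has mean N v, so the threshold 48 N v fails
   with probability at most 1/48. Multiplied by 1/2 for [b] this leaves 1/32. *)
have hphi w : b w -> 1 / 16 <= pr (fun x => phi (w, x)).
  move=> /andP[uB tB]; have m1 := measurable_snd_cst mG w mphi1.
  have m2 := measurable_snd_cst mG w mphi2.
  have pI := posdef_inv (pB uB); rewrite -inv0E// in pI.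
  have h1 := qf_paley_zygmund v0 ga pI.1 (inv0_ge0 uB) (lt_le_trans L0 tB)
    (posdef_sqr_le_trace pI).
  have h2 : pr (fun x => 48 * N%:R * v < qf 1%:M (av x)) <= 1 / 48.
    have := markov_pr (finite_moments_qf ga 1%:M) (_ : forall w, 0 <= qf 1%:M (av w)) (ltW Nv).
    rewrite (Ex_qf ga) mxtrace1 => /(_ _) h2.
    rewrite -(ler_pM2l Nv); apply: le_trans (h2 _) _ => [x|]; last by lra.
    by rewrite qf_scalar mul1r dotvv_ge0.
  apply: le_trans (pr_and P m1 m2) => /=.
  have m3 : measurable_fun setT (fun x => 48 * N%:R * v < qf 1%:M (av x)).
    by apply: measurable_fun_ltr => //; case: (finite_moments_qf ga 1%:M).
  have := pr_not P m3; under [X in pr X]eq_fun do rewrite -leNgt.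
  by move=> ->; lra.
have h3 := indep_pr_ge mF mG FG mb mphi (_ : 0 <= 1 / 16) hphi.
have {}h3 : 1 / 32 <= pr (fun w => b w && phi (w, w)).
  by apply: le_trans (h3 _); lra.
have mbphi : measurable_fun setT (fun w => b w && phi (w, w)).
  apply: measurable_and; first exact: (measurable_fun_g_sigma mF).
  exact: measurable_diag.
pose psi (z : g_sigma_algebraType F2 * g_sigma_algebraType G2) : R :=
  (B z.1 \in unitmx)%:R *
  ((dotv (av z.1) (inv0 (B z.1) *m (h z.1 + rv_col xi z.2)) - beta) /
   (1 + qf (inv0 (B z.1)) (av z.1))) ^+ 2.
have ma1 : measurable_mx (fun z : g_sigma_algebraType F2 * g_sigma_algebraType G2 => av z.1).
  apply: (@measurable_mx_comp _ _ _ _ _ fst _ _ (av : g_sigma_algebraType F2 -> _)) => //.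
  exact: measurable_cV.
have mB2 : measurable_mx (fun z : g_sigma_algebraType F2 * g_sigma_algebraType G2 => inv0 (B z.1)).
  exact: (measurable_mx_comp measurable_fst (measurable_inv0 mB')).
have mpsi : measurable_fun setT psi.
  apply: measurable_funM.
    apply: measurable_bool; exact: (measurableT_comp (measurable_unit mB') measurable_fst).
  apply: measurable_funX; apply: measurable_funM.
    apply: measurable_funB => //; apply: measurable_dotv => //; apply: measurable_mulmx => //.
    apply: measurable_mxD; first exact: (measurable_mx_comp measurable_fst mh).
    apply: (@measurable_mx_comp _ _ _ _ _ snd _ _ (rv_col xi : g_sigma_algebraType G2 -> _)) => //.
    exact: measurable_cV.
  apply: measurableT_comp; first exact: measurable_inv.
  by apply: measurable_funD => //; exact: measurable_qf.
have -> : (\int[P]_w (regression_error (fun w => h w + rv_col xi w) beta w)%:E =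
    \int[P]_w \int[P]_x (psi (w, x))%:E)%E.
  apply: (@ge0_integral_indep _ _ _ P F2 G2 (fun z => (psi z)%:E)) => //.
    exact/measurable_EFinP.
  by move=> z; rewrite lee_fin mulr_ge0 ?sqr_ge0.
set x := v * L / 2; have x0 : 0 < x by rewrite divr_gt0// mulr_gt0.
set c := _ / (48 * N%:R * v).
have c0 : 0 <= c by rewrite divr_ge0 ?(ltW Nv)// mulr_ge0 ?sqr_ge0.
apply: (@le_trans _ _ (c * pr (fun w => b w && phi (w, w)))%:E).
  by rewrite lee_fin ler_wpM2l.
rewrite -ExZ; last exact: finite_moments_bool.
rewrite -ExE; last by apply: finite_momentsZ; exact: finite_moments_bool.
apply: ge0_le_integral_nonmeasurable => w; first by rewrite lee_fin mulr_ge0.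
case: (boolP (b w && phi (w, w))) => [|_]; last first.
  by rewrite mulr0; apply: integral_ge0 => y _; rewrite lee_fin mulr_ge0 ?sqr_ge0.
move=> /andP[/andP[uB tB] /andP[/= hs ha]]; rewrite mulr1 /psi /= uB.
set q := inv0 (B w) *m av w; set s := qf _ _ in hs *.
have pI := posdef_inv (pB uB); rewrite -inv0E// in pI.
have sI : (inv0 (B w))^T = inv0 (B w) by case: pI.
set c1 := dotv (av w) (inv0 (B w) *m h w) - beta.
have e1 y : dotv (av w) (inv0 (B w) *m (h w + rv_col xi y)) - beta = dotv q (rv_col xi y) + c1.
  by rewrite mulmxDr dotvDr (dotv_adj _ _ (rv_col xi y)) sI -/q /c1; ring.
have [_ /(_ (fun i => q i 0)) lq] := gxi.
have q0 : 0 <= \sum_i sxi ^+ 2 * q i 0 ^+ 2.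
  by apply: sumr_ge0 => i _; rewrite mulr_ge0 ?sqr_ge0.
have lqE : \sum_i sxi ^+ 2 * q i 0 ^+ 2 = sxi ^+ 2 * dotv q q.
  by rewrite /dotv mulr_sumr; apply: eq_bigr => i _; rewrite expr2.
set Z := fun w => _ in lq.
have eZ y : dotv q (rv_col xi y) = Z y by apply: eq_bigr => i _; rewrite [rv_col xi y i 0]mxE.
have fZ := law_finite_moments q0 lq.
have f2 := finite_momentsX 2 fZ.
have f3 : finite_moments P (fun y => (Z y + c1) ^+ 2).
  by apply: finite_momentsX; apply: finite_momentsD => //; exact: finite_moments_cst.
have EZ2 : Ex P (fun y => Z y ^+ 2) = sxi ^+ 2 * dotv q q.
  by apply: EFin_inj; rewrite -ExE// (law_integral_pow2 q0 lq) lqE.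
have EZ1 : Ex P Z = 0 by apply: EFin_inj; rewrite -ExE// (law_integral_pow1 q0 lq).
have s1 : 0 < 1 + s by rewrite ltr_wpDr// inv0_ge0.
have f4 : finite_moments P (fun y => ((1 + s) ^+ 2)^-1 * (Z y + c1) ^+ 2) by exact: finite_momentsZ.
rewrite (_ : (fun y => _) = (fun y => (((1 + s) ^+ 2)^-1 * (Z y + c1) ^+ 2)%:E)); last first.
  by apply/funext => y; rewrite mul1r e1 eZ expr_div_n mulrC.
rewrite ExE// lee_fin ExZ//.
(* The noise is centered, so the constant [c1], which contains signal and bias, can only increase
   the second moment. *)
have h4 : sxi ^+ 2 * dotv q q <= Ex P (fun y => (Z y + c1) ^+ 2).
  have -> : (fun y => (Z y + c1) ^+ 2) = (fun y => Z y ^+ 2 + (2 * c1 * Z y + c1 ^+ 2)).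
    by apply/funext => y; ring.
  rewrite ExD//; last by apply: finite_momentsD; [exact: finite_momentsZ|exact: finite_moments_cst].
  rewrite ExD; [|exact: finite_momentsZ|exact: finite_moments_cst].
  by rewrite ExZ// EZ1 EZ2 Ex_cst mulr0 add0r lerDl sqr_ge0.
have aq : dotv (av w) q = s by [].
have h5 := CauchySchwarz_dotv (av w) q; rewrite aq in h5.
rewrite qf_scalar mul1r in ha.
have h6 : s ^+ 2 <= 48 * N%:R * v * dotv q q.
  by apply: le_trans h5 _; rewrite ler_wpM2r// dotvv_ge0.
have xs : x <= s.
  by apply: le_trans hs; rewrite /x -!mulrA ler_pM2l// ler_pM2r.
have x1 : 0 < 1 + x by rewrite ltr_wpDr// ltW.
have h7 : x / (1 + x) <= s / (1 + s).
  by rewrite ler_pdivrMr 1?mulrAC ?ler_pdivlMr//; lra.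
have h8 : (x / (1 + x)) ^+ 2 <= (s / (1 + s)) ^+ 2.
  by rewrite ler_sqr ?nnegrE// divr_ge0 ?(ltW x0) ?(ltW s1) ?(ltW x1)// inv0_ge0.
apply: (@le_trans _ _ (((1 + s) ^+ 2)^-1 * (sxi ^+ 2 * dotv q q))); last first.
  by rewrite ler_pM2l// invr_gt0 exprn_gt0.
rewrite /c ler_pdivrMr//; apply: (@le_trans _ _ (sxi ^+ 2 * (s / (1 + s)) ^+ 2)).
  by rewrite ler_wpM2l ?sqr_ge0.
have -> : sxi ^+ 2 * (s / (1 + s)) ^+ 2 = ((1 + s) ^+ 2)^-1 * (sxi ^+ 2 * s ^+ 2).
  by field; rewrite gt_eqF.
rewrite -[leRHS]mulrA ler_pM2l ?invr_gt0 ?exprn_gt0// -[leRHS]mulrA ler_wpM2l ?sqr_ge0//.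
by rewrite [leRHS]mulrC.
Qed.

End core.

(** * Splitting off one column of the design *)

Lemma qf_mul_trmx (R : realFieldType) m n (C : 'M[R]_(m, n)) v :
  qf (C *m C^T) v = dotv (C^T *m v) (C^T *m v).
Proof. by rewrite -qf_gram trmxK. Qed.

Lemma cvg_bigsum (R : realType) (I : Type) (r : seq I) (f : nat -> I -> R) (g : I -> R) :
  (forall i, f n i @[n --> \oo] --> g i) ->
  \sum_(i <- r) f n i @[n --> \oo] --> \sum_(i <- r) g i.
Proof.
move=> h; elim: r => [|i r IH].
  by rewrite big_nil; under eq_fun do rewrite big_nil; exact: cvg_cst.
by rewrite big_cons; under eq_fun do rewrite big_cons; apply: cvgD.
Qed.

Section columns.
Context {R : realType} {p : option nat}.
Variable u : idx p -> vec R p.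
Hypotheses (uRp : forall j, Rp (u j))
  (uon : forall j l, dot (u j) (u l) = (j == l)%:R)
  (ucp : forall v, Rp v -> (forall j, dot (u j) v = 0) -> forall i, v i = 0).
Variables (N : nat) (x : 'I_N -> vec R p).
Hypothesis Rx : forall i, Rp (x i).
Local Notation coef := (basis_coef u).
Local Notation bv := (bv u).

Lemma Rp_sum (y : 'I_N -> vec R p) (c : 'I_N -> R) : (forall i, Rp (y i)) ->
  Rp (fun t => \sum_i c i * y i t).
Proof.
move=> Ry; elim: (index_enum _) => [|i r IH].
  by under eq_fun do rewrite big_nil; exact: (@Rp0 R p).
by under eq_fun do rewrite big_cons; apply: RpD => //; exact: RpZ.
Qed.

Lemma dot_suml (y : 'I_N -> vec R p) (c : 'I_N -> R) (z : vec R p) :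
  (forall i, Rp (y i)) -> Rp z ->
  dot (fun t => \sum_i c i * y i t) z = \sum_i c i * dot (y i) z.
Proof.
move=> Ry Rz.
suff [] : Rp (fun t => \sum_i c i * y i t) /\
  dot (fun t => \sum_i c i * y i t) z = \sum_i c i * dot (y i) z by [].
elim: (index_enum _) => [|i r [R1 IH]].
  by under eq_fun do rewrite big_nil; rewrite big_nil dot0l; split => //; exact: (@Rp0 R p).
have Ri : Rp (fun t => c i * y i t) by exact: RpZ.
under eq_fun do rewrite big_cons; rewrite big_cons; split; first exact: RpD.
by rewrite dotDl// dotZl// IH.
Qed.

Variable j : nat.
Hypothesis pj : in_dim p j.

Definition col_part : 'cV[R]_N := \col_i coef (x i) j.
Definition residual i : vec R p := vsub (x i) (fun t => coef (x i) j * bv j t).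
Definition residual_gram : 'M[R]_N := \matrix_(i, k) dot (residual i) (residual k).

Let Rb := @Rp_bv _ _ _ uRp.

Lemma Rp_residual i : Rp (residual i).
Proof. by apply: Rp_vsub => //; apply: RpZ; exact: Rb. Qed.

Lemma coef_residual i l : coef (residual i) l = (l != j)%:R * coef (x i) l.
Proof.
have Rab : Rp (fun t => coef (x i) j * bv j t) by apply: RpZ; exact: Rb.
rewrite coef_vsub// {2}/basis_coef dotC dotZl//; [|exact: Rb..].
rewrite dot_bv// eq_sym pj/=; case: eqVneq => [->|_]; first by rewrite mulr1 subrr mul0r.
by rewrite mulr0 subr0 mul1r.
Qed.

Lemma gram_residual i k : dot (x i) (x k) = coef (x i) j * coef (x k) j + residual_gram i k.
Proof.
have Ra q : Rp (fun t => coef (x q) j * bv j t) by apply: RpZ; exact: Rb.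
have hZ q z : Rp z -> dot (fun t => coef (x q) j * bv j t) z = coef (x q) j * coef z j.
  by move=> Rz; apply: dotZl => //; exact: Rb.
have Rk : Rp (residual k) by exact: Rp_residual.
rewrite mxE dotBl// hZ// coef_residual eqxx mul0r mulr0 subr0.
by rewrite dotBr// [dot (x i) (fun t => coef (x k) j * _)]dotC hZ//; ring.
Qed.

Lemma residual_gram_sym : residual_gram^T = residual_gram.
Proof. by apply/matrixP => i k; rewrite !mxE dotC. Qed.

Let comb_residual (v : 'cV[R]_N) : vec R p := fun t => \sum_i v i 0 * residual i t.

Let Rcomb v : Rp (comb_residual v).
Proof. by apply: Rp_sum => i; exact: Rp_residual. Qed.

Let qf_comb v : qf residual_gram v = dot (comb_residual v) (comb_residual v).
Proof.
rewrite {1}/comb_residual dot_suml//; last by move=> i; exact: Rp_residual.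
rewrite qfE; apply: eq_bigr => i _; rewrite dotC dot_suml//; [|exact: Rp_residual..].
rewrite mulr_sumr; apply: eq_bigr => k _; rewrite mxE dotC; ring.
Qed.

Lemma residual_gram_ge0 v : 0 <= qf residual_gram v.
Proof. by rewrite qf_comb dot_ge0. Qed.

(** Bessel's inequality for the combination of residuals with coefficients [v], restricted to the
    coordinates selected by [c]. *)
Lemma gram_le_residual_gram m (c : 'I_m -> bool) (v : 'cV[R]_N) :
  (forall l : 'I_m, c l -> l != j :> nat) ->
  forall Y : 'M[R]_(N, m), Y = \matrix_(i < N, l < m) ((c l)%:R * coef (x i) l) ->
  qf (Y *m Y^T) v <= qf residual_gram v.
Proof.
move=> cj Y ->; rewrite qf_comb qf_mul_trmx.
have Rv : Rp (comb_residual v) by exact: Rcomb.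
have := bessel uRp uon m Rv; apply: le_trans; apply: ler_sum => l _.
rewrite (_ : (_ *m v) l 0 = (c l)%:R * coef (comb_residual v) l); last first.
  rewrite mxE /basis_coef dotC dot_suml//; last by move=> i; exact: Rp_residual.
  rewrite mulr_sumr; apply: eq_bigr => i _; rewrite !mxE.
  rewrite [dot (residual i) _]dotC -/(coef (residual i) l) coef_residual.
  by have := cj l; case: (c l) => [/(_ isT) ->|_]; rewrite /basis_coef ?mul0r// !mul1r mulrC.
by case: (c l); rewrite ?mul1r -?expr2// mul0r expr0n sqr_ge0.
Qed.

Lemma cvg_residual_gram i k :
  \sum_(l < n) (l != j :> nat)%:R * coef (x i) l * coef (x k) l @[n --> \oo] --> residual_gram i k.
Proof.
have Ri : Rp (residual i) by exact: Rp_residual.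
have Rk : Rp (residual k) by exact: Rp_residual.
rewrite mxE; have := parseval uRp uon ucp Ri Rk.
apply: cvg_trans; apply: near_eq_cvg; near=> n; apply: eq_bigr => l _.
by rewrite !coef_residual; case: (_ != _); rewrite ?(mul1r, mul0r).
Unshelve. all: end_near. Qed.

(** Zeroing row [j] instead of removing it keeps [k] rows whether or not [j < k]. *)
Definition head_mx (k : nat) : 'M[R]_(k, N) :=
  \matrix_(l < k, i < N) ((l != j :> nat)%:R * coef (x i) l).

Lemma cvg_tail_gram k i q :
  \sum_(l < n) ((k <= l)%N && (l != j :> nat))%:R * coef (x i) l * coef (x q) l @[n --> \oo] -->
  (residual_gram - (head_mx k)^T *m head_mx k) i q.
Proof.
set C := head_mx k.
have c1 : (\sum_(l < n) (l != j :> nat)%:R * coef (x i) l * coef (x q) l)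
    - (C^T *m C) i q @[n --> \oo] --> (residual_gram - C^T *m C) i q.
  rewrite [(residual_gram - _) i q]mxE [(- (C^T *m C)) i q]mxE.
  by apply: cvgB; [exact: cvg_residual_gram|exact: cvg_cst].
move: c1; apply: cvg_trans; apply: near_eq_cvg; near=> n.
have kn : (k <= n)%N by near: n; exact: nbhs_infty_ge.
have -> : (C^T *m C) i q = \sum_(l < k) (l != j :> nat)%:R * coef (x i) l * coef (x q) l.
  by rewrite mxE; apply: eq_bigr => l _; rewrite !mxE; case: (_ != _); rewrite ?(mul1r, mul0r).
rewrite -(subnKC kn) !big_split_ord/= addrAC subrr add0r.
rewrite [X in _ = X + _]big1 ?add0r; last by move=> l _; rewrite leqNgt ltn_ord !mul0r.
by apply: eq_bigr => l _; rewrite leq_addr.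
Unshelve. all: end_near. Qed.

(** Entrywise, the tail Gram matrix is a limit of sums of rank-one terms r r^T. Each contributes |Q
    r|^2 <= |r|^2 to the trace, so bounds on the truncated sums of squares are enough. *)
Lemma resolvent_residual_le (k : nat) (e t : R) : 0 < e ->
  (forall n, \sum_i \sum_(l < n) ((k <= l)%N && (l != j :> nat))%:R * coef (x i) l ^+ 2 <= t) ->
  \tr (resolvent (head_mx k) e *m (residual_gram - (head_mx k)^T *m head_mx k)
    *m resolvent (head_mx k) e) <= t.
Proof.
move=> e0 ht; set C := head_mx k; set Q := resolvent C e.
pose D n : 'M[R]_N := \matrix_(i, q)
  \sum_(l < n) ((k <= l)%N && (l != j :> nat))%:R * coef (x i) l * coef (x q) l.
have cD i q : D n i q @[n --> \oo] --> (residual_gram - C^T *m C) i q.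
  by under eq_fun do rewrite mxE; exact: cvg_tail_gram.
have tE (M : 'M[R]_N) : \tr (Q *m M *m Q) = \sum_a \sum_b \sum_c Q a b * M b c * Q c a.
  apply: eq_bigr => a _; rewrite mxE exchange_big/=; apply: eq_bigr => c _.
  by rewrite mxE mulr_suml.
have ct : \tr (Q *m D n *m Q) @[n --> \oo] --> \tr (Q *m (residual_gram - C^T *m C) *m Q).
  rewrite tE; under eq_fun do rewrite tE.
  apply: cvg_bigsum => a; apply: cvg_bigsum => b; apply: cvg_bigsum => c.
  apply: cvgM; last exact: cvg_cst.
  by apply: cvgM; [exact: cvg_cst|exact: cD].
rewrite -(cvg_lim (@Rhausdorff R) ct); apply: limr_le; first by apply/cvg_ex; eexists; exact: ct.
near=> n; apply: le_trans (ht n).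
pose r (l : nat) : 'cV[R]_N := \col_i (((k <= l)%N && (l != j))%:R * coef (x i) l).
have DE : D n = \sum_(l < n) r l *m (r l)^T.
  apply/matrixP => i q; rewrite mxE summxE; apply: eq_bigr => l _.
  by rewrite !mxE big_ord1 !mxE; case: (_ && _); rewrite ?(mul1r, mul0r, mulr0, expr2).
have -> : \tr (Q *m D n *m Q) = \sum_(l < n) dotv (Q *m r l) (Q *m r l).
  rewrite DE mulmx_sumr mulmx_suml raddf_sum/=; apply: eq_bigr => l _.
  have -> : Q *m (r l *m (r l)^T) *m Q = Q *m r l *m (Q *m r l)^T.
    by rewrite trmx_mul (trmx_resolvent C e0) !mulmxA.
  rewrite mxtrace_mulC.
  by rewrite /mxtrace big_ord1 dotvE.
rewrite [leRHS]exchange_big/=; apply: ler_sum => l _.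
apply: le_trans (resolvent_contraction C e0 (r l)) _.
rewrite le_eqVlt; apply/orP; left; apply/eqP; apply: eq_bigr => i _; rewrite !mxE.
by case: (_ && _); rewrite ?(mul1r, mul0r, mulr0, expr2).
Unshelve. all: end_near. Qed.

(** * The minimum-norm interpolator and its error along one direction *)

Section interpolation.
Variables (y : 'I_N -> R) (bhat beta : vec R p).
Hypothesis Rbeta : Rp beta.
Let A : 'M[R]_N := \matrix_(i, k) dot (x i) (x k).

(** The interpolator z in the span of the rows is a competitor, and bhat - z is orthogonal to all
    rows, hence to z; Pythagoras and minimality force [bhat = z]. *)
Lemma argmin_coef : is_argmin_norm (interpolators x y) bhat -> A \in unitmx ->
  Rp bhat /\ exists2 lam : 'cV[R]_N, A *m lam = \col_i y i & coef bhat j = dotv col_part lam.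
Proof.
move=> [[Rbh bhy] bmin] uA; split => //.
exists (invmx A *m \col_i y i); first by rewrite mulKVmx.
set lam := invmx A *m _; pose z : vec R p := fun t => \sum_i lam i 0 * x i t.
have Rz : Rp z by exact: Rp_sum.
have zx i : dot (x i) z = y i.
  rewrite dotC dot_suml//; have -> : y i = (A *m lam) i 0 by rewrite mulKVmx// mxE.
  by rewrite [RHS]mxE; apply: eq_bigr => k _; rewrite [A _ _]mxE mulrC dotC.
have Rbz : Rp (vsub bhat z) by exact: Rp_vsub.
have orth : dot z (vsub bhat z) = 0.
  by rewrite dot_suml// big1// => i _; rewrite dotBr// bhy zx subrr mulr0.
have nle := bmin z (conj Rz zx).
have d0 : dot (vsub bhat z) (vsub bhat z) = 0.
  apply/eqP; rewrite eq_le dot_ge0// andbT.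
  have : dot bhat bhat <= dot z z.
    rewrite -(sqr_sqrtr (dot_ge0 Rbh)) -(sqr_sqrtr (dot_ge0 Rz)) ler_sqr ?nnegrE ?sqrtr_ge0//.
  have -> : dot bhat bhat = dot z z + dot (vsub bhat z) (vsub bhat z).
    have e : dot bhat z = dot z z by move: orth; rewrite dotBr// => /subr0_eq; rewrite dotC.
    by rewrite dotBl// !dotBr// [dot z bhat]dotC e; ring.
  by lra.
have -> : bhat = z.
  by apply/funext => t; apply/subr0_eq; exact: (dot_eq0 Rbz d0 t).
rewrite /basis_coef dotC dot_suml//; apply: eq_bigr => i _.
by rewrite [col_part i 0]mxE mulrC dotC.
Qed.

Lemma gram_col_part : A = col_part *m col_part^T + residual_gram.
Proof.
apply/matrixP => i k; rewrite [LHS]mxE gram_residual [RHS]mxE; congr (_ + _).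
by rewrite mxE big_ord1 !mxE.
Qed.

Lemma posdef_gram : posdef residual_gram -> posdef A.
Proof.
move=> pB; rewrite gram_col_part; split => [|v v0].
  by rewrite linearD/= trmx_mul trmxK residual_gram_sym.
by rewrite qfD qf_mul_trmx ltr_wpDl ?dotvv_ge0//; exact: pB.2.
Qed.

Lemma argmin_error (e : 'cV[R]_N) : posdef residual_gram ->
  is_argmin_norm (interpolators x y) bhat -> (forall i, y i = coef beta j * coef (x i) j + e i 0) ->
  coef (vsub bhat beta) j =
  (dotv col_part (invmx residual_gram *m e) - coef beta j) /
    (1 + qf (invmx residual_gram) col_part).
Proof.
move=> pB amin ye.
have [Rbh [lam lamE ce]] := argmin_coef amin (posdef_unit (posdef_gram pB)).
rewrite coef_vsub// ce; apply: rank_one_solve => //.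
by rewrite -gram_col_part lamE; apply/colP => i; rewrite !mxE ye.
Qed.

Lemma interpolators_nonempty : A \in unitmx -> interpolators x y !=set0.
Proof.
move=> uA; set lam := invmx A *m \col_i y i; exists (fun t => \sum_i lam i 0 * x i t).
split => [|i]; first exact: Rp_sum.
rewrite dotC dot_suml//; have -> : y i = (A *m lam) i 0 by rewrite mulKVmx// mxE.
by rewrite [RHS]mxE; apply: eq_bigr => k _; rewrite [A _ _]mxE mulrC dotC.
Qed.

End interpolation.
End columns.

(** * Laws and independence in the model *)

Section measurable_vectors.
Context {R : realType} {p : option nat} {d : measure_display} {T : measurableType d}.
Variable x : T -> vec R p.
Hypotheses (mx : forall j, measurable_fun setT (fun w => x w j)) (Rx : forall w, Rp (x w)).

Lemma measurable_zext l : measurable_fun setT (fun w => zext (x w) l).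
Proof.
by rewrite /zext; case: (insub l) => [i|]/=; [exact: mx|exact: measurable_cst].
Qed.

Lemma measurable_dot (v : vec R p) : Rp v -> measurable_fun setT (fun w => dot (x w) v).
Proof.
move=> Rv; apply: (@measurable_fun_cvg _ _ _ _ (fun n w => \sum_(l < n) zext (x w) l * zext v l)).
  by move=> n; apply: measurable_sum => l; apply: measurable_funM => //; exact: measurable_zext.
by move=> w _; apply: cvg_dot.
Qed.

End measurable_vectors.

Lemma has_law0 (R : realType) d (T : measurableType d) (P : probability T R) :
  has_centered_normal_law P (fun=> 0) 0.
Proof.
split => // B mB; rewrite /centered_normal eqxx.
rewrite diracE; have [|] := boolP (0 \in B).
  by rewrite inE => h; rewrite (_ : _ @^-1` _ = setT) ?probability_setT//; apply/seteqP; split.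
move=> /negP h; rewrite (_ : _ @^-1` _ = set0) ?measure0//.
by apply/seteqP; split => // w /= hw; apply: h; rewrite inE.
Qed.

Section generators.
Context {R : realType} {d : measure_display} {T : measurableType d}.
Variable L : set (T -> R).

Definition generators : set (set T) :=
  [set A | exists U (Y : set (measurableTypeR R)), [/\ L U, measurable Y & A = U @^-1` Y]].

Lemma measurable_generators U : L U -> measurable_fun setT (U : g_sigma_algebraType generators -> R).
Proof.
by move=> LU _ Y mY; rewrite setTI; apply: sub_sigma_algebra; exists U, Y.
Qed.

Lemma generators_measurable : (forall U, L U -> measurable_fun setT U) -> generators `<=` measurable.
Proof.
by move=> h _ [U [Y [LU mY ->]]]; rewrite -[_ @^-1` _]setTI; exact: h.
Qed.

End generators.

Section sigma_gen.
Context {R : realType} {d : measure_display} {T : measurableType d} {I : Type}.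
Variable Z : I -> T -> R.
Hypothesis mZ : forall i, measurable_fun setT (Z i).

Definition base_gen : set (set T) := \bigcup_(i in [set: I])
  preimage_set_system [set: T] (Z i) (@measurable _ (measurableTypeR R)).

Lemma base_gen_measurable : base_gen `<=` measurable.
Proof. by move=> _ [i _ [Y mY <-]]; exact: mZ. Qed.

Lemma sigma_gen_measurable : sigma_gen Z `<=` measurable.
Proof. apply: smallest_sub; [exact: sigma_algebra_measurable|exact: base_gen_measurable]. Qed.

Lemma measurable_base_gen i : measurable_fun setT (Z i : g_sigma_algebraType base_gen -> R).
Proof. by move=> _ Y mY; apply: sub_sigma_algebra; exists i => //; exists Y. Qed.

Lemma sigma_gen_setI : setI_closed (sigma_gen Z).
Proof. by move=> A B hA hB; exact: (@measurableI _ (g_sigma_algebraType base_gen)). Qed.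

Lemma sigma_genT : sigma_gen Z setT.
Proof. exact: (@measurableT _ (g_sigma_algebraType base_gen)). Qed.

Lemma sigma_gen_sub i (Y : set (measurableTypeR R)) : measurable Y -> sigma_gen Z (Z i @^-1` Y).
Proof.
by move=> mY; apply: sub_sigma_algebra; exists i => //; exists Y => //; rewrite setTI.
Qed.

End sigma_gen.

Section model.
Context {R : realType} {p : option nat} {N : nat}.
Variables (S : idx p -> vec R p) (sigma : vec R p) (u : idx p -> vec R p).
Hypothesis cov : is_covariance S sigma u.
Context {d : measure_display} {T : measurableType d}.
Variables (P : probability T R) (beta : vec R p) (sxi : R)
  (X : 'I_N -> T -> vec R p) (xi : 'I_N -> T -> R) (bhat : T -> vec R p).
Hypothesis glm : gaussian_linear_model P S beta sxi X xi bhat.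

Let uRp := cov_basis_Rp cov.
Let uon := cov_orthonormal cov.
Let ucp := cov_complete cov.
Local Notation sg := (zext sigma).
Local Notation coef := (basis_coef u).
Local Notation bv := (bv u).
Local Notation qcov := (cov_form S).

Let RX i w : Rp (X i w). Proof. by exact: (glm_X_Rp glm). Qed.

Definition row_gen (J : pred 'I_N) : set (set T) :=
  \bigcup_(i in [set i | J i]) sigma_gen (fun j w => X i w j).

Lemma row_gen_measurable J : row_gen J `<=` measurable.
Proof. by move=> A [i _]; apply: sigma_gen_measurable => j; exact: (glm_X_meas glm). Qed.

Lemma row_indep (J : pred 'I_N) :
  independent2 P <<s row_gen J>> <<s row_gen (fun i => ~~ J i)>>.
Proof.
apply: mutually_independent_split.
- by move=> i; exact: sigma_gen_setI.
- by move=> i; exact: sigma_genT.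
- by move=> i; apply: sigma_gen_measurable => j; exact: (glm_X_meas glm).
- exact: (glm_X_indep glm).
Qed.

Lemma measurable_row_gen (J : pred 'I_N) i v : J i -> Rp v ->
  measurable_fun setT ((fun w => dot (X i w) v) : g_sigma_algebraType (row_gen J) -> R).
Proof.
move=> Ji Rv; apply: (@measurable_dot _ _ _ (g_sigma_algebraType (row_gen J)) (X i)) => // j.
move=> _ Y mY; rewrite setTI; apply: sub_sigma_algebra; exists i => //.
by apply: (@sigma_gen_sub _ _ _ _ (fun j w => X i w j) j).
Qed.

(** Rows are added one at a time, each being independent of all the others. *)
Lemma design_law (v : 'I_N -> vec R p) : (forall i, Rp (v i)) ->
  has_centered_normal_law P (fun w => \sum_i dot (X i w) (v i)) (\sum_i qcov (v i)).
Proof.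
move=> Rv.
have h (r : seq 'I_N) : uniq r ->
    has_centered_normal_law P (fun w => \sum_(i <- r) dot (X i w) (v i)) (\sum_(i <- r) qcov (v i)).
  elim: r => [_|i r IH /= /andP[ir ur]].
    by rewrite big_nil; under eq_fun do rewrite big_nil; exact: has_law0.
  rewrite big_cons; under eq_fun do rewrite big_cons.
  apply: (law_add (F := row_gen (pred1 i)) (G := row_gen (fun k => ~~ pred1 i k))).
  - exact: row_gen_measurable.
  - exact: row_gen_measurable.
  - exact: row_indep.
  - by apply: measurable_row_gen => //=; rewrite eqxx.
  (* As [i] is not in [r], replacing a possible term at [i] by 0 changes nothing and makes each
     summand visibly measurable for the other rows. *)
  - rewrite (_ : (fun w => _) = (fun w => \sum_(k <- r) if k == i then 0 else dot (X k w) (v k))).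
      apply: measurable_sum => k; case: (boolP (k == i)) => ki; first exact: measurable_cst.
      exact: measurable_row_gen.
    apply/funext => w; rewrite big_seq [RHS]big_seq; apply: eq_bigr => k kr.
    by case: eqVneq => // ki; move: ir; rewrite -ki kr.
  - exact: (qcov_ge0 cov).
  - by apply: sumr_ge0 => k _; exact: (qcov_ge0 cov).
  - by apply: (glm_X_gauss glm).
  - exact: IH.
exact: h (index_enum_uniq _).
Qed.

Definition design_gen : set (set T) := base_gen (fun (ij : 'I_N * idx p) w => X ij.1 w ij.2).
Definition noise_gen : set (set T) := base_gen xi.

Lemma measurable_xi i : measurable_fun setT (xi i).
Proof.
have [m _] := glm_xi_gauss glm (fun k => (k == i)%:R).
rewrite (_ : xi i = (fun w => \sum_k (k == i)%:R * xi k w))//; apply/funext => w.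
by rewrite (bigD1 i)//= eqxx mul1r big1 ?addr0// => k /negbTE ->; rewrite mul0r.
Qed.

Lemma design_gen_measurable : design_gen `<=` measurable.
Proof. by apply: base_gen_measurable => ij; exact: (glm_X_meas glm). Qed.

Lemma noise_gen_measurable : noise_gen `<=` measurable.
Proof. by apply: base_gen_measurable => i; exact: measurable_xi. Qed.

Lemma design_noise_indep : independent2 P <<s design_gen>> <<s noise_gen>>.
Proof. exact: (glm_X_xi_indep glm). Qed.

Lemma measurable_design_gen i v : Rp v ->
  measurable_fun setT ((fun w => dot (X i w) v) : g_sigma_algebraType design_gen -> R).
Proof.
move=> Rv; apply: (@measurable_dot _ _ _ (g_sigma_algebraType design_gen) (X i)) => // j.
exact: (measurable_base_gen (Z := fun (ij : 'I_N * idx p) w => X ij.1 w ij.2) (i, j)).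
Qed.

Lemma measurable_noise_gen i : measurable_fun setT (xi i : g_sigma_algebraType noise_gen -> R).
Proof. exact: measurable_base_gen. Qed.

Lemma model_law (v : 'I_N -> vec R p) (c : 'I_N -> R) : (forall i, Rp (v i)) ->
  has_centered_normal_law P (fun w => \sum_i dot (X i w) (v i) + \sum_i c i * xi i w)
    (\sum_i qcov (v i) + sxi ^+ 2 * \sum_i c i ^+ 2).
Proof.
move=> Rv; apply: (law_add (F := design_gen) (G := noise_gen)).
- exact: design_gen_measurable.
- exact: noise_gen_measurable.
- exact: design_noise_indep.
- by apply: measurable_sum => i; exact: measurable_design_gen.
- by apply: measurable_sum => i; apply: measurable_funM => //; exact: measurable_noise_gen.
- by apply: sumr_ge0 => i _; exact: (qcov_ge0 cov).
- by rewrite mulr_ge0 ?sqr_ge0// sumr_ge0// => i _; exact: sqr_ge0.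
- exact: design_law.
- exact: (glm_xi_gauss glm).
Qed.

Lemma noise_gaussian : gaussian_vector P xi (fun=> sxi ^+ 2).
Proof.
split=> [i|a]; first exact: sqr_ge0.
by rewrite -mulr_sumr; exact: (glm_xi_gauss glm).
Qed.

(** * Independence of one column from the rest of the model *)

Section column.
Variable j : nat.
Hypothesis pj : in_dim p j.

Let Rb l : Rp (bv l). Proof. by exact: (@Rp_bv _ _ _ uRp). Qed.

Definition column_space : set (T -> R) :=
  [set U | exists c : 'I_N -> R, U = fun w => \sum_i c i * dot (X i w) (bv j)].

(** Linear functionals of the rows in directions orthogonal to u_j, together with the noise: the
    matrix [B] and the vector e of the overview are measurable for the sigma-algebra that they
    generate. *)
Definition orth_space : set (T -> R) :=
  [set V | exists (v : 'I_N -> vec R p) (c : 'I_N -> R),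
    [/\ forall i, Rp (v i), forall i, coef (v i) j = 0 &
    V = fun w => \sum_i dot (X i w) (v i) + \sum_i c i * xi i w]].

Definition column_gen := generators column_space.
Definition orth_gen := generators orth_space.

Let dot0r (v : vec R p) : dot v (fun=> 0) = 0.
Proof. by rewrite dotC dot0l. Qed.

Let dotXlin i w (a : R) v v' : Rp v -> Rp v' ->
  dot (X i w) (fun t => a * v t + v' t) = a * dot (X i w) v + dot (X i w) v'.
Proof.
move=> Rv Rv'; have Rav : Rp (fun t => a * v t) by exact: RpZ.
by rewrite dotC dotDl// dotZl// ![dot _ (X i w)]dotC.
Qed.

Let Rlin (a : R) (v v' : vec R p) : Rp v -> Rp v' -> Rp (fun t => a * v t + v' t).
Proof. by move=> Rv Rv'; apply: RpD => //; exact: RpZ. Qed.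

Let coef_lin (a : R) v v' l : Rp v -> Rp v' ->
  coef (fun t => a * v t + v' t) l = a * coef v l + coef v' l.
Proof.
move=> Rv Rv'; have Rav : Rp (fun t => a * v t) by exact: RpZ.
by rewrite /basis_coef dotC dotDl// dotZl// ![dot _ (bv l)]dotC.
Qed.

Lemma linear_column_space : linear_space column_space.
Proof.
split; first by exists (fun=> 0); apply/funext => w; rewrite big1// => i _; rewrite mul0r.
move=> a _ _ [c ->] [c' ->]; exists (fun i => a * c i + c' i); apply/funext => w.
by rewrite mulr_sumr -big_split; apply: eq_bigr => i _ /=; rewrite mulrDl mulrA.
Qed.

Lemma linear_orth_space : linear_space orth_space.
Proof.
split.
  exists (fun _ _ => 0), (fun=> 0); split => [i|i|]; [exact: (@Rp0 R p)|by rewrite /basis_coef dot0r|].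
  apply/funext => w; rewrite !big1 ?addr0// => i _; by rewrite ?mul0r ?dot0r.
move=> a _ _ [v [c [Rv vj ->]]] [v' [c' [Rv' vj' ->]]].
exists (fun i t => a * v i t + v' i t), (fun i => a * c i + c' i); split => [i|i|].
- exact: Rlin.
- by rewrite coef_lin// vj vj' mulr0 addr0.
apply/funext => w; rewrite mulrDr !mulr_sumr addrACA; congr (_ + _); rewrite -big_split/=.
  by apply: eq_bigr => i _; rewrite dotXlin.
by apply: eq_bigr => i _; rewrite mulrDl mulrA.
Qed.

Lemma qcov_orth (a : R) v : Rp v -> coef v j = 0 ->
  qcov (fun t => a * bv j t + v t) = sg j * a ^+ 2 + qcov v.
Proof. exact: (qcov_add_orth cov). Qed.

Let qcov0 : qcov (fun=> 0 : R) = 0.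
Proof. by rewrite /cov_form dot0l. Qed.

Lemma column_law (c : 'I_N -> R) :
  has_centered_normal_law P (fun w => \sum_i c i * dot (X i w) (bv j)) (\sum_i sg j * c i ^+ 2).
Proof.
have R0 : Rp ((fun=> 0) : vec R p) by exact: (@Rp0 R p).
pose v i : vec R p := fun t => c i * bv j t + 0.
have Rv i : Rp (v i) by exact: Rlin.
have := design_law Rv; congr (has_centered_normal_law _ _ _).
  apply/funext => w; apply: eq_bigr => i _.
  by rewrite (dotXlin i w (c i) (@Rb j) R0) dot0r addr0.
by apply: eq_bigr => i _; rewrite (qcov_orth (c i) R0) ?qcov0 ?addr0// /basis_coef dot0r.
Qed.

(** Since u_j is an eigenvector, the covariance form splits along u_j and its orthogonal complement
    ([qcov_orth]). The variance of a sum is then the sum of the variances, and the sum is normal as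
    a linear functional of the whole model. *)
Lemma column_orth_uncorrelated : uncorrelated_normal P column_space orth_space.
Proof.
move=> _ _ [c ->] [v [c' [Rv vj ->]]].
exists (\sum_i sg j * c i ^+ 2), (\sum_i qcov (v i) + sxi ^+ 2 * \sum_i c' i ^+ 2); split.
- split; first by apply: sumr_ge0 => i _; rewrite mulr_ge0 ?sqr_ge0// (zext_sigma_ge0 cov).
  apply: addr_ge0; first by apply: sumr_ge0 => i _; exact: (qcov_ge0 cov).
  by rewrite mulr_ge0 ?sqr_ge0// sumr_ge0// => i _; exact: sqr_ge0.
- exact: column_law.
- exact: model_law.
pose v' i : vec R p := fun t => c i * bv j t + v i t.
have Rv' i : Rp (v' i) by exact: Rlin.
have := model_law c' Rv'; congr (has_centered_normal_law _ _ _).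
  apply/funext => w; rewrite [RHS]addrA -[X in _ = X + _]big_split/=; congr (_ + _); apply: eq_bigr => i _.
  by rewrite (dotXlin i w (c i) (@Rb j) (Rv i)).
rewrite addrA -big_split/=; congr (_ + _); apply: eq_bigr => i _.
by rewrite (qcov_orth (c i) (Rv i)).
Qed.

Lemma column_orth_indep : independent2 P <<s orth_gen>> <<s column_gen>>.
Proof.
have h : independent2 P <<s column_gen>> <<s orth_gen>>.
  apply: (normal_indep linear_column_space linear_orth_space column_orth_uncorrelated).
    by move=> A [U [Y h]]; exists U, Y.
  by move=> A [U [Y h]]; exists U, Y.
by move=> A B hA hB; rewrite setIC h// muleC.
Qed.

Lemma column_gen_measurable : column_gen `<=` measurable.
Proof. by apply: generators_measurable => U [c ->]; case: (column_law c). Qed.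

Lemma orth_gen_measurable : orth_gen `<=` measurable.
Proof.
by apply: generators_measurable => V [v [c [Rv _ ->]]]; case: (model_law c Rv).
Qed.

Lemma column_gaussian : gaussian_vector P (fun i w => coef (X i w) j) (fun=> sg j).
Proof.
split=> [i|c]; first exact: (zext_sigma_ge0 cov).
have := column_law c; congr (has_centered_normal_law _ _ _).
by apply/funext => w; apply: eq_bigr => i _; rewrite dotC.
Qed.

Lemma measurable_column i :
  measurable_fun setT ((fun w => coef (X i w) j) : g_sigma_algebraType column_gen -> R).
Proof.
apply: measurable_generators; exists (fun k => (k == i)%:R); apply/funext => w.
rewrite (bigD1 i)//= eqxx mul1r big1 ?addr0 => [|k /negbTE ->]; last by rewrite mul0r.
by rewrite dotC.
Qed.

Lemma measurable_orth_dot i v : Rp v -> coef v j = 0 ->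
  measurable_fun setT ((fun w => dot (X i w) v) : g_sigma_algebraType orth_gen -> R).
Proof.
move=> Rv vj; apply: measurable_generators.
exists (fun k t => (k == i)%:R * v t), (fun=> 0); split => [k|k|].
- exact: RpZ.
- by rewrite /basis_coef dotC dotZl// dotC -/(coef v j) vj mulr0.
apply/funext => w; rewrite [X in _ + X]big1 ?addr0 => [|k _]; last by rewrite mul0r.
rewrite (bigD1 i)//= eqxx [X in _ + X]big1 ?addr0 => [|k /negbTE ->].
  by under [in RHS]eq_fun do rewrite mul1r.
by rewrite dotC dotZl// mul0r.
Qed.

Lemma measurable_orth_xi i :
  measurable_fun setT (xi i : g_sigma_algebraType orth_gen -> R).
Proof.
apply: measurable_generators.
exists (fun _ _ => 0), (fun k => (k == i)%:R); split => [k|k|]; [exact: (@Rp0 R p)|by rewrite /basis_coef dot0r|].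
apply/funext => w; rewrite big1 ?add0r => [|k _]; last by rewrite dot0r.
by rewrite (bigD1 i)//= eqxx mul1r big1 ?addr0// => k /negbTE ->; rewrite mul0r.
Qed.

Lemma measurable_orth_coef i l : l != j ->
  measurable_fun setT ((fun w => coef (X i w) l) : g_sigma_algebraType orth_gen -> R).
Proof.
move=> lj; under eq_fun do rewrite /basis_coef dotC.
apply: measurable_orth_dot; first exact: Rb.
by rewrite /basis_coef dot_bv// eq_sym (negbTE lj) andbF.
Qed.

End column.
End model.

(** * Lower bounds in one direction *)

Section column_bounds.
Context {R : realType} {p : option nat} {N : nat}.
Variables (S : idx p -> vec R p) (sigma : vec R p) (u : idx p -> vec R p).
Hypothesis cov : is_covariance S sigma u.
Context {d : measure_display} {T : measurableType d}.
Variables (P : probability T R) (beta : vec R p) (sxi : R)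
  (X : 'I_N -> T -> vec R p) (xi : 'I_N -> T -> R) (bhat : T -> vec R p).
Hypothesis glm : gaussian_linear_model P S beta sxi X xi bhat.

Let uRp := cov_basis_Rp cov.
Let uon := cov_orthonormal cov.
Let ucp := cov_complete cov.
Local Notation sg := (zext sigma).
Local Notation coef := (basis_coef u).
Local Notation bv := (bv u).
Local Notation pr := (pr P).

Let RX w i : Rp (X i w). Proof. by exact: (glm_X_Rp glm). Qed.
Let Rb l : Rp (bv l). Proof. by exact: (@Rp_bv _ _ _ uRp). Qed.

Variables (b : R) (k : nat).
Let t := tail_trace sigma k.
Hypotheses (N0 : (0 < N)%N) (b24 : 24 <= b) (sk0 : 0 < sg k) (bt : b * N%:R * sg k <= t).

Let NR : 0 < N%:R :> R. Proof. by rewrite ltr0n. Qed.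
Let Nsk : 24 * N%:R * sg k <= t.
Proof. by apply: le_trans bt; rewrite ler_pM2r// ler_pM2r. Qed.
Let t0 : 0 < t.
Proof. by apply: lt_le_trans Nsk; rewrite !mulr_gt0. Qed.

Variable j : nat.
Hypothesis pj : in_dim p j.

Let vj : 0 < sg j. Proof. exact: (zext_sigma_gt0 cov). Qed.

Definition other_gram w : 'M[R]_N := residual_gram u (fun i => X i w) j.
(** The regression vector without its component along u_j; with the noise it yields a response that
    does not involve the column. *)
Definition other_signal : vec R p := vsub beta (fun i => coef beta j * bv j i).
Definition other_response w : 'cV[R]_N := \col_i dot (X i w) other_signal.
Definition column : 'I_N -> T -> R := fun i w => coef (X i w) j.

Let Rbeta : Rp beta. Proof. by exact: (glm_beta glm). Qed.

Let Rcb : Rp (fun i => coef beta j * bv j i).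
Proof. by apply: RpZ; exact: Rb. Qed.

Let Rsignal : Rp other_signal.
Proof. exact: Rp_vsub. Qed.

Let coef_signal : coef other_signal j = 0.
Proof.
rewrite /other_signal coef_vsub// {2}/basis_coef dotC dotZl//; [|exact: Rb..].
by rewrite dot_bv// pj eqxx mulr1 subrr.
Qed.

Let gram_sym w : (other_gram w)^T = other_gram w.
Proof. exact: residual_gram_sym. Qed.

Let gram_ge0 w v : 0 <= qf (other_gram w) v.
Proof. exact: (residual_gram_ge0 uRp (@RX w)). Qed.

(** The map [f] changes the sigma-algebra on [T], so that the same proof serves [orthT] and
    [designT]. *)
Lemma measurable_other_gram d' (T' : measurableType d') (f : T' -> T) :
  (forall i l, l != j -> measurable_fun setT (fun w => coef (X i (f w)) l)) ->
  measurable_mx (fun w => other_gram (f w)).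
Proof.
move=> h i q; apply: (@measurable_fun_cvg _ _ _ _
  (fun n w => \sum_(l < n) (l != j :> nat)%:R * coef (X i (f w)) l * coef (X q (f w)) l)).
  move=> n; apply: measurable_sum => l; case: (boolP (l != j :> nat)) => lj.
    by apply: measurable_funM; [apply: measurable_funM => //|]; exact: h.
  by under eq_fun do rewrite !mul0r; exact: measurable_cst.
by move=> w _; apply: (cvg_residual_gram uRp uon ucp (@RX (f w)) pj).
Qed.

Local Notation orthT := (g_sigma_algebraType (orth_gen u X xi j)).
Local Notation designT := (g_sigma_algebraType (design_gen X)).

Lemma orth_measurable_gram : measurable_mx (other_gram : orthT -> _).
Proof.
apply: (@measurable_other_gram _ orthT id) => i l lj.
by apply: (measurable_orth_coef cov glm).
Qed.

Lemma orth_measurable_response : measurable_mx ((fun w => other_response w + rv_col xi w) : orthT -> _).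
Proof.
apply: measurable_mxD; apply: measurable_cV => i.
  by apply: (measurable_orth_dot cov glm).
exact: measurable_orth_xi.
Qed.

Lemma design_measurable_coef i l : measurable_fun setT ((fun w => coef (X i w) l) : designT -> R).
Proof.
by under eq_fun do rewrite /basis_coef dotC; apply: (measurable_design_gen glm); exact: Rb.
Qed.

Lemma design_measurable_gram : measurable_mx (other_gram : designT -> _).
Proof.
by apply: (@measurable_other_gram _ designT id) => i l lj; exact: design_measurable_coef.
Qed.

Lemma design_measurable_response : measurable_mx (other_response : designT -> _).
Proof. by apply: measurable_cV => i; apply: (measurable_design_gen glm). Qed.

Let column_gaussian_j : gaussian_vector P column (fun=> sg j).
Proof. exact: (column_gaussian cov glm). Qed.

Definition column_error : T -> R :=
  regression_error column other_gram (fun w => other_response w + rv_col xi w) (coef beta j).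

Lemma column_error_ge0 w : 0 <= column_error w.
Proof. by rewrite mulr_ge0 ?sqr_ge0. Qed.

Let mOG : orth_gen u X xi j `<=` measurable.
Proof. by apply: (orth_gen_measurable cov glm). Qed.

Let measurable_gram : measurable_mx other_gram.
Proof.
by move=> i q; apply: (measurable_fun_g_sigma mOG); exact: orth_measurable_gram.
Qed.

Lemma measurable_column_error : measurable_fun setT column_error.
Proof.
have mc : measurable_mx (rv_col column) by exact: (measurable_rv_col column_gaussian_j).
have mr : measurable_mx (fun w => other_response w + rv_col xi w).
  by move=> i q; apply: (measurable_fun_g_sigma mOG); exact: orth_measurable_response.
have mi := measurable_inv0 measurable_gram.
apply: measurable_funM.
  by apply: measurable_bool; exact: measurable_unit.
apply: measurable_funX; apply: measurable_funM.
  by apply: measurable_funB => //; apply: measurable_dotv => //; exact: measurable_mulmx.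
apply: measurableT_comp; first exact: measurable_inv.
by apply: measurable_funD => //; exact: measurable_qf.
Qed.

Let active (l : nat) : bool := (k <= l)%N && (l != j).

Let tail_data m (i : 'I_N) (l : 'I_m) w : R := (active l)%:R * coef (X i w) l.

Let tail_data_gaussian m i :
  gaussian_vector P (tail_data (m := m) i) (fun l => (active l)%:R * sg l).
Proof.
split=> [l|a]; first by rewrite mulr_ge0// (zext_sigma_ge0 cov).
pose c (l : nat) : R := (active l)%:R * oapp a 0 (insub l : option 'I_m).
have Rc : Rp (comb u c m) by exact: Rp_comb.
have := glm_X_gauss glm i Rc; rewrite -/(cov_form S _) (qcov_comb cov).
congr (has_centered_normal_law _ _ _).
  apply/funext => w; rewrite dotC (dot_comb uRp)//; apply: eq_bigr => l _.
  by rewrite /c valK/= /tail_data; ring.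
apply: eq_bigr => l _; rewrite /c valK/=.
by case: (active l); rewrite ?mul1r// !mul0r expr0n mulr0.
Qed.

Let row_measurable (J : pred 'I_N) i m (l : 'I_m) : J i ->
  measurable_fun setT (tail_data i l : g_sigma_algebraType (row_gen X J) -> R).
Proof.
move=> Ji; apply: measurable_funM => //; under eq_fun do rewrite /basis_coef dotC.
by apply: (measurable_row_gen glm) => //; exact: Rb.
Qed.

Lemma gram_trace_inv_le :
  4 / 5 <= pr (fun w => (other_gram w \in unitmx) &&
    (\tr (inv0 (other_gram w)) <= 10 * N%:R / t)).
Proof.
have [ct lt] := tail_trace_cvg cov k.
(* Finitely many columns suffice: the partial sums of the tail eigenvalues tend to t and eventually
   exceed 23 t / 24. *)
have [m _ /(_ m (leqnn m)) hm] : \forall n \near \oo, 23 / 24 * t < \sum_(l < n) tail_sigma sigma k l.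
  by apply: (cvgr_gt t) => //; rewrite -/t; move: t0; lra.
have sk' : 0 <= sg k by exact: ltW.
have s01 (l : 'I_m) : 0 <= (active l)%:R * sg l <= sg k.
  rewrite mulr_ge0 ?(zext_sigma_ge0 cov)//= /active; case: leqP => kl; last by rewrite mul0r.
  case: (_ != _); rewrite ?mul0r ?mul1r//; exact: (zext_sigma_noninc cov).
have NskN : sg k * (24 * N%:R) <= t by rewrite mulrC.
(* Excluding [j] loses at most sg k <= t / 24, and sg k N is at most t / 24 as well: 23/24 - 2/24 =
   7/8. *)
have ht : 7 / 8 * t <= \sum_(l < m) (active l)%:R * sg l - sg k * N%:R.
  have h1 : \sum_(l < m) tail_sigma sigma k l - sg k <= \sum_(l < m) (active l)%:R * sg l.
    have e (l : 'I_m) : tail_sigma sigma k l =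
        (active l)%:R * sg l + (l == j :> nat)%:R * tail_sigma sigma k l.
      rewrite /tail_sigma /active [(k <= l)%N]leqNgt; case: (l < k)%N; rewrite ?mul0r ?mulr0 ?addr0//=.
      by case: (_ == _); rewrite ?mul0r ?mul1r ?add0r ?addr0.
    rewrite (eq_bigr _ (fun l _ => e l)) big_split/= lerBlDr lerD2l.
    case: (ltnP j m) => jm; last first.
      rewrite big1// => l _; rewrite (_ : (l == j :> nat) = false) ?mul0r//.
      by apply/negbTE; rewrite neq_ltn (leq_trans (ltn_ord l)).
    rewrite (bigD1 (Ordinal jm))//= eqxx mul1r big1 ?addr0; first exact: (tail_sigma_le cov).
    by move=> l lj; rewrite (_ : (l == j :> nat) = false) ?mul0r//; exact/negbTE.
  have h2 : sg k <= sg k * N%:R by rewrite ler_peMr// ler1n.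
  by move: hm h1 h2 NskN t0; lra.
(* [K] is the bound of [trace_gram_inv_le]; the ridge 1 / (2 K) is the one that
   [trace_inv_le_of_gram] removes, doubling the bound to 10 N / t. *)
pose K := 5 * N%:R / t; have K0 : 0 < K by rewrite divr_gt0// mulr_gt0.
have e0 : 0 < (2 * K)^-1 by rewrite invr_gt0 mulr_gt0.
have mF (J : pred 'I_N) : row_gen X J `<=` measurable by apply: (row_gen_measurable glm).
have mYF i q (l : 'I_m) : q != i -> measurable_fun setT
    (tail_data q l : g_sigma_algebraType (row_gen X (fun q => q != i)) -> R).
  by move=> qi; exact: row_measurable.
have mYG i (l : 'I_m) : measurable_fun setT
    (tail_data i l : g_sigma_algebraType (row_gen X (fun q => ~~ (q != i))) -> R).
  by apply: row_measurable; rewrite /= negbK.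
have [mgood hgood] := trace_gram_inv_le sk' s01 (@tail_data_gaussian m) (fun i => mF _)
  (fun i => mF _) (fun i => row_indep glm (J := fun q => q != i)) mYF mYG t0 e0 N0 ht NskN.
apply: (le_trans hgood); apply: pr_le => //.
  apply: measurable_and; first exact: measurable_unit.
  by apply: measurable_fun_ler => //; apply: measurable_trace; exact: measurable_inv0.
move=> w hw.
have [//|uB tB] := trace_inv_le_of_gram K0 (gram_sym w) _ hw.
  move=> v; apply: (gram_le_residual_gram uRp uon (@RX w) pj (c := fun l => active l)) => //.
  by move=> l /andP[].
rewrite uB inv0E//=; apply: (le_trans tB); rewrite le_eqVlt; apply/orP; left; apply/eqP.
by rewrite /K; field; rewrite gt_eqF.
Qed.

Lemma column_error_bias :
  ((coef beta j ^+ 2 / (1 + 10 * (sg j * (10 * N%:R / t))) ^+ 2 * (8 / 25))%:E <=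
    \int[P]_w (column_error w)%:E)%E.
Proof.
apply: (regression_error_bias mOG _ (column_orth_indep cov glm (j := j)) vj column_gaussian_j).
- by apply: (column_gen_measurable cov glm).
- by move=> i; apply: measurable_column.
- exact: orth_measurable_gram.
- exact: gram_sym.
- exact: gram_ge0.
- exact: orth_measurable_response.
- by rewrite divr_gt0// mulr_gt0.
- exact: gram_trace_inv_le.
Qed.

Let tail_energy n w : R := \sum_i \sum_(l < n) (active l)%:R * coef (X i w) l ^+ 2.

Let tail_energy_limit w : R :=
  \tr (other_gram w - (head_mx u (fun i => X i w) j k)^T *m head_mx u (fun i => X i w) j k).

Let cvg_tail_energy w : tail_energy n w @[n --> \oo] --> tail_energy_limit w.
Proof.
apply: cvg_bigsum => i; have := @cvg_tail_gram _ _ _ uRp uon ucp _ _ (@RX w) _ pj k i i.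
apply: cvg_trans; apply: near_eq_cvg; near=> n; apply: eq_bigr => l _.
by rewrite expr2 mulrA.
Unshelve. all: end_near. Qed.

Let tail_energy_nd w : nondecreasing_seq (tail_energy ^~ w).
Proof.
apply/nondecreasing_seqP => n; apply: ler_sum => i _; rewrite big_ord_recr/= lerDl.
by rewrite mulr_ge0 ?sqr_ge0.
Qed.

Let tail_energy_le w n : tail_energy n w <= tail_energy_limit w.
Proof.
have c := @cvg_tail_energy w; rewrite -(cvg_lim (@Rhausdorff R) c).
apply: nondecreasing_cvgn_le; first exact: tail_energy_nd.
by apply/cvg_ex; eexists; exact: c.
Qed.

Let tail_energy_ge0 n w : 0 <= tail_energy n w.
Proof. by apply: sumr_ge0 => i _; apply: sumr_ge0 => l _; rewrite mulr_ge0 ?sqr_ge0. Qed.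

Let fm_tail_energy_term i l : finite_moments P (fun w => (active l)%:R * coef (X i w) l ^+ 2).
Proof.
apply: finite_momentsZ; apply: finite_momentsX.
exact: (gaussian_vector_finite_moments (column_gaussian cov glm l) i).
Qed.

Let fm_tail_energy n : finite_moments P (tail_energy n).
Proof. by apply: finite_moments_sum => i; apply: finite_moments_sum => l. Qed.

Let Ex_tail_energy n : Ex P (tail_energy n) <= N%:R * t.
Proof.
rewrite Ex_sum; last by move=> i; apply: finite_moments_sum => l.
apply: (@le_trans _ _ (\sum_(i < N) t)); last by rewrite sumr_const card_ord mulr_natl.
apply: ler_sum => i _; rewrite Ex_sum//.
have [_ h] := tail_trace_cvg cov k; apply: le_trans (h n); apply: ler_sum => l _.
have gl := column_gaussian cov glm l.
rewrite ExZ; last by apply: finite_momentsX; exact: (gaussian_vector_finite_moments gl i).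
have := gaussian_vector_moment2 gl i i; rewrite eqxx mulr1.
under eq_fun do rewrite -expr2.
move=> ->; rewrite /active /tail_sigma ltnNge; case: (k <= l)%N => /=; last by rewrite mul0r.
by case: (_ != _); rewrite ?mul1r// mul0r (zext_sigma_ge0 cov).
Qed.

Let measurable_limit : measurable_fun setT tail_energy_limit.
Proof.
apply: (@measurable_fun_cvg _ _ _ _ tail_energy) => [n|w _]; first by case: (fm_tail_energy n).
exact: cvg_tail_energy.
Qed.

Let integral_tail_energy : (\int[P]_w (tail_energy_limit w)%:E <= (N%:R * t)%:E)%E.
Proof.
have mE n : measurable_fun setT (EFin \o tail_energy n).
  by apply/measurable_EFinP; case: (fm_tail_energy n).
have E0 n w : setT w -> (0 <= (EFin \o tail_energy n) w)%E by rewrite lee_fin.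
have nd w : setT w -> nondecreasing_seq (fun n => (EFin \o tail_energy n) w).
  by move=> _ n m nm; rewrite lee_fin; exact: tail_energy_nd.
have := monotone_convergence P measurableT mE E0 nd.
have -> : (\int[P]_w limn (fun n => (EFin \o tail_energy n) w) = \int[P]_w (tail_energy_limit w)%:E)%E.
  apply: eq_integral => w _; apply: cvg_lim => //.
  by apply: cvg_EFin; [near=> n|exact: cvg_tail_energy].
move=> ->; apply: lime_le.
  apply: ereal_nondecreasing_is_cvgn => n m nm; apply: ge0_le_integral => //.
    by move=> w _; rewrite lee_fin.
  by move=> w _; rewrite lee_fin; exact: tail_energy_nd.
near=> n; rewrite (ExE (fm_tail_energy n)) lee_fin; exact: Ex_tail_energy.
Unshelve. all: end_near. Qed.

(** Invertibility is inherited from the event of [gram_trace_inv_le], intersected with the event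
    from Markov's inequality: 4/5 + 3/4 - 1 exceeds 1/2. *)
Lemma gram_trace_inv_ge : (k < N)%N ->
  1 / 2 <= pr (fun w => (other_gram w \in unitmx) &&
    ((N%:R - k%:R) ^+ 2 / (8 * N%:R * t) <= \tr (inv0 (other_gram w)))).
Proof.
move=> kN; have Nt : 0 < 4 * N%:R * t by rewrite !mulr_gt0.
pose bad w := 4 * N%:R * t < tail_energy_limit w.
have mbad : measurable_fun setT bad by exact: measurable_fun_ltr.
have hbad : pr bad <= 1 / 4.
  have e0 w : 0 <= tail_energy_limit w by exact: le_trans (tail_energy_le w 0).
  have := pr_le_integral P mbad (ltW Nt) e0 (fun w => @ltW _ _ _ _).
  move=> /le_trans /(_ integral_tail_energy); rewrite lee_fin => h.
  by rewrite -(ler_pM2l Nt); move: h; lra.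
pose good w := (other_gram w \in unitmx) && (\tr (inv0 (other_gram w)) <= 10 * N%:R / t).
have mtr : measurable_fun setT (fun w => \tr (inv0 (other_gram w))).
  by apply: measurable_trace; exact: measurable_inv0.
have munit : measurable_fun setT (fun w => other_gram w \in unitmx) by exact: measurable_unit.
have mgood : measurable_fun setT good.
  by apply: measurable_and => //; exact: measurable_fun_ler.
have mnb : measurable_fun setT (fun w => ~~ bad w) by exact: measurable_neg.
apply: (@le_trans _ _ (pr (fun w => good w && ~~ bad w))).
  apply: le_trans (pr_and P mgood mnb); rewrite pr_not//.
  by have := gram_trace_inv_le; rewrite -/good; move: hbad; lra.
apply: pr_le; [exact: measurable_and| |].
  by apply: measurable_and => //; exact: measurable_fun_ler.
move=> w /andP[/andP[uB _]]; rewrite /bad -leNgt => h; rewrite uB inv0E//=.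
have pB := psd_unit_posdef (gram_sym w) (gram_ge0 w) uB.
have -> : 8 * N%:R * t = 2 * (4 * N%:R * t) by ring.
apply: (trace_inv_ge (C := head_mx u (fun i => X i w) j k)) => // e e0.
apply: (resolvent_residual_le uRp uon ucp (@RX w) pj e0) => n.
exact: le_trans (tail_energy_le w n) h.
Qed.

Lemma column_error_variance : (k < N)%N ->
  forall x, x = sg j * ((N%:R - k%:R) ^+ 2 / (8 * N%:R * t)) / 2 ->
  ((sxi ^+ 2 * (x / (1 + x)) ^+ 2 / (48 * N%:R * sg j) * (1 / 32))%:E <=
    \int[P]_w (column_error w)%:E)%E.
Proof.
move=> kN _ ->; have kNR : 0 < N%:R - k%:R :> R by rewrite subr_gt0 ltr_nat.
have mCG : column_gen u X j `<=` measurable by apply: (column_gen_measurable cov glm).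
have mDG : design_gen X `<=` measurable by apply: (design_gen_measurable glm).
have mNG : noise_gen xi `<=` measurable by apply: (noise_gen_measurable glm).
apply: (@regression_error_variance _ _ _ P _ _ _ mOG mCG (column_orth_indep cov glm (j := j))
  column _ other_gram vj column_gaussian_j _ _ _ _ _ _ other_response xi sxi (coef beta j)
  ((N%:R - k%:R) ^+ 2 / (8 * N%:R * t)) mDG mNG (design_noise_indep glm)).
- by move=> i; apply: measurable_column.
- exact: orth_measurable_gram.
- exact: gram_sym.
- exact: gram_ge0.
- exact: design_measurable_gram.
- by move=> i; exact: design_measurable_coef.
- exact: design_measurable_response.
- by move=> i; exact: measurable_noise_gen.
- exact: (noise_gaussian glm).
- by [].
- by rewrite divr_gt0 ?exprn_gt0// !mulr_gt0.
- exact: gram_trace_inv_ge.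
Qed.

(** Where the full Gram matrix is singular an interpolator may not exist and nothing is known of
    [bhat]. The functional vanishes there, because invertibility of [other_gram] would imply that of
    the full Gram matrix. *)
Lemma column_error_eq0 w :
  (\matrix_(i, q) dot (X i w) (X q w) : 'M[R]_N) \notin unitmx -> column_error w = 0.
Proof.
move=> nA; rewrite /column_error /regression_error.
case: (boolP (other_gram w \in unitmx)) => uB; last by rewrite mul0r.
have pB := psd_unit_posdef (gram_sym w) (gram_ge0 w) uB.
by rewrite (posdef_unit (posdef_gram uRp uon (@RX w) pj pB)) in nA.
Qed.

Lemma column_error_le w :
  is_argmin_norm (interpolators (fun i => X i w) (fun i => dot (X i w) beta + xi i w)) (bhat w) ->
  column_error w <= coef (vsub (bhat w) beta) j ^+ 2.
Proof.
move=> amin; rewrite /column_error /regression_error.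
case: (boolP (other_gram w \in unitmx)) => uB; last by rewrite mul0r sqr_ge0.
have pB := psd_unit_posdef (gram_sym w) (gram_ge0 w) uB.
rewrite mul1r inv0E// (argmin_error uRp uon (@RX w) pj Rbeta (e := other_response w + rv_col xi w) pB amin).
  by rewrite le_eqVlt; apply/orP; left; apply/eqP; do 2!congr (_ ^+ _).
move=> i; rewrite !mxE /other_signal dotBr// [dot _ (fun q => coef beta j * _)]dotC.
have -> : dot (fun q => coef beta j * bv j q) (X i w) = coef beta j * coef (X i w) j.
  by apply: dotZl => //; exact: Rb.
ring.
Qed.

End column_bounds.

(** * The risk *)

Lemma ae_ge0_le_integral_nonmeasurable (R : realType) d (T : measurableType d)
    (P : probability T R) (f g : T -> \bar R) : measurable_fun setT f ->
  (forall w, 0 <= f w)%E -> (forall w, 0 <= g w)%E ->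
  {ae P, forall w, (f w <= g w)%E} -> (\int[P]_w f w <= \int[P]_w g w)%E.
Proof.
move=> mf f0 g0 [A [mA PA hA]].
rewrite (@ge0_negligible_integral _ _ _ P setT A)// integral_mkcond.
apply: ge0_le_integral_nonmeasurable => w; rewrite patchE; case: ifPn => // wA.
move: wA; rewrite inE => -[_ nA]; apply: contrapT => h; apply: nA; exact: (hA w h).
Qed.

Section risk.
Context {R : realType} {p : option nat} {N : nat}.
Variables (S : idx p -> vec R p) (sigma : vec R p) (u : idx p -> vec R p).
Hypothesis cov : is_covariance S sigma u.
Context {d : measure_display} {T : measurableType d}.
Variables (P : probability T R) (beta : vec R p) (sxi : R)
  (X : 'I_N -> T -> vec R p) (xi : 'I_N -> T -> R) (bhat : T -> vec R p).
Hypothesis glm : gaussian_linear_model P S beta sxi X xi bhat.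
Local Notation sg := (zext sigma).
Local Notation coef := (basis_coef u).

(** By Bessel, the first [n] coordinates of the error bound the risk from below. The constants [c l]
    may vanish on part of the indices, which isolates the head or the tail. *)
Lemma risk_ge (n : nat) (c : nat -> R) :
  (forall l, in_dim p l -> ((c l)%:E <= \int[P]_w (column_error u beta X xi l w)%:E)%E) ->
  ((\sum_(l < n) sg l * c l)%:E <=
    \int[P]_w (norm2 (Sigma_sqrt sigma u (vsub (bhat w) beta)) ^+ 2)%:E)%E.
Proof.
move=> hc; have s0 l : 0 <= sg l by exact: (zext_sigma_ge0 cov).
pose g (l : nat) w : R := if in_dim p l then sg l * column_error u beta X xi l w else 0.
have g0 l w : 0 <= g l w.
  by rewrite /g; case: ifP => // _; rewrite mulr_ge0// column_error_ge0.
have mg l : measurable_fun setT (g l).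
  rewrite /g; case: (boolP (in_dim p l)) => pl; last exact: measurable_cst.
  by apply: measurable_funM => //; apply: (measurable_column_error cov glm pl).
apply: (@le_trans _ _ (\int[P]_w (\sum_(l < n) g l w)%:E)%E).
  rewrite (_ : (fun w => _) = (fun w => \sum_(l < n) (g l w)%:E)%E); last first.
    by apply/funext => w; rewrite sumEFin.
  rewrite ge0_integral_sum//; last 2 first.
  - by move=> l; apply/measurable_EFinP.
  - by move=> l w _; rewrite lee_fin.
  rewrite -sumEFin; apply: lee_sum => l _; rewrite /g.
  case: (boolP (in_dim p l)) => pl; last first.
    by rewrite [sg l]zext_out ?(negbTE pl)// mul0r integral0.
  under eq_integral do rewrite EFinM; rewrite ge0_integralZl_EFin//.
  - by rewrite EFinM; apply: lee_wpmul2l; [rewrite lee_fin|exact: hc].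
  - by move=> w _; rewrite lee_fin column_error_ge0.
  - by apply/measurable_EFinP; apply: (measurable_column_error cov glm pl).
apply: ae_ge0_le_integral_nonmeasurable.
- by apply/measurable_EFinP; apply: measurable_sum => l.
- by move=> w; rewrite lee_fin sumr_ge0.
- by move=> w; rewrite lee_fin sqr_ge0.
apply: filterS (glm_bhat glm) => w /= hw; rewrite lee_fin.
set A : 'M[R]_N := \matrix_(i, q) dot (X i w) (X q w).
have RX i : Rp (X i w) by exact: (glm_X_Rp glm).
case: (boolP (A \in unitmx)) => uA; last first.
  rewrite big1 ?sqr_ge0// => l _; rewrite /g; case: ifP => // pl.
  by rewrite (column_error_eq0 cov glm pl uA) mulr0.
have amin := hw (interpolators_nonempty RX (fun i => dot (X i w) beta + xi i w) uA).
have Rbh : Rp (bhat w) by case: amin => -[].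
have Rd : Rp (vsub (bhat w) beta) by apply: Rp_vsub => //; exact: (glm_beta glm).
have := norm2_Sigma_sqrt_ge cov n Rd; apply: le_trans; apply: ler_sum => l _; rewrite /g.
case: ifP => pl; last by rewrite mulr_ge0 ?sqr_ge0.
by rewrite ler_wpM2l//; exact: (column_error_le cov glm pl amin).
Qed.

Variables (b : R) (k : nat).
Let t := tail_trace sigma k.
Hypotheses (N0 : (0 < N)%N) (b24 : 24 <= b) (kN : 4 * k%:R <= N%:R :> R).
Hypothesis kst : is_kstar sigma u b N k.
Variable r : R.
Hypothesis hr : (\int[P]_w (norm2 (Sigma_sqrt sigma u (vsub (bhat w) beta)) ^+ 2)%:E)%E = r%:E.

Let NR : 0 < N%:R :> R. Proof. by rewrite ltr0n. Qed.
Let b0 : 0 < b. Proof. exact: lt_le_trans b24. Qed.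
Let sk0 : 0 < sg k. Proof. by case: (kstar_facts cov b0 N0 kst). Qed.
Let bt : b * N%:R * sg k <= t. Proof. by case: (kstar_facts cov b0 N0 kst). Qed.
Let hhead l : (l < k)%N -> t <= b * N%:R * sg l.
Proof. by case: (kstar_facts cov b0 N0 kst) => _ _; apply. Qed.
Let t0 : 0 < t.
Proof. by apply: lt_le_trans bt; rewrite !mulr_gt0. Qed.
Let s0 l : 0 <= sg l. Proof. exact: (zext_sigma_ge0 cov). Qed.
Let Rbeta : Rp beta. Proof. by exact: (glm_beta glm). Qed.

Let risk_sum (n : nat) (c : nat -> R) :
  (forall l, in_dim p l -> ((c l)%:E <= \int[P]_w (column_error u beta X xi l w)%:E)%E) ->
  \sum_(l < n) sg l * c l <= r.
Proof. by move=> /(risk_ge n); rewrite hr lee_fin. Qed.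

(** The ratio that governs both bias and variance in direction [l]. The choice of [k] makes it cross
    the level 1 / b there: at least 1 / b before [k], at most 1 / b from [k] on. *)
Let snr l : R := sg l * N%:R / t.

Let snr_ge0 l : 0 <= snr l.
Proof. by rewrite divr_ge0 ?(ltW t0)// mulr_ge0// ltW. Qed.

Let snr_tail l : (k <= l)%N -> snr l <= b^-1.
Proof.
move=> kl; rewrite /snr ler_pdivrMr// ler_pdivlMl// mulrCA mulrC -mulrA [N%:R * _]mulrC.
apply: le_trans bt; rewrite -mulrA mulrCA [sg l * _]mulrC !mulrA.
by rewrite ler_pM2l ?mulr_gt0// (zext_sigma_noninc cov).
Qed.

Let snr_head l : (l < k)%N -> b^-1 <= snr l.
Proof.
move=> lk; rewrite /snr ler_pdivlMr// ler_pdivrMl//.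
by have := hhead lk; rewrite -mulrA [N%:R * _]mulrC.
Qed.

Lemma risk_bias_tail :
  norm2 (Sigma_tail_sqrt sigma u k (proj_tail u k beta)) ^+ 2 <= 225 / 2 * r.
Proof.
have h n : \sum_(l < n) tail_sigma sigma k l * coef beta l ^+ 2 <= 225 / 2 * r.
  (* In the tail the ratio is at most 1 / b <= 1 / 24, so 1 + 100 snr <= 6, and (8 / 25) / 36 = 2 /
     225. *)
  pose c (l : nat) := (k <= l)%:R * (coef beta l ^+ 2 * (2 / 225)).
  have hc l : in_dim p l -> ((c l)%:E <= \int[P]_w (column_error u beta X xi l w)%:E)%E.
    move=> pl; apply: (@le_trans _ _ _ _ _ (_ : (_ <= _)%E) (column_error_bias cov glm N0 b24 sk0 bt pl)).
    rewrite lee_fin -/t /c; case: leqP => kl; last first.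
      by rewrite mul0r mulr_ge0// divr_ge0 ?sqr_ge0.
    rewrite mul1r -mulrA ler_wpM2l ?sqr_ge0//.
    have -> : sg l * (10 * N%:R / t) = 10 * snr l by rewrite /snr; ring.
    have h1 : snr l <= 24^-1.
      by apply: (le_trans (snr_tail kl)); rewrite lef_pV2 ?posrE.
    have h2 : (1 + 10 * (10 * snr l)) ^+ 2 <= 36.
      rewrite (_ : 36 = 6 ^+ 2); last by ring.
      by rewrite ler_sqr ?nnegrE; have := snr_ge0 l; lra.
    rewrite [leRHS]mulrC ler_pdivlMr; last by rewrite exprn_gt0//; have := snr_ge0 l; lra.
    by move: h2; lra.
  have := risk_sum n hc; rewrite -(ler_pM2l (_ : 0 < 225 / 2))//; apply: le_trans.
  rewrite mulr_sumr; apply: ler_sum => l _; rewrite /c /tail_sigma.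
  case: leqP => kl; last by rewrite mulr0n !mul0r !mulr0.
  rewrite mulr1n.
  by rewrite le_eqVlt; apply/orP; left; apply/eqP; field.
have c := cvg_bias_tail cov (k := k) Rbeta.
rewrite -(cvg_lim (@Rhausdorff R) c); apply: limr_le; first by apply/cvg_ex; eexists; exact: c.
by near=> n; exact: h.
Unshelve. all: end_near. Qed.

Lemma risk_bias_head :
  norm2 (Sigma_head_invsqrt sigma u k (proj_head u k beta)) ^+ 2 * (t / N%:R) ^+ 2 <=
  b ^+ 2 * (225 / 2) * r.
Proof.
rewrite (bias_head cov k Rbeta).
(* In the head 1 <= b snr, and 24 snr <= b snr, so 1 + 100 snr <= 6 b snr; the constant 2 / 225
   reappears. *)
pose c (l : nat) := (l < k)%:R * (coef beta l ^+ 2 / (b * snr l) ^+ 2 * (2 / 225)).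
have hc l : in_dim p l -> ((c l)%:E <= \int[P]_w (column_error u beta X xi l w)%:E)%E.
  move=> pl; apply: (@le_trans _ _ _ _ _ (_ : (_ <= _)%E) (column_error_bias cov glm N0 b24 sk0 bt pl)).
  rewrite lee_fin -/t /c; case: ltnP => lk; last first.
    by rewrite mul0r mulr_ge0// divr_ge0 ?sqr_ge0.
  rewrite mul1r -mulrA -[leRHS]mulrA ler_wpM2l ?sqr_ge0//.
  have -> : sg l * (10 * N%:R / t) = 10 * snr l by rewrite /snr; ring.
  have h1 : 1 <= b * snr l by rewrite -ler_pdivrMl// mulr1 snr_head.
  have h3 : 24 * snr l <= b * snr l by rewrite ler_wpM2r.
  have h2 : (1 + 10 * (10 * snr l)) ^+ 2 <= (6 * (b * snr l)) ^+ 2.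
    by rewrite ler_sqr ?nnegrE; have := snr_ge0 l; lra.
  have q0 : 0 < (b * snr l) ^+ 2 by rewrite exprn_gt0//; lra.
  have q1 : 0 < (1 + 10 * (10 * snr l)) ^+ 2 by rewrite exprn_gt0//; have := snr_ge0 l; lra.
  have h5 : ((6 * (b * snr l)) ^+ 2)^-1 <= ((1 + 10 * (10 * snr l)) ^+ 2)^-1.
    by rewrite lef_pV2 ?posrE// exprn_gt0//; lra.
  by move: h5; rewrite exprMn invfM (_ : 6 ^+ 2 = 36 :> R); [lra|ring].
have := risk_sum k hc; rewrite -(ler_pM2l (_ : 0 < b ^+ 2 * (225 / 2))); last first.
  by rewrite mulr_gt0// exprn_gt0.
apply: le_trans; rewrite mulr_suml mulr_sumr; apply: ler_sum => l _.
rewrite /c ltn_ord mul1r /snr le_eqVlt; apply/orP; left; apply/eqP.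
have sl : 0 < sg l by apply: lt_le_trans sk0 _; apply: (zext_sigma_noninc cov); exact: ltnW.
by field; rewrite !gt_eqF.
Qed.

(** As x -> x / (1 + x) is increasing and y <= 1, it suffices that [y] is at most the quantity of
    [column_error_variance]. Since N - k >= 3 N / 4, the latter is at least 9 snr / 256, hence at
    least snr / 32. *)
Let column_variance l (y : R) : in_dim p l -> 0 < y -> y <= 1 -> y <= snr l / 32 ->
  ((sxi ^+ 2 * (y / 2) ^+ 2 / (48 * N%:R * sg l) * (1 / 32))%:E <=
    \int[P]_w (column_error u beta X xi l w)%:E)%E.
Proof.
move=> pl y0 y1 yl; have kN' : (k < N)%N.
  rewrite -(ltr_nat R); move: kN NR (ler0n R k); lra.
have sl : 0 < sg l by exact: (zext_sigma_gt0 cov).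
have := column_error_variance cov glm N0 b24 sk0 bt pl kN' erefl; rewrite -/t.
set x := sg l * _ / 2; apply: le_trans; rewrite lee_fin.
have yx : y <= x.
  apply: (le_trans yl); rewrite /x /snr.
  have -> : sg l * N%:R / t / 32 = sg l / (t * N%:R) * (N%:R ^+ 2 / 32).
    by field; rewrite !gt_eqF.
  have -> : sg l * ((N%:R - k%:R) ^+ 2 / (8 * N%:R * t)) / 2 =
      sg l / (t * N%:R) * ((N%:R - k%:R) ^+ 2 / 16) by field; rewrite !gt_eqF.
  rewrite ler_wpM2l//; first by rewrite divr_ge0// ltW// mulr_gt0.
  have : (3 / 4 * N%:R) ^+ 2 <= (N%:R - k%:R) ^+ 2 :> R.
    rewrite ler_sqr ?nnegrE; move: kN NR (ler0n R k); lra.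
  by rewrite exprMn; have := sqr_ge0 (N%:R : R); lra.
have h : y / 2 <= x / (1 + x).
  have x1 : 0 < 1 + x by lra.
  rewrite ler_pdivlMr//.
  have : y * x <= x by rewrite ler_piMl//; lra.
  lra.
rewrite ler_wpM2r// ler_wpM2r//; first by rewrite invr_ge0 ltW// !mulr_gt0.
rewrite ler_wpM2l ?sqr_ge0// ler_sqr ?nnegrE//; first by lra.
by apply: le_trans h; lra.
Qed.

Let b1 : b^-1 <= 1.
Proof. by rewrite invf_le1//; move: b24; lra. Qed.

Lemma risk_variance_head :
  sxi ^+ 2 * k%:R / N%:R <= b ^+ 2 * (64 * 64 * 48 * 32) * r.
Proof.
(* Here y = 1 / (32 b), so that squaring y / 2 produces b^2 and 64 twice; 48 and 32 come from
   [column_variance]. The factor 1 / sg l cancels the weight in [risk_sum], and all [k] indices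
   contribute equally. *)
pose c (l : nat) := (l < k)%:R * (sxi ^+ 2 * (b^-1 / 32 / 2) ^+ 2 / (48 * N%:R * sg l) * (1 / 32)).
have hc l : in_dim p l -> ((c l)%:E <= \int[P]_w (column_error u beta X xi l w)%:E)%E.
  move=> pl; rewrite /c; case: ltnP => lk; last first.
    by rewrite mul0r; apply: integral_ge0 => w _; rewrite lee_fin column_error_ge0.
  rewrite [X in (X)%:E]mul1r; apply: column_variance => //.
  - by rewrite divr_gt0// invr_gt0.
  - by move: b1; lra.
  - by rewrite ler_pM2r// snr_head.
have := risk_sum k hc; rewrite -(ler_pM2l (_ : 0 < b ^+ 2 * (64 * 64 * 48 * 32))); last first.
  by rewrite mulr_gt0// exprn_gt0.
apply: le_trans; rewrite mulr_sumr.
have -> : sxi ^+ 2 * k%:R / N%:R = \sum_(l < k) sxi ^+ 2 / N%:R.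
  by rewrite sumr_const card_ord -[RHS]mulr_natr mulrAC.
apply: ler_sum => l _; rewrite /c ltn_ord mulr1n le_eqVlt; apply/orP; left; apply/eqP.
have sl : 0 < sg l by apply: lt_le_trans sk0 _; apply: (zext_sigma_noninc cov); exact: ltnW.
by field; rewrite !gt_eqF.
Qed.

Lemma risk_variance_tail :
  sxi ^+ 2 * N%:R * tail_trace2 sigma k / t ^+ 2 <= (64 * 64 * 48 * 32) * r.
Proof.
have r0 : 0 <= r.
  by rewrite -lee_fin -hr; apply: integral_ge0 => w _; rewrite lee_fin sqr_ge0.
have h n : \sum_(l < n) sxi ^+ 2 * N%:R / t ^+ 2 * tail_sigma sigma k l ^+ 2 <= (64 * 64 * 48 * 32) * r.
  pose c (l : nat) := (k <= l)%:R * (sxi ^+ 2 * (snr l / 32 / 2) ^+ 2 / (48 * N%:R * sg l) * (1 / 32)).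
  have hc l : in_dim p l -> ((c l)%:E <= \int[P]_w (column_error u beta X xi l w)%:E)%E.
    move=> pl; rewrite /c; case: leqP => kl; last first.
      by rewrite mul0r; apply: integral_ge0 => w _; rewrite lee_fin column_error_ge0.
    rewrite [X in (X)%:E]mul1r; apply: column_variance => //.
    - by rewrite divr_gt0// divr_gt0// mulr_gt0// (zext_sigma_gt0 cov).
    - by have := snr_tail kl; move: b1; lra.
  have := risk_sum n hc; rewrite -(ler_pM2l (_ : 0 < 64 * 64 * 48 * 32 :> R))//.
  apply: le_trans; rewrite mulr_sumr; apply: ler_sum => l _; rewrite /c /tail_sigma.
  case: leqP => kl; last by rewrite mul0r expr0n !mulr0.
  rewrite mulr1n /snr le_eqVlt; apply/orP; left; apply/eqP.
  (* Beyond the dimension [sg l] is 0, and with the convention that 0 has inverse 0 both sides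
     vanish. *)
  have [sl|sl] := eqVneq (sg l) 0; first by rewrite sl !(mul0r, mulr0, expr0n, invr0).
  by field; rewrite sl !gt_eqF.
set q := sxi ^+ 2 * N%:R / t ^+ 2.
have q0 : 0 <= q by rewrite divr_ge0 ?sqr_ge0// mulr_ge0 ?sqr_ge0// ltW.
have -> : sxi ^+ 2 * N%:R * tail_trace2 sigma k / t ^+ 2 = q * tail_trace2 sigma k.
  by rewrite /q mulrAC.
(* [q] vanishes exactly when the noise does; otherwise dividing by it reduces the claim to partial
   sums. *)
have [->|qn] := eqVneq q 0; first by rewrite mul0r mulr_ge0.
have qp : 0 < q by rewrite lt0r qn.
rewrite -ler_pdivlMl//; apply: nneg_sum_le => [l|n]; first exact: sqr_ge0.
by rewrite ler_pdivlMl// mulr_sumr; exact: h.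
Qed.

End risk.

Theorem theorem10 (R : realType) (kappa : R) :
  is_kappa_DM kappa ->
  exists c0 c1 : R, 0 < c0 /\ 0 < c1 /\
  forall (p : option nat) (N : nat)
    (S : idx p -> vec R p) (sigma : vec R p) (u : idx p -> vec R p)
    (d : measure_display) (T : measurableType d) (P : probability T R)
    (beta : vec R p) (sxi : R)
    (X : 'I_N -> T -> vec R p) (xi : 'I_N -> T -> R) (bhat : T -> vec R p)
    (b : R) (k : nat),
  is_covariance S sigma u ->
  gaussian_linear_model P S beta sxi X xi bhat ->
  c0 <= N%:R ->
  Num.max (4 / kappa) 24 <= b ->
  is_kstar sigma u b N k ->
  k%:R < N%:R / 4 :> R ->
  ((c1 / b ^+ 2 *
    Num.max (sxi ^+ 2 * k%:R / N%:R)
   (Num.max (sxi ^+ 2 * N%:R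
               * trace (fun v => Sigma_tail sigma u k (Sigma_tail sigma u k v))
               / trace (Sigma_tail sigma u k) ^+ 2)
   (Num.max (norm2 (Sigma_tail_sqrt sigma u k (proj_tail u k beta)) ^+ 2)
            (norm2 (Sigma_head_invsqrt sigma u k (proj_head u k beta)) ^+ 2
               * (trace (Sigma_tail sigma u k) / N%:R) ^+ 2))))%:E
   <= 'E_P[fun w => (norm2 (Sigma_sqrt sigma u (vsub (bhat w) beta)) ^+ 2)%R])%E.
Proof.
move=> _; have hC : 225 / 2 <= 64 * 64 * 48 * 32 :> R.
  have h1 : 225 / 2 <= 64 * 64 :> R by lra.
  have h2 : 1 <= 48 * 32 :> R by lra.
  by apply: (le_trans h1); rewrite -[leRHS]mulrA ler_peMr// mulr_ge0.
(* [c0 = 1] only has to make [N] positive. [c1] is the inverse of the variance constant, which by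
   [hC] also dominates the bias constant 225 / 2. *)
exists 1, (64 * 64 * 48 * 32)^-1; split => //; split; first by rewrite invr_gt0.
move=> p N S sigma u d T P beta sxi X xi bhat b k cov glm N1 hb kst kN.
have N0 : (0 < N)%N by rewrite -(ltr_nat R); move: N1; lra.
have b24 : 24 <= b by apply: le_trans hb; rewrite le_max lexx orbT.
have b0 : 0 < b by move: b24; lra.
have kN' : 4 * k%:R <= N%:R :> R by move: kN; lra.
rewrite (trace_Sigma_tail2 cov) (trace_Sigma_tail cov) unlock.
have : (0 <= \int[P]_w (norm2 (Sigma_sqrt sigma u (vsub (bhat w) beta)) ^+ 2)%:E)%E.
  by apply: integral_ge0 => w _; rewrite lee_fin sqr_ge0.
(* An infinite risk exceeds everything; otherwise it is a real number [r], as the bounds on the four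
   terms suppose. *)
case E : (\int[P]_w _)%E => [r| |]//; last by move=> _; rewrite leey.
rewrite lee_fin => r0.
have b2 : 1 <= b ^+ 2 by rewrite expr_ge1// ?(ltW b0)//; move: b24; lra.
have h1 := risk_variance_head cov glm N0 b24 kN' kst E.
have h2 := risk_variance_tail cov glm N0 b24 kN' kst E.
have h3 := risk_bias_tail cov glm N0 b24 kst E.
have h4 := risk_bias_head cov glm N0 b24 kst E.
(* The two tail bounds carry no factor b^2; since b >= 1 they are weakened to the common form. *)
have br : r <= b ^+ 2 * r by rewrite ler_peMl.
rewrite lee_fin mulrC -ler_pdivlMr; last by rewrite divr_gt0// ?exprn_gt0// invr_gt0.
have -> : r / ((64 * 64 * 48 * 32)^-1 / b ^+ 2) = b ^+ 2 * (64 * 64 * 48 * 32) * r.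
  by field; rewrite gt_eqF.
rewrite !ge_max h1/=; apply/and3P; split.
- by apply: (le_trans h2); rewrite -[leRHS]mulrA [leRHS]mulrCA ler_pM2l.
- by apply: (le_trans h3); rewrite -[leRHS]mulrA [leRHS]mulrCA ler_pM.
- by apply: (le_trans h4); rewrite ler_wpM2r// ler_wpM2l// sqr_ge0.
Qed.
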